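(* Let $N\ge4$, $R>0$, $B_R=B(0,R)\subset\mathbb{R}^N$ and $2^*=\frac{2N}{N-2}$. There exist a sequence $(p_k)_{k\ge0}$ with $p_k<2^*$ for all $k\ge0$ and $\lim_{k\to+\infty}p_k=2^*$, and a sequence $(u_k)_{k\ge0}$ of positive radial solutions of $$-\Delta u_k+u_k=u_k^{p_k-1}\ \text{ in }B_R,\qquad\partial_\nu u_k=0\ \text{ on }\partial B_R,$$ which is of type $B$, that is, there exist numbers $\lambda_k>0$ with $\lambda_k\to0$ as $k\to+\infty$ such that $$u_k=B_{\lambda_k}+o(1)\quad\text{in }H^1(B_R)\ \text{ as }k\to+\infty.$$
   Context: $\Delta=\sum_i\partial_{x_i}^2$ and $\partial_\nu$ is the outward normal derivative. For $\lambda>0$, $B_\lambda(x)=[N(N-2)]^{\frac{N-2}{4}}\left(\frac{\lambda}{\lambda^2+|x|^2}\right)^{\frac{N-2}{2}}$. *)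

(* Defs.v *)
From HB Require Import structures.
From mathcomp Require Import all_boot all_order all_algebra.
From mathcomp Require Import all_classical all_reals all_analysis.

Set Implicit Arguments.
Unset Strict Implicit.
Unset Printing Implicit Defensive.

Import Order.TTheory GRing.Theory Num.Theory.
Import numFieldNormedType.Exports.

Local Open Scope classical_set_scope.
Local Open Scope ring_scope.

Section measurable_rV.
Context {K : realType} (n : nat).

Definition rV_coord (i : 'I_n) (x : 'rV[K]_n) : measurableTypeR K := x ord0 i.

Let rV_set0 : g_sigma_preimage rV_coord set0.
Proof. exact: sigma_algebra0. Qed.

Let rV_setC A : g_sigma_preimage rV_coord A -> g_sigma_preimage rV_coord (~` A).
Proof. exact: sigma_algebraC. Qed.

Let rV_bigcup (F : _^nat) : (forall i, g_sigma_preimage rV_coord (F i)) ->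
  g_sigma_preimage rV_coord (\bigcup_i (F i)).
Proof. exact: sigma_algebra_bigcup. Qed.

HB.instance Definition _ :=
  @isMeasurable.Build (measure_tuple_display default_measure_display)
    'rV[K]_n (g_sigma_preimage rV_coord) rV_set0 rV_setC rV_bigcup.

End measurable_rV.

Section measurable_rV_fun.
Context {K : realType} (n : nat).

Lemma measurable_rV_coord (i : 'I_n) :
  measurable_fun [set: 'rV[K]_n] (rV_coord i).
Proof.
move=> _ Y mY; rewrite setTI; apply: sub_sigma_algebra => /=.
rewrite -bigcup_seq/=; exists i => /=; first by rewrite mem_index_enum.
by exists Y => //; rewrite setTI.
Qed.

End measurable_rV_fun.

Lemma measurable_fun_rV {K : realType} n d (T : measurableType d) (f : T -> 'rV[K]_n) :
  (forall i, measurable_fun [set: T] (rV_coord i \o f)) ->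
  measurable_fun [set: T] f.
Proof.
move=> mf; suff : g_sigma_preimage (fun i => rV_coord i \o f) `<=` measurable.
  rewrite g_sigma_preimage_comp => prefS _ A mA.
  by apply: prefS; exists A.
apply: smallest_sub; first exact: sigma_algebra_measurable.
case: n f mf => [|m] f mf /=; first by rewrite big_ord0.
rewrite -bigcup_mkord_ord; apply: bigcup_sub => i Ii.
by move=> A [B mB <-]; exact: mf.
Qed.

Section lebesgue_rV.
Context {K : realType}.

Definition rV_cons n (p : measurableTypeR K * 'rV[K]_n) : 'rV[K]_n.+1 :=
  row_mx (p.1%:M : 'rV[K]_1) p.2.

Definition rV_uncons n (x : 'rV[K]_n.+1) : measurableTypeR K * 'rV[K]_n :=
  (x ord0 ord0, \row_j x ord0 (lift ord0 j)).

Lemma rV_cons0 n (p : measurableTypeR K * 'rV[K]_n) :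
  rV_cons p ord0 ord0 = p.1.
Proof.
by rewrite mxE; case: splitP => // j; rewrite !ord1 mxE /= mulr1n.
Qed.

Lemma rV_consS n (p : measurableTypeR K * 'rV[K]_n) j :
  rV_cons p ord0 (lift ord0 j) = p.2 ord0 j.
Proof.
rewrite mxE; case: splitP => [k|k /= /eqP]; first by rewrite ord1.
by rewrite /bump leq0n !add1n eqSS => /eqP jk; congr (_ _ _); exact: val_inj.
Qed.

Lemma rV_consK n : cancel (@rV_cons n) (@rV_uncons n).
Proof.
case=> a v; rewrite /rV_uncons rV_cons0; congr pair.
by apply/rowP => j; rewrite mxE rV_consS.
Qed.

Lemma rV_indexP n (i : 'I_n.+1) : i = ord0 \/ exists j, i = lift ord0 j.
Proof.
have [->|] := eqVneq i ord0; [by left|rewrite eq_sym => /unlift_some[j -> _]].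
by right; exists j.
Qed.

Lemma measurable_rV_cons n : measurable_fun [set: _] (@rV_cons n).
Proof.
apply: measurable_fun_rV => i; have [->|[j ->]] := rV_indexP i.
  by rewrite (_ : _ \o _ = fst)//; apply/funext => p; exact: rV_cons0.
rewrite (_ : _ \o _ = rV_coord j \o snd).
  by apply: measurableT_comp => //; exact: measurable_rV_coord.
by apply/funext => p; exact: rV_consS.
Qed.

Lemma measurable_rV_uncons n : measurable_fun [set: _] (@rV_uncons n).
Proof.
apply: measurable_fun_pair; first exact: (measurable_rV_coord ord0).
apply: measurable_fun_rV => j.
rewrite (_ : _ \o _ = rV_coord (lift ord0 j)); first exact: measurable_rV_coord.
by apply/funext => x /=; rewrite /rV_coord mxE.
Qed.

Section step.
Context (n : nat) (mu : {sigma_finite_measure set 'rV[K]_n -> \bar K}).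
Local Open Scope ereal_scope.

Definition lebesgue_rV_step : set 'rV[K]_n.+1 -> \bar K :=
  pushforward (@lebesgue_measure K \x mu) (@rV_cons n).

Let mcons (A : set 'rV[K]_n.+1) : measurable A ->
  measurable (@rV_cons n @^-1` A).
Proof.
by move=> mA; rewrite -[X in measurable X]setTI; exact: measurable_rV_cons.
Qed.

Let step0 : lebesgue_rV_step set0 = 0.
Proof. by rewrite /lebesgue_rV_step /pushforward preimage_set0 measure0. Qed.

Let step_ge0 A : 0 <= lebesgue_rV_step A.
Proof. by rewrite /lebesgue_rV_step /pushforward; exact: measure_ge0. Qed.

Let step_sigma_additive : semi_sigma_additive lebesgue_rV_step.
Proof.
move=> F mF tF mUF; rewrite /lebesgue_rV_step /pushforward preimage_bigcup.
apply: measure_semi_sigma_additive.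
- by move=> k; exact: mcons.
- apply/trivIsetP => /= i j _ _ ij; rewrite -preimage_setI.
  by move/trivIsetP : tF => /(_ _ _ _ _ ij) ->//; rewrite preimage_set0.
- by rewrite -preimage_bigcup; exact: mcons.
Qed.

HB.instance Definition _ := isMeasure.Build _ _ _ lebesgue_rV_step
  step0 step_ge0 step_sigma_additive.

Let step_sigma_finite : sigma_finite setT lebesgue_rV_step.
Proof.
have /sigma_finiteP[F [FT ndF Foo]] := sigma_finiteT (@lebesgue_measure K).
have /sigma_finiteP[G [GT ndG Goo]] := sigma_finiteT mu.
exists (fun k => @rV_uncons n @^-1` (F k `*` G k)).
  rewrite -preimage_bigcup -(preimage_setT (@rV_uncons n)); congr (_ @^-1` _).
  rewrite -setXTT FT GT predeqE => -[x y]; split.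
    move=> [/= [i _ Fix] [j _ Gjy]]; exists (maxn i j) => //; split.
    - by move: x Fix; exact/subsetPset/ndF/leq_maxl.
    - by move: y Gjy; exact/subsetPset/ndG/leq_maxr.
  by move=> [i _ []/= ? ?]; split; exists i.
move=> k; have [mF Fk] := Foo k; have [mG Gk] := Goo k; split.
  rewrite -[X in measurable X]setTI; apply: measurable_rV_uncons => //.
  exact: measurableX.
rewrite /lebesgue_rV_step /pushforward -comp_preimage.
rewrite (_ : _ \o _ = id); last by apply/funext; exact: rV_consK.
by rewrite preimage_id product_measure1E// lte_mul_pinfty// ge0_fin_numE.
Qed.

HB.instance Definition _ := Measure_isSigmaFinite.Build _ _ _
  lebesgue_rV_step step_sigma_finite.

End step.

End lebesgue_rV.

Fixpoint lebesgue_rV {K : realType} (n : nat) :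
    {sigma_finite_measure set 'rV[K]_n -> \bar K} :=
  if n is m.+1 then lebesgue_rV_step (lebesgue_rV m)
  else @dirac _ 'rV[K]_0 0 K.

Section lebesgue_rV_box.
Local Open Scope ereal_scope.

Lemma lebesgue_rV_box {K : realType} n (A : 'I_n -> set (measurableTypeR K)) :
  (forall i, measurable (A i)) ->
  lebesgue_rV n [set x | forall i, A i (x ord0 i)] =
  \prod_(i < n) lebesgue_measure (A i).
Proof.
elim: n A => [|n IHn] A mA.
  by rewrite big_ord0 /= diracE mem_set//= => -[].
rewrite big_ord_recl -IHn// -product_measure1E//.
  congr (product_measure1 _ _ _).
  apply/seteqP; split => -[a v] /=; rewrite -?/(rV_cons (a, v)).
    move=> Aav; split => [|i].
      by have := Aav ord0; rewrite (rV_cons0 (a, v)).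
    by have := Aav (lift ord0 i); rewrite (rV_consS (a, v)).
  move=> [Aa Av] i; have [->|[j ->]] := rV_indexP i.
    by rewrite (rV_cons0 (a, v)).
  by rewrite (rV_consS (a, v)).
rewrite [X in measurable X](_ : _ = \bigcap_(i in [set: 'I_n])
    (rV_coord i @^-1` A (lift ord0 i))).
  apply: fin_bigcap_measurable => // i _.
  by rewrite -[X in measurable X]setTI; exact: measurable_rV_coord.
by apply/seteqP; split => [v Av i _|v Av i]; exact: Av.
Qed.

End lebesgue_rV_box.

Section euclidean.
Context {K : realType} {n : nat}.
Implicit Types (x v : 'rV[K]_n) (f : 'rV[K]_n -> K) (R : K).

(* The library's norm on row vectors is the sup norm: it induces the same
   topology, but balls and spheres must use the Euclidean norm. *)
Definition enorm x : K := Num.sqrt (\sum_i x ord0 i ^+ 2).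

Definition eball R : set 'rV[K]_n := [set x | enorm x < R].
Definition ecball R : set 'rV[K]_n := [set x | enorm x <= R].
Definition esphere R : set 'rV[K]_n := [set x | enorm x = R].

Definition partial (i : 'I_n) f : 'rV[K]_n -> K := 'D_(delta_mx ord0 i) f.

Definition laplacian f x : K := \sum_i partial i (partial i f) x.

(* The next two are meant for open sets A. *)
Definition C1_on (A : set 'rV[K]_n) f :=
  forall x, A x -> forall i,
    derivable f x (delta_mx ord0 i) /\ {for x, continuous (partial i f)}.

Definition C2_on (A : set 'rV[K]_n) f :=
  C1_on A f /\ forall i, C1_on A (partial i f).

(* f is C^1 up to the boundary: f and its first derivatives extend
   continuously to the closed ball. *)
Definition C1_closed_ball R f :=
  [/\ C1_on (eball R) f, {within ecball R, continuous f} &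
    forall i, exists2 g : 'rV[K]_n -> K, {within ecball R, continuous g} &
      forall x, eball R x -> g x = partial i f x].

(* One-sided, since f is only meaningful on the closed ball; the outward unit
   normal at a point x of the sphere of radius R is R^-1 *: x. *)
Definition is_normal_derivative R f x (l : K) :=
  t^-1 * (f x - f (x - t *: (R^-1 *: x))) @[t --> 0^'+] --> l.

Definition radial_on (A : set 'rV[K]_n) f :=
  exists v : K -> K, forall x, A x -> f x = v (enorm x).

Definition positive_radial_solution R (p : K) f :=
  [/\ C2_on (eball R) f /\ C1_closed_ball R f,
      forall x, eball R x -> 0 < f x,
      radial_on (ecball R) f,
      forall x, eball R x -> - laplacian f x + f x = f x `^ (p - 1) &
      forall x, esphere R x -> is_normal_derivative R f x 0].

(* The norm of H^1(B_R), for functions of class C^1 in B_R, whose weak and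
   classical gradients agree. *)
Definition H1norm R f : \bar K :=
  sqrte (\int[lebesgue_rV n]_(x in eball R)
    (\sum_i partial i f x ^+ 2 + f x ^+ 2)%:E).

Definition bubble (lam : K) x : K :=
  (n%:R * (n%:R - 2)) `^ ((n%:R - 2) / 4) *
  (lam / (lam ^+ 2 + enorm x ^+ 2)) `^ ((n%:R - 2) / 2).

Definition type_B R (u : nat -> 'rV[K]_n -> K) :=
  exists lam : nat -> K,
    [/\ forall k, 0 < lam k, lam k @[k --> \oo] --> (0 : K) &
        H1norm R (fun x => u k x - bubble (lam k) x) @[k --> \oo] --> 0%E].

End euclidean.

Definition critical_exponent (K : realType) (N : nat) : K :=
  2 * N%:R / (N%:R - 2).

(* Main.v *)
Require Import Defs.
From mathcomp Require Import all_boot all_order all_algebra.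
From mathcomp Require Import all_classical all_reals all_analysis.
From mathcomp Require Import measurable_realfun.
From mathcomp Require Import ring lra.
Import Order.TTheory GRing.Theory Num.Theory.
Import numFieldNormedType.Exports.
Local Open Scope classical_set_scope.
Local Open Scope ring_scope.

Set Implicit Arguments.
Unset Strict Implicit.
Unset Printing Implicit Defensive.

(* The solution is sought as u(x) = alpha w(kappa |x|), where w(0) = 1 and w
   solves the radial equation w'' + (N - 1) w' / s + w ^ q - e w = 0 with
   q = p - 1, e = kappa ^ -2 and alpha ^ (q - 1) = kappa ^ 2; the Neumann
   condition becomes w'(S) = 0 at S = kappa R. Put d = kappa ^ (-1/2) and let q
   run over [q* - d, q*], where q* = 2* - 1. By the Pohozaev identity, w
   exceeds a power barrier or w' becomes positive before S when q = q*, whereas w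
   stays below the barrier with w' < 0 up to S when q = q* - d. Hence for some
   intermediate q both inequalities hold in the weak sense on the whole interval,
   with equality in one of them somewhere. The decay estimate w <= C s ^ (2 - N)
   keeps w strictly below the barrier, and a zero of w' before S contradicts
   uniqueness for the initial value problem; so w' vanishes at S. On bounded sets
   w is close to the profile of the bubble as d -> 0, and outside of them the
   decay estimate, uniform in d, bounds the remaining energy. *)

(** * Calculus on the real line *)

(** The size of d comes from the Pohozaev function P, with e = d^4 and S = R d^-2. Below the
    critical exponent the power term adds to P and the mass term e w^2 subtracts. At q* - d the gain
    is a fixed multiple of d, the losses are O(e) on the core and O(e S) = O(d^2) beyond it, so P
    stays positive. At q* only the loss remains and P <= - e I after the core, whereas decay like
    s^(2-N) would force P(S) >= - C' S^(2-N). These conflict if e S^(N-2) I = R^(N-2) d^(8-2N) I is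
    large: automatic for N >= 5, while for N = 4 the power of d is 1 and I must be made large, which
    the logarithm ln M provides. This is where N >= 4 enters.

    The obstacle in the decay estimate is that no boundary condition holds at S for the exponents
    tested, so w(S) is unknown and contributes a slowly decaying part. It is absorbed by the mass
    term: the outward flux at S is nonnegative, and e S^2 = R^2 makes the mass term comparable with
    w(S) S^(N-2). The constants of the estimate are fixed before the matching point M, and M before
    d; otherwise the logarithm could not win. *)

Section calculus.
Context {K : realType}.
Implicit Types (f g : K -> K) (a b x s : K).

Lemma is_derive_add f g x a b : is_derive x 1 f a -> is_derive x 1 g b ->
  is_derive x 1 (fun t => f t + g t) (a + b).
Proof. by move=> fa gb; exact: is_deriveD. Qed.

Lemma is_derive_sub f g x a b : is_derive x 1 f a -> is_derive x 1 g b ->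
  is_derive x 1 (fun t => f t - g t) (a - b).
Proof. by move=> fa gb; exact: is_deriveB. Qed.

Lemma is_derive_opp f x a : is_derive x 1 f a ->
  is_derive x 1 (fun t => - f t) (- a).
Proof. by move=> fa; exact: is_deriveN. Qed.

Lemma is_derive_mul f g x a b : is_derive x 1 f a -> is_derive x 1 g b ->
  is_derive x 1 (fun t => f t * g t) (a * g x + f x * b).
Proof.
move=> fa gb; have := is_deriveM fa gb.
by rewrite /GRing.scale/= addrC (mulrC (g x)).
Qed.

Lemma is_derive_const c x : is_derive x 1 (fun=> c : K) 0.
Proof. exact: is_derive_cst. Qed.

Lemma is_derive_var x : is_derive x 1 (fun t : K => t) 1.
Proof. exact: is_derive_id. Qed.

Lemma is_derive_comp f g x a b : is_derive (g x) 1 f a -> is_derive x 1 g b ->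
  is_derive x 1 (fun t => f (g t)) (a * b).
Proof. by move=> fa gb; exact: is_derive1_comp. Qed.

Lemma is_derive_expn f n x a : is_derive x 1 f a ->
  is_derive x 1 (fun t => f t ^+ n) (n%:R * f x ^+ n.-1 * a).
Proof.
move=> fa; have -> : (fun t => f t ^+ n) = f ^+ n by apply/funext => t; rewrite fctE.
exact: is_deriveX.
Qed.

Lemma is_derive_powR f c x a : 0 < f x -> is_derive x 1 f a ->
  is_derive x 1 (fun t => f t `^ c) (c * f x `^ (c - 1) * a).
Proof.
move=> f0 fa.
exact: (@is_derive_comp (fun u => u `^ c) f _ _ _ (is_derive1_powR _ f0) fa).
Qed.

Lemma is_derive_exp f x a : is_derive x 1 f a ->
  is_derive x 1 (fun t => expR (f t)) (expR (f x) * a).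
Proof. by move=> fa; exact: is_derive_comp. Qed.

Lemma is_derive_continuous f x a : is_derive x 1 f a -> {for x, continuous f}.
Proof. by case=> /derivable1_diffP/differentiable_continuous. Qed.

Lemma continuous_within f a b :
  (forall x, a <= x <= b -> {for x, continuous f}) ->
  {within `[a, b], continuous f}.
Proof.
by move=> cf; apply: continuous_in_subspaceT => x; rewrite inE/= in_itv/= => /cf.
Qed.

Lemma le_of_derive_ge0 f f' a b : a <= b ->
  (forall x, a <= x <= b -> {for x, continuous f}) ->
  (forall x, a < x < b -> is_derive x 1 f (f' x)) ->
  (forall x, a < x < b -> 0 <= f' x) -> f a <= f b.
Proof.
rewrite le_eqVlt => /predU1P[->//|ab] cf df f'0.
have df' x : x \in `]a, b[ -> is_derive x 1 f (f' x) by rewrite in_itv/=; exact: df.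
have [c + fE] := MVT ab df' (continuous_within cf).
by rewrite in_itv/= -subr_ge0 fE => /f'0 c0; rewrite mulr_ge0// subr_ge0 ltW.
Qed.

Lemma le_of_derive_le f g f' g' a b : a <= b ->
  (forall x, a <= x <= b -> {for x, continuous f}) ->
  (forall x, a <= x <= b -> {for x, continuous g}) ->
  (forall x, a < x < b -> is_derive x 1 f (f' x)) ->
  (forall x, a < x < b -> is_derive x 1 g (g' x)) ->
  (forall x, a < x < b -> f' x <= g' x) -> f b - f a <= g b - g a.
Proof.
move=> ab cf cg df dg fg.
have : g a - f a <= g b - f b.
  apply: (@le_of_derive_ge0 (fun x => g x - f x) (fun x => g' x - f' x)) => //.
  - by move=> x abx; apply: continuousB; [exact: cg|exact: cf].
  - by move=> x abx; apply: is_derive_sub; [exact: dg|exact: df].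
  - by move=> x abx; rewrite subr_ge0 fg.
lra.
Qed.

Lemma le_of_derive_le' f g f' g' a b : a <= b ->
  (forall x, a <= x <= b -> is_derive x 1 f (f' x)) ->
  (forall x, a <= x <= b -> is_derive x 1 g (g' x)) ->
  (forall x, a < x < b -> f' x <= g' x) -> f b - f a <= g b - g a.
Proof.
move=> ab df dg fg; apply: (@le_of_derive_le _ _ f' g') => //.
- by move=> x /df/is_derive_continuous.
- by move=> x /dg/is_derive_continuous.
- by move=> x /andP[ax xb]; apply: df; rewrite !ltW.
- by move=> x /andP[ax xb]; apply: dg; rewrite !ltW.
Qed.

Lemma continuousP_eps f x : {for x, continuous f} <->
  forall e : K, 0 < e -> exists2 d : K, 0 < d & forall y : K, `|y - x| < d -> `|f y - f x| < e.
Proof.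
split=> [/cvgrPdist_lt cf e e0|cf].
  have /nbhs_ballP[d d0 df] := cf _ e0; exists d => // y yx.
  by rewrite distrC; apply: df; rewrite -ball_normE/= distrC.
apply/cvgrPdist_lt => e /cf[d d0 df]; apply/nbhs_ballP; exists d => // y.
by rewrite /ball/= => xy; rewrite distrC df// distrC.
Qed.

Lemma first_zero g a b : a <= b ->
  (forall x, a <= x <= b -> {for x, continuous g}) -> g a < 0 -> 0 <= g b ->
  exists z, [/\ a < z, z <= b, g z = 0 & forall x, a <= x < z -> g x < 0].
Proof.
move=> ab cg ga gb; pose Z : set K := [set x | a <= x <= b /\ 0 <= g x].
have Zb : Z b by split; rewrite // ab lexx.
have Zinf : has_inf Z by split; [exists b|exists a => x [/andP[]]].
pose z := inf Z.
have az : a <= z by apply: lb_le_inf; [exists b|move=> x [/andP[]]].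
have zb : z <= b by apply: ge_inf => //; case: Zinf.
have azb : a <= z <= b by rewrite az.
have below x : a <= x < z -> g x < 0.
  move=> /andP[ax xz]; rewrite ltNge; apply/negP => gx.
  have : z <= x.
    apply: ge_inf; first by case: Zinf.
    by split=> //; rewrite ax (le_trans (ltW xz)).
  by rewrite leNgt xz.
have gz0 : 0 <= g z.
  rewrite leNgt; apply/negP => gz.
  have [|d d0 dg] := (continuousP_eps g z).1 (cg _ azb) (- g z); first lra.
  have [x Zx xz] := @inf_adherent _ Z d d0 Zinf.
  have zx : z <= x by apply: ge_inf => //; case: Zinf.
  have := dg x; rewrite ger0_norm ?subr_ge0// => /(_ _)/ltr_normlP[].
    by rewrite /z; lra.
  by case: Zx => _; lra.
have az' : a < z.
  by rewrite lt_neqAle az andbT; apply/eqP => za; rewrite za in ga; lra.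
exists z; split=> //; apply/eqP; rewrite eq_le gz0 andbT leNgt; apply/negP => gz.
have [d d0 dg] := (continuousP_eps g z).1 (cg _ azb) (g z) gz.
pose x := Num.max a (z - d / 2).
have xz : x < z by rewrite gt_max az'/=; lra.
have := dg x; rewrite distrC ger0_norm ?subr_ge0 ?ltW// => /(_ _)/ltr_normlP[].
  have : z - d / 2 <= x by rewrite le_max lexx orbT.
  lra.
by have := below x; rewrite le_max lexx xz => /(_ isT); lra.
Qed.

(** Bootstrap principle: a bound need only be refuted at a first contact point, where it may already
    be used at all earlier points. *)
Lemma continuous_barrier g a b :
  (forall x, a <= x <= b -> {for x, continuous g}) -> g a < 0 ->
  (forall z, a < z <= b -> (forall x, a <= x < z -> g x < 0) -> g z <> 0) ->
  forall x, a <= x <= b -> g x < 0.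
Proof.
move=> cg ga bar x /andP[ax xb]; rewrite ltNge; apply/negP => gx.
have [y /andP[ay yx]||//|z [az zx gz gneg]] := @first_zero g a x ax.
- by apply: cg; rewrite ay (le_trans yx).
- exact: ga.
- by apply: (bar z) => //; rewrite az (le_trans zx).
Qed.

End calculus.

Lemma is_derive_ext (K : realType) (f : K -> K) (x a b : K) :
  is_derive x 1 f a -> a = b -> is_derive x 1 f b.
Proof. by move=> ? <-. Qed.

(** The order of the clauses matters: constants must be caught before the algebraic patterns, and
    differences before sums, a difference being a sum with an opposite. The value of the derivative
    is found by unification; [derive_by] then leaves the positivity conditions of powers and the
    equality with the stated value. *)
Ltac derive_rec := lazymatch goal with
  | |- is_derive _ _ (fun t => t) _ => notypeclasses refine (is_derive_var _)
  | |- is_derive _ _ (fun _ => ?c) _ => notypeclasses refine (is_derive_const c _)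
  | |- is_derive _ _ (fun t => @?f t + - @?g t) _ =>
      notypeclasses refine (@is_derive_sub _ f g _ _ _ _ _); cbv beta; derive_rec
  | |- is_derive _ _ (fun t => @?f t + @?g t) _ =>
      notypeclasses refine (@is_derive_add _ f g _ _ _ _ _); cbv beta; derive_rec
  | |- is_derive _ _ (fun t => - @?f t) _ =>
      notypeclasses refine (@is_derive_opp _ f _ _ _); cbv beta; derive_rec
  | |- is_derive _ _ (fun t => @?f t * @?g t) _ =>
      notypeclasses refine (@is_derive_mul _ f g _ _ _ _ _); cbv beta; derive_rec
  | |- is_derive _ _ (fun t => @?f t ^+ ?n) _ =>
      notypeclasses refine (@is_derive_expn _ f n _ _ _); cbv beta; derive_rec
  | |- is_derive _ _ (fun t => @?f t `^ ?c) _ =>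
      notypeclasses refine (@is_derive_powR _ f c _ _ _ _); cbv beta;
      [ | derive_rec]
  | |- is_derive _ _ (fun t => expR (@?f t)) _ =>
      notypeclasses refine (@is_derive_exp _ f _ _ _); cbv beta; derive_rec
  | |- is_derive _ _ _ _ =>
      first [eassumption
            | match goal with H : forall _, is_derive _ _ _ _ |- _ =>
                notypeclasses refine (H _) end
            | idtac]
  end.

Ltac derive_by := notypeclasses refine (is_derive_ext _ _); [derive_rec | ].

(* [lra] does not treat the inverse of a non-numeral as an atom. *)
Ltac has_var t := match t with context [?v] => is_var v end.
Ltac abstract_inverse x :=
  lazymatch x with
  | GRing.natmul _ ?m => has_var m
  | _ => idtac
  end;
  let v := fresh "inv" in set v := (GRing.inv x) in *; clearbody v.
Ltac invlra :=
  repeat match goal with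
  | |- context [GRing.inv ?x] => abstract_inverse x
  | H : context [GRing.inv ?x] |- _ => abstract_inverse x
  end; lra.

(** * The radial initial value problem *)

Section flow.
Context {K : realType}.
Implicit Types (f g h w k : K -> K) (a b x s : K).

Lemma continuous_local f g x d : 0 < d -> (forall y, `|y - x| < d -> f y = g y) ->
  {for x, continuous g} -> {for x, continuous f}.
Proof.
move=> d0 fg /continuousP_eps cg; apply/continuousP_eps => e /cg[d' d'0 dg].
exists (Num.min d d'); first by rewrite lt_min d0.
move=> y; rewrite lt_min => /andP[yd yd']; rewrite !fg ?subrr ?normr0//.
exact: dg.
Qed.

Lemma is_derive_local f g x d a : 0 < d -> (forall y, `|y - x| < d -> f y = g y) ->
  is_derive x 1 g a -> is_derive x 1 f a.
Proof.
move=> d0 fg; apply: near_eq_is_derive; apply/nbhs_ballP; exists d => // y.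
by rewrite /ball/= distrC => /fg.
Qed.

(** Integrating from -1 puts 0 in the interior of the interval, so that the fundamental theorem also
    gives the two-sided derivative at 0; to the left of 0 the integral vanishes with [g]. *)
Lemma primitive_exists g : (forall x, {for x, continuous g}) ->
  (forall x, x <= 0 -> g x = 0) ->
  exists2 G : K -> K, (forall x, is_derive x 1 G (g x)) &
    (forall x, x <= 0 -> G x = 0).
Proof.
move=> cg g0.
pose G (x : K) := (\int[@lebesgue_measure K]_(t in `[(- 1 : K), x]) g t)%R.
have G0 x : x <= 0 -> G x = 0.
  move=> x0; rewrite /G (@eq_Rintegral _ _ _ _ _ (fun=> 0)) ?Rintegral_cst ?mul0r//.
  by move=> t; rewrite inE/= in_itv/= => /andP[_ tx]; rewrite g0// (le_trans tx).
exists G => // x.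
have [x0|x0] := ltP x 0.
  apply: (@is_derive_local _ (fun=> 0) _ (- x)); first by rewrite oppr_gt0.
    move=> y /ltr_normlP[_ yx]; rewrite G0//; lra.
  by rewrite g0 ?ltW//; exact: is_derive_const.
have [||||dG GE] := @continuous_FTC1_closed K g (-1) x (x + 1).
- by rewrite ltrDl.
- apply: continuous_compact_integrable; first exact: segment_compact.
  by apply: continuous_within.
- by rewrite (lt_le_trans _ x0)// oppr_lt0.
- exact: cg.
by split; [exact: dG|rewrite -derive1E; exact: GE].
Qed.

(* The radial equation in dimension [N = n.+2], with [k s = w'(s) / s]: this
   quotient extends continuously to [0], so nothing is singular there. *)
Definition flow (n : nat) h w k :=
  [/\ w 0 = 1,
      forall s, 0 <= s -> is_derive s 1 w (s * k s),
      forall s, {for s, continuous w} /\ {for s, continuous k},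
      k 0 = - (h 0 / n.+2%:R) &
      forall s, 0 < s ->
        is_derive s 1 (fun s => s ^+ n.+2 * k s) (- (s ^+ n.+1 * h s))].

Lemma continuous_max0 x : {for x, continuous (fun s : K => Num.max 0 s)}.
Proof. by apply: continuous_max => //; exact: cst_continuous. Qed.

Lemma continuous_expn f p x : {for x, continuous f} ->
  {for x, continuous (fun s => f s ^+ p)}.
Proof.
move=> cf; elim: p => [|p IH].
  rewrite (_ : (fun s => f s ^+ 0) = fun=> 1).
    exact: cst_continuous.
  by apply/funext => s; rewrite expr0.
rewrite (_ : (fun s => f s ^+ p.+1) = fun s => f s * f s ^+ p).
  exact: continuousM.
by apply/funext => s; rewrite exprS.
Qed.

(** [G y / y ^+ n.+2] is the mean of [h] for the weight x^(N-1), divided by N. Applied to [h] and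
    [- h], the bound gives the continuity of w'(s) / s at 0. *)
Lemma average_bound (n : nat) h (G : K -> K) c y : 0 < y ->
  (forall x, is_derive x 1 G (Num.max 0 x ^+ n.+1 * h x)) -> G 0 = 0 ->
  (forall x, 0 < x < y -> h x <= c) -> G y / y ^+ n.+2 <= c / n.+2%:R.
Proof.
move=> y0 dG G0 hc; have N0 : n.+2%:R != 0 :> K by rewrite pnatr_eq0.
have dP x : is_derive x 1 (fun t => c / n.+2%:R * t ^+ n.+2) (x ^+ n.+1 * c).
  by derive_by; rewrite /=; field.
have := @le_of_derive_le' _ G _ _ _ 0 y (ltW y0) (fun x _ => dG x) (fun x _ => dP x).
rewrite G0 subr0 expr0n/= mulr0 subr0 => GP.
rewrite ler_pdivrMr ?exprn_gt0//; apply: GP => x /andP[x0 xy].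
by rewrite (max_idPr (ltW x0)) ler_pM2l ?exprn_gt0// hc// x0.
Qed.

(** Two quadratures, of the flux and then of s k(s). Replacing s by [Num.max 0 s] in the integrands
    makes all functions continuous on the whole line, so no one-sided limit at 0 appears. *)
Lemma flow_exists n h : (forall s, {for s, continuous h}) ->
  exists w k, flow n h w k /\ forall s, s <= 0 -> w s = 1.
Proof.
move=> ch; pose g s := Num.max 0 s ^+ n.+1 * h s.
have max0 (s : K) : s <= 0 -> Num.max 0 s = 0 by move=> s0; apply/max_idPl.
have max1 (s : K) : 0 < s -> Num.max 0 s = s by move=> s0; apply/max_idPr/ltW.
have cg s : {for s, continuous g}.
  apply: continuousM; last exact: ch.
  by apply: continuous_expn; exact: continuous_max0.
have [|G dG G0] := primitive_exists cg.
  by move=> s s0; rewrite /g max0// expr0n mul0r.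
pose k s := if s <= 0 then - (h 0 / n.+2%:R) else - (G s / s ^+ n.+2).
have kE s : 0 < s -> k s = - (G s / s ^+ n.+2).
  by move=> s0; rewrite /k leNgt s0.
have k0 s : s <= 0 -> k s = - (h 0 / n.+2%:R) by rewrite /k => ->.
have ck s : {for s, continuous k}.
  have [s0|s0|->] := ltgtP s 0.
  - apply: (@continuous_local _ (fun=> - (h 0 / n.+2%:R)) _ (- s)); first lra.
      by move=> y /ltr_normlP[_ ys]; apply: k0; lra.
    exact: cst_continuous.
  - apply: (@continuous_local _ (fun s => - (G s / s ^+ n.+2)) _ s s0).
      by move=> y /ltr_normlP[ys _]; apply: kE; lra.
    apply: continuousN; apply: continuousM; first exact: is_derive_continuous (dG s).
    apply: continuousV; first by rewrite expf_neq0// gt_eqF.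
    by apply: continuous_expn.
  apply/continuousP_eps => e e0.
  have [d d0 dh] := (continuousP_eps h 0).1 (ch 0) e e0.
  exists d => // y; rewrite subr0 => /ltr_normlP[yd1 yd2].
  have [y0|y0] := leP y 0; first by rewrite !k0// subrr normr0.
  rewrite kE// k0// opprK addrC.
  have dhx x : 0 < x < y -> `|h x - h 0| < e.
    move=> /andP[x0 xy]; apply: dh; rewrite subr0 gtr0_norm//; lra.
  have dG' (x : K) : is_derive x 1 (fun t => - G t) (Num.max 0 x ^+ n.+1 * - h x).
    by derive_by; rewrite mulrN.
  have := @average_bound n h G (h 0 + e) y y0 dG (G0 0 (lexx 0)).
  have := @average_bound n (fun x => - h x) _ (- h 0 + e) y y0 dG'.
  rewrite G0// oppr0 => /(_ erefl) H1 H2.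
  rewrite !mulrDl !mulNr in H1 H2.
  have eN : e / n.+2%:R < e by rewrite ltr_pdivrMr ?ltr0n// ltr_pMr// ltr1n.
  move: (G y / y ^+ n.+2) (h 0 / _) (e / _) eN H1 H2 => X u v ve H1 H2.
  have {}H1 : - X <= - u + v by apply: H1 => x /dhx/ltr_normlP[]; lra.
  have {}H2 : X <= u + v by apply: H2 => x /dhx/ltr_normlP[]; lra.
  by apply/ltr_normlP; split; lra.
pose g2 s := Num.max 0 s * k s.
have cg2 s : {for s, continuous g2}.
  by apply: continuousM; [exact: continuous_max0|exact: ck].
have [|W dW W0] := primitive_exists cg2.
  by move=> s s0; rewrite /g2 max0// mul0r.
have dW1 s : is_derive s 1 (fun s => 1 + W s) (g2 s) by derive_by; rewrite add0r.
exists (fun s => 1 + W s), k; split; last by move=> s s0; rewrite W0// addr0.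
split.
- by rewrite W0// addr0.
- by move=> s s0; have := dW1 s; rewrite /g2 (max_idPr s0).
- by move=> s; split; [exact: is_derive_continuous (dW1 s)|exact: ck].
- by rewrite k0.
- move=> s s0; apply: (@is_derive_local _ (fun s => - G s) _ s) => //.
    move=> y /ltr_normlP[ys _]; have y0 : 0 < y by lra.
    rewrite kE// mulrN; congr (- _); field.
    by rewrite expf_neq0// gt_eqF.
  by apply: is_derive_opp; have := dG s; rewrite /g max1.
Qed.
End flow.

Section flow_comparison.
Context {K : realType} (n : nat).
Implicit Types (f g h w k : K -> K) (a b c A x s t : K).

Lemma flow_w0 h w k : flow n h w k -> w 0 = 1.
Proof. by case. Qed.

Lemma flow_dw h w k s : flow n h w k -> 0 <= s -> is_derive s 1 w (s * k s).
Proof. by case=> _ dw _ _ _; exact: dw. Qed.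

Lemma flow_cw h w k : flow n h w k -> forall s, {for s, continuous w}.
Proof. by case=> _ _ c _ _ s; case: (c s). Qed.

Lemma flow_ck h w k s : flow n h w k -> {for s, continuous k}.
Proof. by case=> _ _ c _ _; case: (c s). Qed.

Lemma flow_k0 h w k : flow n h w k -> k 0 = - (h 0 / n.+2%:R).
Proof. by case. Qed.

Lemma flow_dk h w k s : flow n h w k -> 0 < s ->
  is_derive s 1 (fun t => t ^+ n.+2 * k t) (- (s ^+ n.+1 * h s)).
Proof. by case=> _ _ _ _; exact. Qed.

Lemma continuous_id_expn p (s : K) : {for s, continuous (fun t : K => t ^+ p)}.
Proof. by apply: continuous_expn => //; exact: cvg_id. Qed.

Lemma flow_continuous_moment h w k s : flow n h w k ->
  {for s, continuous (fun t => t ^+ n.+2 * k t)}.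
Proof.
move=> F; apply: continuousM; first exact: continuous_id_expn.
exact: flow_ck F.
Qed.

(** The weight exp(c s^2) suits w' = s k: it increases, so on [0, s] it may be frozen at its value
    in s when the flux is integrated, and the integral of s exp(c s^2) gains the factor 1 / (2 c).
    The estimate is one-sided, with indices exchanged because the flux has derivative - s^(N-1)
    h. *)
Lemma flow_diff_le h1 w1 k1 h2 w2 k2 c A S : flow n h1 w1 k1 -> flow n h2 w2 k2 ->
  0 < c -> 0 <= A ->
  (forall s, 0 <= s <= S -> h1 s - h2 s <= A * expR (c * s ^+ 2)) ->
  forall s, 0 <= s <= S ->
    k2 s - k1 s <= A * expR (c * s ^+ 2) / n.+2%:R /\
    w2 s - w1 s <= A * expR (c * s ^+ 2) / (2 * c * n.+2%:R).
Proof.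
move=> F1 F2 c0 A0 h12.
have N0 : 0 < n.+2%:R :> K by rewrite ltr0n.
have kP s : 0 <= s <= S -> k2 s - k1 s <= A * expR (c * s ^+ 2) / n.+2%:R.
  move=> /andP[]; rewrite le_eqVlt => /predU1P[<-|s0] sS.
    rewrite (flow_k0 F1) (flow_k0 F2) opprK addrC -mulrBl ler_pM2r ?invr_gt0// h12//; lra.
  have sn0 : 0 < s ^+ n.+2 by rewrite exprn_gt0.
  rewrite -(ler_pM2l sn0).
  pose B := A * expR (c * s ^+ 2).
  suff : s ^+ n.+2 * k2 s - s ^+ n.+2 * k1 s - (0 ^+ n.+2 * k2 0 - 0 ^+ n.+2 * k1 0)
      <= B / n.+2%:R * s ^+ n.+2 - B / n.+2%:R * 0 ^+ n.+2.
    by rewrite !expr0n/= mulr0 !mul0r !subr0 -mulrBr [in leRHS]mulrC.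
  apply: (@le_of_derive_le K (fun t => t ^+ n.+2 * k2 t - t ^+ n.+2 * k1 t)
    (fun t => B / n.+2%:R * t ^+ n.+2)
    (fun t => - (t ^+ n.+1 * h2 t) - - (t ^+ n.+1 * h1 t))
    (fun t => t ^+ n.+1 * B) 0 s (ltW s0)).
  - by move=> x _; apply: continuousB; apply: flow_continuous_moment; eassumption.
  - by move=> x _; apply: continuousM; [exact: cst_continuous|exact: continuous_id_expn].
  - by move=> x /andP[x0 _]; exact: is_derive_sub (flow_dk F2 x0) (flow_dk F1 x0).
  - by move=> x _; derive_by; rewrite /=; field; rewrite gt_eqF.
  - move=> x /andP[x0 xs]; rewrite opprK addrC -mulrBr ler_pM2l ?exprn_gt0//.
    apply: le_trans (h12 _ _) _; first by rewrite !ltW// (lt_le_trans xs).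
    by rewrite ler_wpM2l// ler_expR ler_pM2l// lerXn2r// ?nnegrE ltW.
move=> s sS; split; first exact: kP.
move: (sS) => /andP[s0 sleS].
have := @le_of_derive_le' K (fun t => w2 t - w1 t)
  (fun t => A * expR (c * t ^+ 2) / (2 * c * n.+2%:R))
  (fun t => t * k2 t - t * k1 t)
  (fun t => t * (A * expR (c * t ^+ 2) / n.+2%:R)) 0 s s0.
rewrite (flow_w0 F1) (flow_w0 F2) subrr subr0 => H.
apply: le_trans (H _ _ _) _.
- by move=> x /andP[x0 _]; exact: is_derive_sub (flow_dw F2 x0) (flow_dw F1 x0).
- by move=> x _; derive_by; rewrite /=; field; rewrite !gt_eqF.
- move=> x /andP[x0 xs]; rewrite -mulrBr ler_pM2l//; apply: kP.
  by rewrite !ltW// (lt_le_trans xs).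
- by rewrite gerBl divr_ge0// ?mulr_ge0// ?expR_ge0// ?ltW.
Qed.

Lemma flow_diff h1 w1 k1 h2 w2 k2 c A S : flow n h1 w1 k1 -> flow n h2 w2 k2 ->
  0 < c -> 0 <= A ->
  (forall s, 0 <= s <= S -> `|h1 s - h2 s| <= A * expR (c * s ^+ 2)) ->
  forall s, 0 <= s <= S ->
    `|k1 s - k2 s| <= A * expR (c * s ^+ 2) / n.+2%:R /\
    `|w1 s - w2 s| <= A * expR (c * s ^+ 2) / (2 * c * n.+2%:R).
Proof.
move=> F1 F2 c0 A0 h12 s sS.
have [|k21 w21] := flow_diff_le F1 F2 c0 A0 _ sS.
  by move=> t /h12; exact/le_trans/ler_norm.
have [|k12 w12] := flow_diff_le F2 F1 c0 A0 _ sS.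
  by move=> t /h12; rewrite distrC; exact/le_trans/ler_norm.
move: k12 k21 w12 w21; move: (_ / n.+2%:R) (_ / (2 * c * _)) => u v k12 k21 w12 w21.
by split; rewrite ler_norml; apply/andP; split; lra.
Qed.

End flow_comparison.

(** * Picard iteration for a Lipschitz nonlinearity *)

Section picard.
Context {K : realType} (n : nat).
Variables (f : K -> K) (L : K).
Hypotheses (L0 : 0 < L) (fL : forall x y, `|f x - f y| <= L * `|x - y|).
Implicit Types (w k : K -> K) (a b c A x s t : K).

Lemma lipschitz_continuous x : {for x, continuous f}.
Proof.
apply/continuousP_eps => e e0; exists (e / L); first exact: divr_gt0.
move=> y yx; apply: le_lt_trans (fL _ _) _; by rewrite mulrC -ltr_pdivlMr.
Qed.

Let E s : K := expR (L * s ^+ 2).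

(* [L * 2] in the denominator beats the Lipschitz constant by a factor 2 N. *)
Lemma flow_contract w1 k1 w2 k2 v1 v2 A S :
  flow n (f \o v1) w1 k1 -> flow n (f \o v2) w2 k2 -> 0 <= A ->
  (forall s, 0 <= s <= S -> `|v1 s - v2 s| <= A * E s) ->
  forall s, 0 <= s <= S -> `|w1 s - w2 s| <= A / 2 * E s.
Proof.
move=> F1 F2 A0 v12 s sS.
have LA : 0 <= L * A by rewrite mulr_ge0// ltW.
have [|_] := flow_diff F1 F2 L0 LA _ sS.
  move=> t tS /=; apply: le_trans (fL _ _) _.
  by rewrite -mulrA ler_pM2l// v12.
move=> /le_trans; apply.
rewrite -[X in _ <= X]mulr1.
have -> : L * A * expR (L * s ^+ 2) / (2 * L * n.+2%:R) = A / 2 * E s * n.+2%:R^-1.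
  by rewrite /E; field; rewrite gt_eqF//= gt_eqF.
rewrite ler_wpM2l//; first by rewrite mulr_ge0// ?expR_ge0// divr_ge0.
by rewrite invf_le1 ?ltr0n// ler1n.
Qed.

Lemma geometric_small c e : 0 <= c -> 0 < e -> exists i, c * 2^-1 ^+ i < e.
Proof.
move=> c0 e0; exists (Num.bound (c / e)).
rewrite exprVn ltr_pdivrMr ?exprn_gt0// mulrC -ltr_pdivrMr//.
apply: (lt_trans (archi_boundP (divr_ge0 c0 (ltW e0)))).
by rewrite -natrX ltr_nat ltn_expl.
Qed.

(** The iterates contract by 1/2 in the weighted norm, so the intervals [w i s] plus or minus
    [B i s] are nested in i and their lengths tend to 0. The limit is the supremum of the left ends;
    extended by its value at 0 to negative s, it is a fixed point. *)
Lemma picard : exists w k, flow n (f \o w) w k.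
Proof.
have cfw w : (forall s, {for s, continuous w}) -> forall s, {for s, continuous (f \o w)}.
  by move=> cw s; apply: continuous_comp; [exact: cw|exact: lipschitz_continuous].
pose T : Type := {w : K -> K | forall s, {for s, continuous w}}.
have next (w : T) : exists w' : T, (exists k, flow n (f \o sval w) (sval w') k) /\
    (forall s, s <= 0 -> sval w' s = 1).
  case: w => w cw /=; have [w' [k [F w'1]]] := flow_exists n (cfw _ cw).
  by exists (exist _ w' (flow_cw F)); split; [exists k|].
have [Nx NxP] := choice next.
have c1 (s : K) : {for s, continuous (fun=> 1 : K)} by exact: cst_continuous.
pose W i := iter i Nx (exist _ _ c1).
pose w i := sval (W i).
have Wflow i : exists k, flow n (f \o w i) (w i.+1) k by exact: (NxP _).1.
have w1 i s : s <= 0 -> w i s = 1 by case: i => [//|i]; exact: (NxP _).2.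
pose A0 : K := `|f 1| / L + 1.
have A00 : 0 <= A0 by rewrite addr_ge0// divr_ge0// ltW.
have w01 s : 0 <= s -> `|w 1%N s - w 0%N s| <= A0 * E s.
  move=> s0; have [k F] := Wflow 0%N.
  (* The constant starting iterate is itself the flow of the zero source, which brings the first
     increment under [flow_diff]. *)
  have F1 : flow n (fun=> 0) (fun=> 1 : K) (fun=> 0).
    split=> //; [|by move=> x; split; exact: cst_continuous|by rewrite mul0r oppr0|].
      by move=> x _; rewrite mulr0; exact: is_derive_const.
    move=> x x0; apply: (@is_derive_local _ _ (fun=> 0) _ 1) => //.
      by move=> y _; rewrite mulr0.
    by rewrite mulr0 oppr0; exact: is_derive_const.
  have [|x _||_] := flow_diff (A := `|f 1|) (S := s) F F1 L0 _ _ (s := s).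
  - by [].
  - by rewrite /= subr0 ler_peMr// -expR0 ler_expR mulr_ge0 ?sqr_ge0// ltW.
  - by rewrite s0 lexx.
  move=> /le_trans; apply; rewrite mulrAC ler_wpM2r ?expR_ge0//.
  apply: (@le_trans _ _ (`|f 1| / L)); last by rewrite lerDl.
  rewrite ler_wpM2l// lef_pV2 ?posrE ?mulr_gt0 ?ltr0n//.
  by rewrite mulrC mulrA ler_peMl ?(ltW L0)// -natrM ler1n.
have step i s : 0 <= s -> `|w i.+1 s - w i s| <= A0 * 2^-1 ^+ i * E s.
  elim: i s => [|i IH] s s0; first by rewrite expr0 mulr1 w01.
  have [k F] := Wflow i; have [k' F'] := Wflow i.+1.
  rewrite exprSr mulrA; apply: (flow_contract F' F _ _ (S := s)) => //.
  - by rewrite mulr_ge0// exprn_ge0// invr_ge0.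
  - by move=> t /andP[t0 _]; exact: IH.
  - by rewrite s0 lexx.
pose B i s := 2 * (A0 * 2^-1 ^+ i * E s).
have BS i s : B i s = B i.+1 s + A0 * 2^-1 ^+ i * E s.
  by rewrite /B exprSr; field.
have B0 i s : 0 <= B i s.
  by rewrite !mulr_ge0// ?exprn_ge0// ?invr_ge0// expR_ge0.
have lo s i j : 0 <= s -> (i <= j)%N -> w i s - B i s <= w j s - B j s.
  move=> s0 /subnK <-; elim: (j - i)%N => // d; rewrite addSn => IH.
  apply: le_trans IH _; have /ler_normlP[] := step (d + i)%N s s0.
  by rewrite (BS (d + i)%N s); lra.
have hi s i j : 0 <= s -> (i <= j)%N -> w j s + B j s <= w i s + B i s.
  move=> s0 /subnK <-; elim: (j - i)%N => // d; rewrite addSn => IH.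
  apply: le_trans IH; have /ler_normlP[] := step (d + i)%N s s0.
  by rewrite (BS (d + i)%N s); lra.
have lohi s i j : 0 <= s -> w i s - B i s <= w j s + B j s.
  move=> s0; have := lo s i (i + j)%N s0 (leq_addr _ _).
  have := hi s j (i + j)%N s0 (leq_addl _ _).
  by have := B0 (i + j)%N s; lra.
pose V s := sup (range (fun i => w i s - B i s)).
have Vw s i : 0 <= s -> `|V s - w i s| <= B i s.
  move=> s0; have ub : has_sup (range (fun i => w i s - B i s)).
    split; first by exists (w 0%N s - B 0%N s), 0%N.
    by exists (w 0%N s + B 0%N s) => _ [j _ <-]; exact: lohi.
  have h1 : w i s - B i s <= V s by apply: ub_le_sup; [case: ub|exists i].
  have h2 : V s <= w i s + B i s.
    by apply: ge_sup; [case: ub|move=> _ [j _ <-]; exact: lohi].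
  by apply/ler_normlP; split; lra.
pose w' s := V (Num.max 0 s).
have max_ge0 (s : K) : 0 <= Num.max 0 s by rewrite le_max lexx.
have wmax i s : w i (Num.max 0 s) = w i s.
  have [s0|//] := leP s 0; by rewrite !w1.
have w'w s i : `|w' s - w i s| <= B i (Num.max 0 s) by rewrite -wmax Vw.
have cw' s : {for s, continuous w'}.
  apply/continuousP_eps => e e0.
  have e3 : 0 < e / 3 by rewrite divr_gt0.
  have [i iP] := @geometric_small (2 * A0 * E (`|s| + 1)) (e / 3)
    (mulr_ge0 (mulr_ge0 (ler0n _ 2) A00) (expR_ge0 _)) e3.
  have [d d0 dP] := (continuousP_eps _ _).1 (svalP (W i) s) _ e3.
  exists (Num.min d 1); first by rewrite lt_min d0/=.
  move=> y; rewrite lt_min => /andP[yd y1].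
  have Bi t : Num.max 0 t <= `|s| + 1 -> B i (Num.max 0 t) < e / 3.
    move=> ts; apply: le_lt_trans iP; rewrite /B.
    have -> : 2 * A0 * E (`|s| + 1) * 2^-1 ^+ i =
        2 * (A0 * 2^-1 ^+ i * E (`|s| + 1)) by ring.
    rewrite ler_pM2l// ler_wpM2l//; first by rewrite mulr_ge0// exprn_ge0// invr_ge0.
    by rewrite ler_expR ler_pM2l// lerXn2r// nnegrE ?max_ge0// addr_ge0.
  have sB : B i (Num.max 0 s) < e / 3.
    by apply: Bi; rewrite ge_max addr_ge0//= (le_trans (ler_norm _))// lerDl.
  have yB : B i (Num.max 0 y) < e / 3.
    apply: Bi; rewrite ge_max addr_ge0//=.
    have := ler_norm s; have := ltr_normlW y1; lra.
  have := dP y yd; have := w'w s i; have := w'w y i.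
  rewrite -/(w i) => /ler_normlP[u1 u2] /ler_normlP[v1 v2] /ltr_normlP[z1 z2].
  by apply/ltr_normlP; split; lra.
have [W' [k [F W'1]]] := flow_exists n (cfw _ cw').
suff W'E : W' = w' by exists w', k; rewrite -{2}W'E.
(* Both functions are close to [w i.+1]: the limit by construction, its flow by one more
   contraction. A positive distance is thus excluded by a large i. *)
have W'w s : 0 <= s -> W' s = w' s.
  move=> s0; apply/eqP/negPn/negP; rewrite -subr_eq0 -normr_gt0 => d0.
  have [i] := @geometric_small (4 * A0 * E s) _
    (mulr_ge0 (mulr_ge0 (ler0n _ 4) A00) (expR_ge0 _)) d0.
  have -> : 4 * A0 * E s * 2^-1 ^+ i = B i s + B i s by rewrite /B; ring.
  apply/negP; rewrite -leNgt.
  have [k' F'] := Wflow i.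
  have Bi0 : 0 <= 2 * (A0 * 2^-1 ^+ i) by rewrite !mulr_ge0// exprn_ge0// invr_ge0.
  have := flow_contract (S := s) F F' Bi0 _ (s := s).
  have w's t : 0 <= t <= s -> `|w' t - w i t| <= 2 * (A0 * 2^-1 ^+ i) * E t.
    by move=> /andP[t0 _]; have := w'w t i; rewrite (max_idPr t0) /B mulrA.
  rewrite s0 lexx => /(_ w's isT).
  have -> : 2 * (A0 * 2^-1 ^+ i) / 2 * E s = B i s - A0 * 2^-1 ^+ i * E s by rewrite /B; field.
  have := w'w s i.+1; rewrite (max_idPr s0) {1}/B exprSr.
  have -> : 2 * (A0 * (2^-1 ^+ i / 2) * E s) = A0 * 2^-1 ^+ i * E s by field.
  move=> /ler_normlP[u1 u2] /ler_normlP[v1 v2].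
  by apply/ler_normlP; split; lra.
apply/funext => s; have [s0|s0] := leP s 0; last by rewrite W'w// ltW.
have -> : w' s = w' 0 by rewrite /w' (max_idPl s0) (max_idPl (lexx 0)).
by rewrite W'1// -W'w// W'1.
Qed.
End picard.

(** * The clamped nonlinearity and the stability of its solutions *)

Section nonlinearity.
Context {K : realType}.
Implicit Types (x y q e c s S : K).

Definition clamp x : K := Num.min 1 (Num.max 0 x).

Lemma clamp_ge0 x : 0 <= clamp x.
Proof. by rewrite le_min ler01 le_max lexx. Qed.

Lemma clamp_le1 x : clamp x <= 1.
Proof. by rewrite ge_min lexx. Qed.

Lemma clamp_id x : 0 <= x <= 1 -> clamp x = x.
Proof. by move=> /andP[x0 x1]; rewrite /clamp (max_idPr x0) (min_idPr x1). Qed.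

Lemma clamp_le0 x : x <= 0 -> clamp x = 0.
Proof. by move=> x0; rewrite /clamp (max_idPl x0) (min_idPr ler01). Qed.

Lemma clamp_lip x y : `|clamp x - clamp y| <= `|x - y|.
Proof.
wlog xy : x y / y <= x => [H|].
  by have [/H//|/ltW/H] := leP y x; rewrite distrC (distrC y).
have cxy : clamp y <= clamp x.
  by rewrite /clamp le_min ge_min lexx/= ge_min ge_max !le_max lexx xy !orbT.
rewrite !ger0_norm ?subr_ge0//.
have := clamp_ge0 y; have := clamp_le1 x.
have [x0|x0] := leP x 0; first by rewrite (clamp_le0 x0); lra.
have [y1|y1] := leP 1 y.
  have -> : clamp y = 1.
    by rewrite /clamp; apply/min_idPl; rewrite le_max y1 orbT.
  lra.
have cx : clamp x <= x by rewrite /clamp (max_idPr (ltW x0)) ge_min lexx orbT.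
have cy : y <= clamp y by rewrite /clamp le_min (ltW y1) le_max lexx orbT.
lra.
Qed.

Lemma powR_le1 x q : 0 <= x <= 1 -> 0 <= q -> x `^ q <= 1.
Proof.
move=> /andP[x0 x1] q0; have q1 : (1 : K) `^ q = 1 by rewrite powR1.
by rewrite -[leRHS]q1; apply: ge0_ler_powR; rewrite ?nnegrE.
Qed.

Lemma powR_lip q x y : 1 <= q <= 3 -> 0 <= x <= 1 -> 0 <= y <= 1 ->
  `|x `^ q - y `^ q| <= 3 * `|x - y|.
Proof.
move=> /andP[q1 q3]; wlog xy : x y / y <= x => [H x01 y01|].
  have [yx|/ltW yx] := leP y x; first exact: H.
  by rewrite distrC (distrC x) H.
move=> /andP[x0 x1] /andP[y0 y1].
have q0 : 0 <= q by lra.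
rewrite !ger0_norm ?subr_ge0//; last exact: ge0_ler_powR.
have [->|yn0] := eqVneq y 0.
  rewrite powR0; last by rewrite gt_eqF; lra.
  rewrite !subr0; have [->|xn0] := eqVneq x 0.
    by rewrite powR0 ?mulr0//; rewrite gt_eqF; lra.
  have xp : 0 < x by rewrite lt_neqAle eq_sym xn0.
  have : x `^ q <= x by apply: ge1r_powR => //; rewrite xp.
  lra.
have yp : 0 < y by rewrite lt_neqAle eq_sym yn0.
rewrite mulrBr; apply: (@le_of_derive_le' K (fun t => t `^ q) (fun t => 3 * t)
  (fun t => q * t `^ (q - 1)) (fun=> 3)) => //.
- by move=> t /andP[yt _]; apply: is_derive1_powR; lra.
- by move=> t _; derive_by; rewrite mul0r add0r mulr1.
- move=> t /andP[yt tx]; apply: le_trans q3; rewrite ler_piMr//.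
  by apply: powR_le1; lra.
Qed.

(** An exponent at least 1 supplies a factor x that tames the logarithm: x^q1 (1 - x^(q2 - q1)) <=
    (q2 - q1) x (- ln x), and - x ln x <= 1 - x. *)
Lemma powR_lip_exponent x q1 q2 : 0 <= x <= 1 -> 1 <= q1 -> 1 <= q2 ->
  `|x `^ q1 - x `^ q2| <= `|q1 - q2|.
Proof.
move=> /andP[x0 x1]; wlog q12 : q1 q2 / q1 <= q2 => [H h1 h2|].
  have [/H|/ltW/H] := leP q1 q2; first exact.
  by rewrite distrC (distrC q1); exact.
move=> h1 h2; have [->|xn0] := eqVneq x 0.
  by rewrite !powR0 ?subrr ?normr0// gt_eqF//; lra.
have xp : 0 < x by rewrite lt_neqAle eq_sym xn0.
rewrite (distrC q1) !ger0_norm ?subr_ge0//; last by apply: ger_powR; rewrite ?xp.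
have -> : x `^ q2 = x `^ q1 * x `^ (q2 - q1).
  by rewrite -powRD ?xn0 ?implybT//; congr (_ `^ _); ring.
have h : 1 - (q2 - q1) * - ln x <= x `^ (q2 - q1).
  by rewrite /powR (negbTE xn0) mulrN opprK; apply: expR_ge1Dx.
have lnx : x * - ln x <= 1 - x.
  have : x * (1 + - ln x) <= x * expR (- ln x) by rewrite ler_pM2l// expR_ge1Dx.
  by rewrite expRN lnK ?posrE// mulfV//; lra.
have xq : x `^ q1 <= x by apply: ge1r_powR => //; rewrite xp.
have ln0 : 0 <= - ln x by rewrite oppr_ge0 ln_le0.
have l0 : 0 <= (q2 - q1) * - ln x by rewrite mulr_ge0// subr_ge0.
apply: (@le_trans _ _ (x * ((q2 - q1) * - ln x))).
  rewrite -[X in X - _]mulr1 -mulrBr; apply: ler_pM => //; first exact: powR_ge0.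
    by rewrite subr_ge0 powR_le1 ?x0// subr_ge0.
  lra.
rewrite mulrCA ler_piMr ?subr_ge0//; lra.
Qed.

(* Clamping to [0, 1] makes the nonlinearity globally Lipschitz; the solutions
   of interest take values in [0, 1]. *)
Definition nl q e x : K := clamp x `^ q - e * x.

Lemma nl_lip q e x y : 1 <= q <= 3 -> 0 <= e <= 1 ->
  `|nl q e x - nl q e y| <= 4 * `|x - y|.
Proof.
move=> q13 /andP[e0 e1].
have -> : nl q e x - nl q e y = (clamp x `^ q - clamp y `^ q) + e * (y - x).
  by rewrite /nl; ring.
apply: le_trans (ler_normD _ _) _; rewrite normrM (ger0_norm e0) (distrC y).
have p1 := powR_lip q13 (introT andP (conj (clamp_ge0 x) (clamp_le1 x)))
  (introT andP (conj (clamp_ge0 y) (clamp_le1 y))).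
have p2 := clamp_lip x y.
have p3 : e * `|x - y| <= `|x - y| by rewrite ler_piMl.
lra.
Qed.

Definition sol n q e (w k : K -> K) := flow n (nl q e \o w) w k.

Lemma sol_exists n q e : 1 <= q <= 3 -> 0 <= e <= 1 -> exists w k, sol n q e w k.
Proof.
by move=> q13 e01; apply: (@picard _ _ _ 4) => // x y; exact: nl_lip.
Qed.

(** A Gronwall estimate through the maximum B of [|w1 - w2| / E]: the comparison gives B <= (4 B +
    eta) / (8 N), and N >= 2 lets B be absorbed. The second source [h2] is arbitrary, so the same
    bound compares two exponents and compares a solution with the profile. *)
Lemma flow_stability n q e (w1 k1 w2 k2 h2 : K -> K) (eta : K) S :
  1 <= q <= 3 -> 0 <= e <= 1 -> 0 <= S -> 0 <= eta ->
  sol n q e w1 k1 -> flow n h2 w2 k2 ->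
  (forall s, 0 <= s <= S -> `|nl q e (w2 s) - h2 s| <= eta) ->
  forall s, 0 <= s <= S ->
    `|k1 s - k2 s| <= 3 * eta * expR (4 * S ^+ 2) /\
    `|w1 s - w2 s| <= 3 * eta * expR (4 * S ^+ 2).
Proof.
move=> q13 e01 S0 eta0 F1 F2 h2P.
pose E s : K := expR (4 * s ^+ 2).
have E0 s : 0 < E s by exact: expR_gt0.
have cE s : {for s, continuous E}.
  have dE : is_derive s 1 E (E s * (8 * s)).
    by rewrite /E; derive_by => /=; congr (_ * _); ring.
  exact: is_derive_continuous dE.
have [m m0 mP] := @EVT_max K (fun s => `|w1 s - w2 s| / E s) 0 S S0
  (@continuous_within _ _ _ _ (fun s _ =>
     continuousM (continuous_comp (continuousB (flow_cw F1 (s := s)) (flow_cw F2 (s := s)))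
      (@norm_continuous _ _ _)) (continuousV (lt0r_neq0 (E0 s)) (cE s)))).
set B := `|w1 m - w2 m| / E m in mP.
have B0 : 0 <= B by rewrite divr_ge0// ltW.
have wB s : 0 <= s <= S -> `|w1 s - w2 s| <= B * E s.
  by move=> sS; rewrite -ler_pdivrMr//; apply: mP; rewrite in_itv.
have hB s : 0 <= s <= S -> `|nl q e (w1 s) - h2 s| <= (4 * B + eta) * E s.
  move=> sS; apply: le_trans (ler_distD (nl q e (w2 s)) _ _) _.
  have p1 := nl_lip (w1 s) (w2 s) q13 e01; have p2 := h2P s sS; have p3 := wB s sS.
  have p4 : eta <= eta * E s.
    by rewrite ler_peMr// -expR0 ler_expR mulr_ge0// sqr_ge0.
  by rewrite mulrDl -mulrA; lra.
have A0 : 0 <= 4 * B + eta by lra.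
have main := flow_diff F1 F2 (ltr0n K 4) A0 hB.
have N2 : n.+2%:R^-1 <= 2^-1 :> K by rewrite lef_pV2 ?posrE ?ltr0n// ler_nat.
have Bb : B <= B / 4 + eta / 16.
  have [] := main m; first by move: m0; rewrite in_itv.
  move=> _; rewrite -/(E m) mulrAC -ler_pdivrMr// -/B => /le_trans; apply.
  have -> : B / 4 + eta / 16 = (4 * B + eta) * (8^-1 * 2^-1) by field.
  rewrite ler_wpM2l// invfM; have -> : 2 * 4 = 8 :> K by ring.
  by rewrite ler_wpM2l.
have Beta : 4 * B + eta <= 3 * eta by lra.
move=> s sS; have [m1 m2] := main s sS.
have EE : E s <= E S.
  move: sS => /andP[s0 sS].
  by rewrite ler_expR ler_pM2l// lerXn2r// nnegrE// (le_trans s0).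
have bound : (4 * B + eta) * E s <= 3 * eta * E S by apply: ler_pM => //; exact: ltW.
have shrink (r : K) : 1 <= r -> (4 * B + eta) * E s / r <= 3 * eta * E S.
  move=> r1; apply: le_trans bound; rewrite ler_piMr// ?mulr_ge0 ?(ltW (E0 s))//.
  by rewrite invf_le1// (lt_le_trans ltr01).
split; first by apply: le_trans m1 _; rewrite shrink// ler1n.
apply: le_trans m2 _; rewrite shrink//.
by rewrite -[2 * 4]natrM -natrM ler1n.
Qed.

Lemma sol_continuous_exponent n q1 q2 e (w1 k1 w2 k2 : K -> K) S :
  1 <= q1 <= 3 -> 1 <= q2 -> 0 <= e <= 1 -> 0 <= S ->
  sol n q1 e w1 k1 -> sol n q2 e w2 k2 -> forall s, 0 <= s <= S ->
    `|k1 s - k2 s| <= 3 * `|q1 - q2| * expR (4 * S ^+ 2) /\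
    `|w1 s - w2 s| <= 3 * `|q1 - q2| * expR (4 * S ^+ 2).
Proof.
move=> q13 q2_ge1 e01 S0 F1 F2; apply: flow_stability F1 F2 _ => // s _ /=.
rewrite /nl opprD opprK addrACA addNr addr0.
by apply: powR_lip_exponent; rewrite ?clamp_ge0 ?clamp_le1//; case/andP: q13.
Qed.

End nonlinearity.

Section powR_pos.
Context {K : realType}.
Implicit Types (x r s : K).

Lemma powRD_pos x r s : 0 < x -> x `^ (r + s) = x `^ r * x `^ s.
Proof. by move=> x0; rewrite powRD// (gt_eqF x0)/= implybT. Qed.

Lemma powRB_pos x r s : 0 < x -> x `^ (r - s) = x `^ r / x `^ s.
Proof. by move=> x0; rewrite powRB// (gt_eqF x0)/= implybT. Qed.

End powR_pos.

(** * The profile of the bubble *)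

Section profile.
Context {K : realType} (n : nat).
Hypothesis n_gt0 : (0 < n)%N.
Implicit Types (s t : K).

Let D : K := n.+2%:R * n%:R.
Let beta s : K := 1 + s ^+ 2 / D.

(* The bubble normalized by the value 1 at the origin, and its derivative
   divided by [s]. *)
Definition profile s : K := (1 + s ^+ 2 / (n.+2%:R * n%:R)) `^ (- (n%:R / 2)).
Definition profile_slope s : K :=
  - (n.+2%:R^-1 * (1 + s ^+ 2 / (n.+2%:R * n%:R)) `^ (- (n%:R / 2) - 1)).
(* [2* - 1] in dimension [n.+2]. *)
Definition crit_power : K := 1 + 4 / n%:R.

Let n0 : 0 < n%:R :> K. Proof. by rewrite ltr0n. Qed.
Let N0 : 0 < n.+2%:R :> K. Proof. by rewrite ltr0n. Qed.
Let D0 : 0 < D. Proof. exact: mulr_gt0. Qed.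
Let D1 : 1 <= D.
Proof. by rewrite /D -natrM ler1n muln_gt0. Qed.
Let beta1 s : 1 <= beta s.
Proof. by rewrite lerDl mulr_ge0 ?sqr_ge0// invr_ge0 ltW. Qed.
Let beta0 s : 0 < beta s.
Proof. exact: lt_le_trans (beta1 s). Qed.

Lemma profile_gt0 s : 0 < profile s. Proof. by rewrite powR_gt0// beta0. Qed.

Lemma profile_le1 s : profile s <= 1.
Proof.
rewrite /profile -/(beta s) powRN invf_le1 ?powR_gt0//.
apply: le_trans (ler_powR (beta1 s) (_ : 0 <= _)); first by rewrite powRr0.
by rewrite divr_ge0.
Qed.

Lemma profile_slopeE s :
  profile_slope s = - (n.+2%:R^-1 * (profile s / beta s)).
Proof.
rewrite /profile_slope /profile -/(beta s) powRB_pos// powRr1// ltW// beta0.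
Qed.

Lemma profile_slope_lt0 s : profile_slope s < 0.
Proof. by rewrite profile_slopeE oppr_lt0 !mulr_gt0 ?invr_gt0// profile_gt0. Qed.

Let dbeta s : is_derive s 1 beta (2 * s / D).
Proof. by rewrite /beta; derive_by => /=; field; rewrite !gt_eqF. Qed.

Lemma is_derive_profile s : is_derive s 1 profile (s * profile_slope s).
Proof.
rewrite /profile_slope /profile -/(beta s).
notypeclasses refine (is_derive_ext _ _).
  notypeclasses refine (@is_derive_powR _ beta _ _ _ _ _); [exact: beta0|exact: dbeta].
by rewrite /D; field; rewrite !gt_eqF.
Qed.

Let dslope s :
  is_derive s 1 profile_slope (- (n.+2%:R^-1 * ((- (n%:R / 2) - 1) *
    beta s `^ (- (n%:R / 2) - 1 - 1) * (2 * s / D)))).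
Proof.
rewrite /profile_slope.
notypeclasses refine (is_derive_opp _).
notypeclasses refine (is_derive_ext _ _).
  notypeclasses refine (@is_derive_mul _ (fun=> _) _ _ _ _ _ _).
    exact: is_derive_const.
  notypeclasses refine (@is_derive_powR _ beta _ _ _ _ _); [exact: beta0|exact: dbeta].
by rewrite mul0r add0r.
Qed.

Lemma profile_pow s :
  profile s `^ crit_power = profile s / beta s ^+ 2.
Proof.
rewrite /profile -/(beta s) -powRrM.
have -> : - (n%:R / 2) * crit_power = - (n%:R / 2) - 2 :> K.
  by rewrite /crit_power; field; rewrite gt_eqF.
by rewrite powRB_pos// powR_mulrn// ltW// beta0.
Qed.

Lemma profile_flow : flow n (nl crit_power 0 \o profile) profile profile_slope.
Proof.
split.
- by rewrite /profile expr0n/= mul0r addr0 powR1.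
- by move=> s _; exact: is_derive_profile.
- move=> s; split; first exact: is_derive_continuous (is_derive_profile s).
  exact: is_derive_continuous (dslope s).
- rewrite /= /profile_slope /nl /profile expr0n/= !mul0r subr0 addr0 !powR1 mulr1.
  by rewrite clamp_id ?ler01 ?lexx// powR1 mul1r.
- move=> s s0 /=; rewrite /nl mul0r subr0 clamp_id ?profile_le1 ?(ltW (profile_gt0 _))//.
  rewrite profile_pow.
  notypeclasses refine (is_derive_ext _ _).
    notypeclasses refine (@is_derive_mul _ (fun t => t ^+ n.+2) _ _ _ _ _ _).
      notypeclasses refine (is_derive_expn _ (is_derive_var _)).
    exact: dslope.
  rewrite profile_slopeE !powRB_pos// powRr1 ?(ltW (beta0 s))// -/(profile s) /=.
  have NE : n.+2%:R = n%:R + 2 :> K by rewrite -addn2 natrD.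
  have b0 := lt0r_neq0 (beta0 s).
  rewrite !exprS; move: b0; rewrite /beta /D NE => b0.
  by field; rewrite !gt_eqF ?addr_gt0 ?mulr_gt0 ?exprn_gt0 ?addr_gt0.
Qed.

(** The natural constant is D^(n/2); the extra factor D >= 1 gives the same constant as in
    [profile_flux]. *)
Lemma profile_decay s : 0 < s -> s ^+ n * profile s <= D `^ (n%:R / 2 + 1).
Proof.
move=> s0; have s2D : 0 < s ^+ 2 / D by rewrite divr_gt0// exprn_gt0.
have le1 : (s ^+ 2 / D) `^ (n%:R / 2) <= beta s `^ (n%:R / 2).
  by apply: ge0_ler_powR; rewrite ?nnegrE ?ltW//; [exact: divr_gt0|rewrite ltrDr].
rewrite /profile -/(beta s) powRN ler_pdivrMr ?powR_gt0//.
have -> : s ^+ n = (s ^+ 2 / D) `^ (n%:R / 2) * D `^ (n%:R / 2).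
  rewrite -powRM ?(ltW s2D) ?(ltW D0)// divfK ?gt_eqF// -[in RHS]powR_mulrn ?(ltW s0)//.
  by rewrite -powRrM -powR_mulrn ?(ltW s0)//; congr (_ `^ _); field.
rewrite mulrC; apply: ler_pM; rewrite ?powR_ge0//.
by apply: ler_powR; rewrite // lerDl.
Qed.

Lemma profile_flux s : 0 < s ->
  - (s ^+ n.+2 * profile_slope s) <= D `^ (n%:R / 2 + 1).
Proof.
move=> s0; have s2D : 0 < s ^+ 2 / D by rewrite divr_gt0// exprn_gt0.
have p0 : 0 < n%:R / 2 + 1 :> K by rewrite ltr_wpDl// divr_ge0.
have le1 : (s ^+ 2 / D) `^ (n%:R / 2 + 1) <= beta s `^ (n%:R / 2 + 1).
  by apply: ge0_ler_powR; rewrite ?nnegrE ?ltW//; rewrite ltrDr.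
rewrite /profile_slope -/(beta s) mulrN opprK -opprD powRN mulrCA.
apply: (@le_trans _ _ (s ^+ n.+2 / beta s `^ (n%:R / 2 + 1))).
  by rewrite ler_piMl ?divr_ge0 ?powR_ge0 ?exprn_ge0 ?(ltW s0)// invf_le1// ler1n.
have -> : s ^+ n.+2 = (s ^+ 2 / D) `^ (n%:R / 2 + 1) * D `^ (n%:R / 2 + 1).
  rewrite -powRM ?(ltW s2D) ?(ltW D0)// divfK ?gt_eqF// -[in RHS]powR_mulrn ?(ltW s0)//.
  rewrite -powRrM -powR_mulrn ?(ltW s0)//; congr (_ `^ _).
  by rewrite -addn2 natrD; field.
by rewrite ler_pdivrMr ?powR_gt0// mulrC ler_wpM2l ?powR_ge0.
Qed.

(** For N = 4 this makes s^3 [profile s] ^ 2 at least a multiple of 1 / s, the source of the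
    logarithm in the critical Pohozaev bound. *)
Lemma profile_lower s : 1 <= s -> n = 2%N -> s ^- 2 / 2 <= profile s.
Proof.
move=> s1 n2; rewrite /profile n2 divff// powRN powRr1; last first.
  by rewrite addr_ge0// divr_ge0// sqr_ge0.
rewrite -invfM lef_pV2 ?posrE.
- have : 1 <= s ^+ 2 by rewrite exprn_ege1.
  have -> : s ^+ 2 / (4 * 2) = s ^+ 2 * 8^-1 by field.
  lra.
- by rewrite mulr_gt0// exprn_gt0// (lt_le_trans _ s1).
- by rewrite ltr_pwDl// divr_ge0// sqr_ge0.
Qed.

Lemma profile_anti s t : 0 <= s <= t -> profile t <= profile s.
Proof.
move=> /andP[s0 st]; rewrite /profile -/(beta s) -/(beta t) !powRN.
rewrite lef_pV2 ?posrE ?powR_gt0//; apply: ge0_ler_powR;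
  rewrite ?nnegrE ?divr_ge0 ?(ltW (beta0 _))//.
by rewrite lerD2l ler_pM2r ?invr_gt0// lerXn2r// nnegrE// (le_trans s0).
Qed.

Lemma profile_slope_incr s t : 0 <= s <= t -> profile_slope s <= profile_slope t.
Proof.
move=> st; rewrite !profile_slopeE lerN2 ler_pM2l ?invr_gt0//.
apply: ler_pM; rewrite ?invr_ge0 ?(ltW (beta0 _)) ?(ltW (profile_gt0 _))//.
  exact: profile_anti.
case/andP: st => s0 st.
by rewrite lef_pV2 ?posrE// lerD2l ler_pM2r ?invr_gt0// lerXn2r// nnegrE// (le_trans s0).
Qed.

(** The conclusion is the sign of the derivative of s^(n-b) [profile s]: sufficiently far out, the
    profile decays faster than s^(b-n). *)
Lemma profile_steep b s : 0 < b -> (n%:R - b) * D < b * s ^+ 2 ->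
  (n%:R - b) * profile s + s ^+ 2 * profile_slope s < 0.
Proof.
move=> b0 bs; rewrite profile_slopeE.
have -> : (n%:R - b) * profile s + s ^+ 2 * - (n.+2%:R^-1 * (profile s / beta s)) =
  profile s / beta s * ((n%:R - b) * beta s - s ^+ 2 / n.+2%:R).
  by field; rewrite !gt_eqF.
rewrite pmulr_rlt0 ?divr_gt0 ?profile_gt0// -(pmulr_llt0 _ D0) mulrBl.
have -> : (n%:R - b) * beta s * D = (n%:R - b) * (D + s ^+ 2).
  by rewrite /beta; field; rewrite gt_eqF.
have -> : s ^+ 2 / n.+2%:R * D = s ^+ 2 * n%:R by rewrite /D; field; rewrite gt_eqF.
lra.
Qed.

End profile.

(** * Uniform decay of the tail *)

Section inverse.
Context {K : realType}.

Lemma is_derive_inv (f : K -> K) (x a : K) : f x != 0 -> is_derive x 1 f a ->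
  is_derive x 1 (fun t => (f t)^-1) (- (f x ^- 2 * a)).
Proof.
move=> fx0 fa; have := is_deriveV fx0 fa.
by rewrite /GRing.scale/= mulNr.
Qed.

End inverse.

Section radial_solution.
Context {K : realType} (n : nat) (q e : K) (w k : K -> K).
Hypotheses (n_gt1 : (1 < n)%N) (q13 : 1 <= q <= 3) (e01 : 0 <= e <= 1).
Hypothesis wk : sol n q e w k.
Implicit Types (s t b : K).

Lemma sol_dk s : 0 < s ->
  is_derive s 1 k (- (nl q e (w s) + n.+2%:R * k s) / s).
Proof.
move=> s0; have dM := flow_dk wk s0.
apply: (@is_derive_local _ k (fun t => (t ^+ n.+2 * k t) * (t ^+ n.+2)^-1) _ s) => //.
  move=> t /ltr_normlP[ts _]; have t0 : 0 < t by lra.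
  by rewrite mulrAC mulfV ?mul1r// expf_neq0// gt_eqF.
notypeclasses refine (is_derive_ext _ _).
  notypeclasses refine (is_derive_mul dM _).
  notypeclasses refine (is_derive_inv _ _); first by rewrite expf_neq0// gt_eqF.
  by notypeclasses refine (is_derive_expn _ (is_derive_var _)).
have sn0 : s ^+ n != 0 by rewrite expf_neq0// gt_eqF.
by rewrite /= !exprS; field; rewrite sn0 gt_eqF.
Qed.

(* [phi b = s ^ (2 b + 1 - n) (s ^ (n - b) w)'], which increases as long as the
   nonlinearity is dominated by the Hardy term [b (n - b) w / s ^ 2]. *)
Let phi b s := s `^ b * ((n%:R - b) * w s + s ^+ 2 * k s).

Lemma is_derive_phi b s : 0 < s ->
  is_derive s 1 (phi b) (s `^ (b - 1) * (b * (n%:R - b) * w s - s ^+ 2 * nl q e (w s))).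
Proof.
move=> s0; rewrite /phi.
have dk := sol_dk s0; have dw := flow_dw wk (ltW s0).
derive_by; first exact: s0.
rewrite /= powRB_pos// powRr1 ?(ltW s0)//.
have -> : n.+2%:R = n%:R + 2 :> K by rewrite -addn2 natrD.
by field; rewrite gt_eqF.
Qed.

Let psi b s := s `^ (n%:R - b) * w s.

Lemma is_derive_psi b s : 0 < s ->
  is_derive s 1 (psi b) (s `^ (n%:R - 2 * b - 1) * phi b s).
Proof.
move=> s0; rewrite /psi /phi.
have dw := flow_dw wk (ltW s0).
derive_by; first exact: s0.
have -> : s `^ (n%:R - b) = s * s `^ (n%:R - b - 1).
  by rewrite [X in _ = _ * X]powRB_pos// powRr1 ?(ltW s0)//; field; rewrite gt_eqF.
have -> : s `^ (n%:R - 2 * b - 1) = s `^ (n%:R - b - 1) / s `^ b.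
  by rewrite -powRB_pos//; congr (_ `^ _); ring.
by rewrite /=; field; rewrite gt_eqF// powR_gt0.
Qed.

(** Under the smallness hypothesis [phi b] increases, hence is at most its value at S, where
    [k S <= 0] leaves only a multiple of [w S]; integrating the derivative of [psi b] gives the
    bound. The condition 3 b <= n yields (n - b) / (n - 2 b) <= 2. *)
Lemma sol_le_comparison b M S : 0 < b -> 3 * b <= n%:R -> 0 < M <= S ->
  (forall s, M <= s <= S -> k s <= 0) -> 0 <= w S ->
  (forall s, M < s < S -> s ^+ 2 * nl q e (w s) <= b * (n%:R - b) * w s) ->
  forall s, M <= s <= S ->
    s `^ (n%:R - b) * w s <= M `^ (n%:R - b) * w M + 2 * S `^ b * w S * s `^ (n%:R - 2 * b).
Proof.
move=> b0 b3 /andP[M0 MS] k0 wS0 small s /andP[Ms sS].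
have S0 : 0 < S by exact: lt_le_trans MS.
have phi_le t : M <= t <= S -> phi b t <= S `^ b * (n%:R - b) * w S.
  move=> /andP[Mt tS]; apply: (@le_trans _ _ (phi b S)).
    apply: (@le_of_derive_ge0 K (phi b) (fun s => s `^ (b - 1) *
      (b * (n%:R - b) * w s - s ^+ 2 * nl q e (w s)))) => //.
    - move=> x /andP[tx _]; apply: is_derive_continuous (is_derive_phi _ _); lra.
    - by move=> x /andP[tx _]; apply: is_derive_phi; lra.
    - move=> x /andP[tx xS]; rewrite mulr_ge0 ?powR_ge0// subr_ge0 small//.
      by rewrite xS andbT; lra.
  rewrite /phi -mulrA ler_wpM2l ?powR_ge0//.
  by rewrite gerDl mulr_ge0_le0 ?sqr_ge0// k0// MS lexx.
set C := S `^ b * (n%:R - b) * w S in phi_le.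
have C0 : 0 <= C by rewrite !mulr_ge0 ?powR_ge0//; lra.
have n2b : 0 < n%:R - 2 * b by lra.
have Hpsi : psi b s - psi b M <=
    C / (n%:R - 2 * b) * s `^ (n%:R - 2 * b) - C / (n%:R - 2 * b) * M `^ (n%:R - 2 * b).
  apply: (@le_of_derive_le' K (psi b) (fun t => C / (n%:R - 2 * b) * t `^ (n%:R - 2 * b))
    (fun t => t `^ (n%:R - 2 * b - 1) * phi b t)
    (fun t => t `^ (n%:R - 2 * b - 1) * C)).
  - exact: Ms.
  - by move=> x /andP[Mx _]; apply: is_derive_psi; lra.
  - move=> x /andP[Mx _]; derive_by; first lra.
    by rewrite /=; field; rewrite gt_eqF.
  - move=> x /andP[Mx xs]; rewrite ler_wpM2l ?powR_ge0// phi_le// ltW//=; lra.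
have : C / (n%:R - 2 * b) * s `^ (n%:R - 2 * b) <= 2 * S `^ b * w S * s `^ (n%:R - 2 * b).
  rewrite ler_wpM2r ?powR_ge0// ler_pdivrMr// /C.
  have -> : 2 * S `^ b * w S * (n%:R - 2 * b) = S `^ b * (2 * (n%:R - 2 * b)) * w S by ring.
  by rewrite ler_wpM2r// ler_wpM2l ?powR_ge0//; lra.
have : 0 <= C / (n%:R - 2 * b) * M `^ (n%:R - 2 * b).
  by rewrite mulr_ge0 ?powR_ge0// divr_ge0// ltW.
by move: Hpsi; rewrite /psi; lra.
Qed.

End radial_solution.

(* [td_end]: [S] is a zero of [w] or the rescaled radius. *)
Record tail_data (K : realType) (n : nat) (q e : K) (w k : K -> K)
    (d c R M S k0 : K) : Prop := TailData {
  td_n : (1 < n)%N;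
  td_e : 0 <= e <= 1;
  td_sol : sol n q e w k;
  td_q : q = crit_power n - d;
  td_d : 0 <= d;
  td_nd : n%:R * d <= 1 / 4;
  td_M : 1 <= M;
  td_MS : M < S;
  td_c : 1 <= c;
  td_R : 0 < R;
  td_w : forall s, M <= s <= S -> 0 <= w s <= 1;
  td_k : forall s, M <= s <= S -> k s <= 0;
  td_k04 : k0 <= 1 / 4;
  td_k0R : k0 <= R ^+ 2 / (256 * n.+2%:R);
  td_small : forall s, M <= s <= S -> s ^+ 2 * w s `^ (q - 1) <= k0;
  td_wM : M ^+ n * w M <= c;
  td_fM : - (M ^+ n.+2 * k M) <= c;
  td_end : w S = 0 \/ (e * S ^+ 2 = R ^+ 2 /\ 2 * M ^+ n.+2 <= S ^+ n.+2) }.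

Section decay.
Context {K : realType}.

Lemma crit_power_range (n : nat) (d : K) : (1 < n)%N -> 0 <= d -> n%:R * d <= 1 / 4 ->
  [/\ n%:R * (crit_power n - d) = n%:R + 4 - n%:R * d, 1 < crit_power n - d &
      crit_power n - d <= 3].
Proof.
move=> n_gt1 d0 nd; have n2 : 2 <= n%:R :> K by rewrite ler_nat.
have n0 : 0 < n%:R :> K by lra.
have nq : n%:R * (crit_power n - d) = n%:R + 4 - n%:R * d.
  by rewrite /crit_power; field; rewrite gt_eqF.
split=> //; first by rewrite -(ltr_pM2l n0) nq; lra.
by rewrite -(ler_pM2l n0) nq; have := mulr_ge0 (ltW n0) d0; lra.
Qed.

Lemma nl_in01 (q e x : K) : 0 <= x <= 1 -> 0 < q ->
  nl q e x = x * x `^ (q - 1) - e * x.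
Proof. by move=> x01 q0; rewrite /nl clamp_id// mulr_powRB1//; case/andP: x01. Qed.

(** The crude decay, from the comparison with b = 1/4: the power term stays below the Hardy term
    since [k0] <= 1/4 <= (1/4) (n - 1/4), and the linear term has the favourable sign. The last
    summand is the price of an unknown [w S]. *)
Lemma tail_first n (q e : K) w k d c R M S k0 : tail_data n q e w k d c R M S k0 ->
  forall s, M <= s <= S ->
  w s <= c * s `^ (- (n%:R - 1 / 4)) + 2 * w S * (S / s) `^ (1 / 4).
Proof.
move=> T; have [n_gt1 e01 wk qE d0 nd M1 MS c1 R0 w01 kle0 k04 k0R small wM fM endS] := T.
have [nq q_gt1 q_le3] := crit_power_range n_gt1 d0 nd; rewrite -qE in nq q_gt1 q_le3.
have n2 : 2 <= n%:R :> K by rewrite ler_nat.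
move=> s sMS; have /andP[Ms sS] := sMS; have s0 : 0 < s by lra.
have M0 : 0 < M by lra.
have wM01 : 0 <= w M <= 1 by apply: w01; rewrite lexx ltW.
have wS01 : 0 <= w S <= 1 by apply: w01; rewrite lexx ltW.
have /andP[wS0 _] := wS01; have /andP[e0 _] := e01.
have H : s `^ (n%:R - 1 / 4) * w s <= M `^ (n%:R - 1 / 4) * w M +
    2 * S `^ (1 / 4) * w S * s `^ (n%:R - 2 * (1 / 4)).
  apply: (sol_le_comparison wk (S := S)) => //; [by lra|by rewrite M0 ltW|].
  move=> t /andP[Mt tS]; have tMS : M <= t <= S by rewrite !ltW.
  have /andP[wt0 wt1] := w01 _ tMS.
  rewrite (nl_in01 _ (w01 _ tMS)); last lra.
  rewrite mulrBr.
  have h1 : t ^+ 2 * (w t * w t `^ (q - 1)) <= 1 / 4 * w t.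
    by rewrite mulrCA mulrC ler_wpM2r//; exact: le_trans (small _ tMS) k04.
  have h2 := mulr_ge0 (sqr_ge0 t) (mulr_ge0 e0 wt0).
  have h3 : 1 / 4 * w t <= 1 / 4 * (n%:R - 1 / 4) * w t by rewrite ler_wpM2r//; lra.
  lra.
have P0 : 0 < s `^ (n%:R - 1 / 4) by exact: powR_gt0.
rewrite -(ler_pM2l P0); apply: (le_trans H) => {H}; rewrite mulrDr; apply: lerD.
  rewrite powRN mulrCA mulfV ?gt_eqF// mulr1 powRB_pos//.
  rewrite powR_mulrn ?(ltW M0)// mulrAC; apply: le_trans wM.
  rewrite ler_piMr//; first by rewrite mulr_ge0 ?exprn_ge0 ?(ltW M0)//; case/andP: wM01.
  rewrite invf_le1 ?powR_gt0//; apply: le_trans (ler_powR M1 (_ : 0 <= _)); last lra.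
  by rewrite powRr0.
have -> : (S / s) `^ (1 / 4) = S `^ (1 / 4) / s `^ (1 / 4).
  rewrite powRM ?invr_ge0 ?(ltW s0)//; last lra.
  by rewrite -(powR_inv1 (ltW s0)) -powRrM mulN1r powRN.
have -> : n%:R - 2 * (1 / 4) = (n%:R - 1 / 4) - 1 / 4 :> K by field.
rewrite (powRB_pos (n%:R - 1 / 4) (1 / 4) s0).
by rewrite le_eqVlt; apply/orP; left; apply/eqP; ring.
Qed.

Lemma powR_add_le (x y q : K) : 0 <= x -> 0 <= y -> 0 <= q ->
  (x + y) `^ q <= (2 * x) `^ q + (2 * y) `^ q.
Proof.
move=> x0 y0 q0; have [xy|yx] := leP x y.
  rewrite (@le_trans _ _ ((2 * y) `^ q)) ?lerDr ?powR_ge0//.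
  by apply: ge0_ler_powR; rewrite ?nnegrE//; lra.
rewrite (@le_trans _ _ ((2 * x) `^ q)) ?lerDl ?powR_ge0//.
by apply: ge0_ler_powR; rewrite ?nnegrE//; lra.
Qed.

(** The crude decay inserted in the source of the flux. The first part is integrable because n + 1 -
    q (n - 1/4) <= -2; in the second, q <= 3 gives (S/s)^(q/4) <= S/s. *)
Lemma tail_source_bound (n : nat) (c s S wS q : K) : 1 <= c -> 1 <= s -> s <= S -> 0 <= wS ->
  1 < q -> q <= 3 -> n%:R + 15/4 <= n%:R * q ->
  s ^+ n.+1 * (c * s `^ (- (n%:R - 1 / 4)) + 2 * wS * (S / s) `^ (1 / 4)) `^ q <=
  8 * c ^+ 3 * s ^- 2 + 64 * wS `^ q * S * s ^+ n.
Proof.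
move=> c1 s1 sS w0 q1 q3 nq; have s0 : 0 < s by lra.
have S0 : 0 < S by lra.
have q0 : 0 <= q by lra.
have Ss : 1 <= S / s by rewrite ler_pdivlMr// mul1r.
have X0 : 0 <= c * s `^ (- (n%:R - 1 / 4)) by rewrite mulr_ge0 ?powR_ge0//; lra.
have Y0 : 0 <= 2 * wS * (S / s) `^ (1 / 4) by rewrite !mulr_ge0 ?powR_ge0.
apply: le_trans (ler_wpM2l (exprn_ge0 n.+1 (ltW s0)) (powR_add_le X0 Y0 q0)) _.
rewrite mulrDr; apply: lerD.
  rewrite mulrA powRM ?powR_ge0//; last lra.
  rewrite -powRrM mulrCA; apply: ler_pM; rewrite ?powR_ge0//.
  - by rewrite mulr_ge0 ?powR_ge0// exprn_ge0// ltW.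
  - apply: (@le_trans _ _ ((2 * c) `^ 3)); first by apply: ler_powR => //; lra.
    by rewrite powR_mulrn; [rewrite exprMn le_eqVlt; apply/orP; left; apply/eqP; ring|lra].
  - rewrite -(powR_mulrn n.+1 (ltW s0)) -powRD_pos//.
    rewrite -(powR_invn 2 (ltW s0)); apply: ler_powR => //.
    by rewrite -natr1; lra.
have -> : 2 * (2 * wS * (S / s) `^ (1 / 4)) = 4 * wS * (S / s) `^ (1 / 4) by ring.
rewrite powRM ?powR_ge0//; last by rewrite mulr_ge0.
rewrite powRM// -powRrM.
have h4 : 4 `^ q <= 64 :> K.
  apply: (@le_trans _ _ (4 `^ 3)); first by apply: ler_powR => //; lra.
  by rewrite (powR_mulrn 3)//; lra.
have hS : (S / s) `^ (1 / 4 * q) <= S / s.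
  by apply: ler1_powR => //; lra.
have -> : 64 * wS `^ q * S * s ^+ n = s ^+ n.+1 * (64 * wS `^ q * (S / s)).
  by rewrite exprS; field; rewrite gt_eqF.
rewrite ler_wpM2l ?exprn_ge0 ?(ltW s0)//; apply: ler_pM; rewrite ?mulr_ge0 ?powR_ge0//.
by rewrite ler_wpM2r ?powR_ge0.
Qed.

(** Integration of the source from M: 8 c^3 comes from the integrable part and one more c^3 from the
    flux at M. The negative term uses that w decreases, so that w >= [w S]; it is kept in order to
    absorb the middle term. *)
Lemma tail_flux n (q e : K) w k d c R M S k0 : tail_data n q e w k d c R M S k0 ->
  forall s, M <= s <= S ->
  - (s ^+ n.+2 * k s) <= 9 * c ^+ 3 + 64 * k0 * (w S * S ^+ n)
     - e * w S * (s ^+ n.+2 - M ^+ n.+2) / n.+2%:R.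
Proof.
move=> T; have first_bound := tail_first T.
have [n_gt1 e01 wk qE d0 nd M1 MS c1 R0 w01 kle0 k04 k0R small wM fM endS] := T.
have [nq q_gt1 q_le3] := crit_power_range n_gt1 d0 nd; rewrite -qE in nq q_gt1 q_le3.
clear T; move=> s /andP[Ms sS].
have M0 : 0 < M by clear -M1; lra.
have S0 : 0 < S by clear -M0 MS; lra.
have q0 : 0 < q by clear -q_gt1; lra.
have N0 : 0 < n.+1%:R :> K by rewrite ltr0n.
have NN0 : 0 < n.+2%:R :> K by rewrite ltr0n.
have wS01 : 0 <= w S <= 1 by apply: w01; rewrite lexx ltW.
have /andP[wS0 _] := wS01; have /andP[e0 _] := e01.
have wdec t : M <= t <= S -> w S <= w t.
  move=> /andP[Mt tS]; rewrite -lerN2.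
  apply: (@le_of_derive_ge0 K (fun t => - w t) (fun t => - (t * k t))) => //.
  - by move=> x _; apply: continuousN; exact: (flow_cw wk).
  - move=> x /andP[tx _]; apply: is_derive_opp; apply: (flow_dw wk).
    by clear -M0 Mt tx; lra.
  - move=> x /andP[tx xS]; rewrite oppr_ge0 mulr_ge0_le0//; first by clear -M0 Mt tx; lra.
    by apply: kle0; rewrite !ltW//; clear -Mt tx; lra.
pose G t := - (8 * c ^+ 3) * t^-1 + 64 * w S `^ q * S / n.+1%:R * t ^+ n.+1
  - e * w S / n.+2%:R * t ^+ n.+2.
have HG : - (s ^+ n.+2 * k s) - - (M ^+ n.+2 * k M) <= G s - G M.
  apply: (@le_of_derive_le' K (fun t => - (t ^+ n.+2 * k t)) G
    (fun t => - - (t ^+ n.+1 * nl q e (w t)))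
    (fun t => 8 * c ^+ 3 * t ^- 2 + 64 * w S `^ q * S * t ^+ n - e * w S * t ^+ n.+1)).
  - exact: Ms.
  - move=> x /andP[Mx _]; apply: is_derive_opp; apply: (flow_dk wk).
    by clear -M0 Mx; lra.
  - move=> x /andP[Mx _]; rewrite /G; have xn0 : x != 0 by rewrite gt_eqF//; clear -M0 Mx; lra.
    notypeclasses refine (is_derive_ext _ _).
      notypeclasses refine (is_derive_sub _ _).
        notypeclasses refine (is_derive_add _ _).
          notypeclasses refine (is_derive_mul _ _); first derive_rec.
          notypeclasses refine (is_derive_inv (f := fun t => t) _ _); [exact: xn0|derive_rec].
        derive_rec.
      derive_rec.
    by rewrite /=; field; rewrite xn0 !gt_eqF.
  - move=> x /andP[Mx xs]; have xMS : M <= x <= S by rewrite !ltW// (lt_le_trans xs).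
    have xw := w01 _ xMS; rewrite opprK /nl clamp_id// mulrBr.
    have x1 : 1 <= x by clear -M1 Mx; lra.
    apply: lerB.
      apply: le_trans (tail_source_bound c1 x1 _ wS0 q_gt1 q_le3 _).
      + rewrite ler_wpM2l ?exprn_ge0//; first by clear -x1; lra.
        apply: ge0_ler_powR; rewrite ?nnegrE ?(ltW q0)//; first by case/andP: xw.
          rewrite addr_ge0// ?mulr_ge0 ?powR_ge0//; clear -c1; lra.
        exact: first_bound.
      + by case/andP: xMS.
      + by clear -nq nd; lra.
    rewrite mulrCA -mulrA ler_wpM2l// mulrC ler_wpM2l ?wdec// exprn_ge0//.
    by clear -x1; lra.
have c3 : 1 <= c ^+ 3 by rewrite exprn_ege1.
have cc3 : c <= c ^+ 3 by rewrite (ler_eXnr (n := 3)).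
have GM : G s - G M <= 8 * c ^+ 3 + 64 * k0 * (w S * S ^+ n)
     - e * w S * (s ^+ n.+2 - M ^+ n.+2) / n.+2%:R.
  have t1 : 0 <= (8 * c ^+ 3) * s^-1.
    by rewrite mulr_ge0 ?invr_ge0//; clear -c3 M0 Ms; lra.
  have t2 : (8 * c ^+ 3) * M^-1 <= 8 * c ^+ 3.
    by rewrite ler_piMr ?invf_le1//; clear -c3; lra.
  have sn : s ^+ n.+1 <= S ^+ n.+1 by rewrite lerXn2r// nnegrE; clear -M0 Ms sS S0; lra.
  have Mn : 0 <= M ^+ n.+1 by rewrite exprn_ge0// ltW.
  have t3 : 64 * w S `^ q * S / n.+1%:R * s ^+ n.+1 -
      64 * w S `^ q * S / n.+1%:R * M ^+ n.+1 <= 64 * k0 * (w S * S ^+ n).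
    rewrite -mulrBr; apply: (@le_trans _ _ (64 * w S `^ q * S * S ^+ n.+1)).
      apply: ler_pM; rewrite ?mulr_ge0 ?powR_ge0 ?invr_ge0 ?(ltW S0) ?(ltW N0)//.
      - by rewrite subr_ge0 lerXn2r// nnegrE; clear -M0 Ms; lra.
      - by rewrite ler_piMr ?mulr_ge0 ?powR_ge0 ?(ltW S0)// invf_le1// ler1n.
      - by clear -sn Mn; lra.
    have -> : 64 * w S `^ q * S * S ^+ n.+1 = 64 * (w S * S ^+ n) * (S ^+ 2 * w S `^ (q - 1)).
      by rewrite -(mulr_powRB1 wS0 q0) exprS; ring.
    have -> : 64 * k0 * (w S * S ^+ n) = 64 * (w S * S ^+ n) * k0 by ring.
    rewrite ler_wpM2l ?mulr_ge0 ?exprn_ge0 ?(ltW S0)//.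
    by apply: small; rewrite lexx ltW.
  have -> : e * w S * (s ^+ n.+2 - M ^+ n.+2) / n.+2%:R =
    e * w S / n.+2%:R * s ^+ n.+2 - e * w S / n.+2%:R * M ^+ n.+2 by ring.
  have gen (a1 a2 a3 a4 a5 a6 a7 a8 : K) : 0 <= a1 -> a2 <= a3 -> a4 - a5 <= a6 ->
      - a1 + a4 - a7 - (- a2 + a5 - a8) <= a3 + a6 - (a7 - a8) by clear; lra.
  by rewrite /G !mulNr; apply: gen.
have gen (a1 a2 g a3 a4 a5 a6 : K) : a1 - a2 <= g -> g <= 8 * a3 + a4 - a5 ->
    a2 <= a6 -> a6 <= a3 -> a1 <= 9 * a3 + a4 - a5 by clear; lra.
exact: gen HG GM fM cc3.
Qed.

(** The first summand bounds w(S) S^n and the second the flux. Neither M nor d occurs, which allows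
    M to be chosen afterwards. *)
Definition decay_const (n : nat) (c R : K) : K := 36 * n.+2%:R * c ^+ 3 / R ^+ 2 + 18 * c ^+ 3.

(** Put Z = w(S) S^n. If S is not a zero of w, the flux at S is nonnegative and the mass term is at
    least R^2 Z / (2 N), while 64 k0 Z <= R^2 Z / (4 N) by the choice of [k0]. Absorption gives R^2
    Z / (4 N) <= 9 c^3, which bounds first Z and then the flux on the whole interval. *)
Lemma tail_decay n (q e : K) w k d c R M S k0 : tail_data n q e w k d c R M S k0 ->
  forall s, M <= s <= S ->
  s ^+ n * w s <= decay_const n c R /\ - (s ^+ n.+2 * k s) <= decay_const n c R.
Proof.
move=> T; have flux := tail_flux T.
have [n_gt1 e01 wk _ _ _ M1 MS c1 R0 w01 kle0 _ k0R _ _ _ endS] := T.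
clear T; move=> s /andP[Ms sS].
have M0 : 0 < M by clear -M1; lra.
have S0 : 0 < S by clear -M0 MS; lra.
have s0 : 0 < s by clear -M0 Ms; lra.
have NN0 : 0 < n.+2%:R :> K by rewrite ltr0n.
have MSS : M <= S <= S by rewrite lexx ltW.
have /andP[wS0 _] := w01 _ MSS; have /andP[e0 _] := e01.
have c3 : 1 <= c ^+ 3 by rewrite exprn_ege1.
have R20 : 0 < R ^+ 2 by rewrite exprn_gt0.
set Z := w S * S ^+ n.
have Z0 : 0 <= Z by exact: mulr_ge0 wS0 (exprn_ge0 n (ltW S0)).
have k0Z : 64 * k0 * Z <= R ^+ 2 / (4 * n.+2%:R) * Z.
  rewrite ler_wpM2r//; have -> : R ^+ 2 / (4 * n.+2%:R) = 64 * (R ^+ 2 / (256 * n.+2%:R)).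
    by field; rewrite gt_eqF.
  by rewrite ler_pM2l.
have ZC : R ^+ 2 / (4 * n.+2%:R) * Z <= 9 * c ^+ 3.
  case: endS => [wS|[eS MS2]].
    by rewrite /Z wS mul0r mulr0; clear -c3; lra.
  have fS := flux S MSS; have kS := kle0 S MSS.
  have fS0 : 0 <= - (S ^+ n.+2 * k S) by rewrite oppr_ge0 mulr_ge0_le0// exprn_ge0// ltW.
  have half : R ^+ 2 / (2 * n.+2%:R) * Z <= e * w S * (S ^+ n.+2 - M ^+ n.+2) / n.+2%:R.
    have -> : R ^+ 2 / (2 * n.+2%:R) * Z = e * w S * (S ^+ n.+2 / 2) / n.+2%:R.
      by rewrite -eS /Z !exprS; field; rewrite gt_eqF.
    rewrite ler_pM2r ?invr_gt0// ler_wpM2l ?mulr_ge0//.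
    by move: MS2; clear; lra.
  have e24 : R ^+ 2 / (2 * n.+2%:R) * Z = R ^+ 2 / (4 * n.+2%:R) * Z + R ^+ 2 / (4 * n.+2%:R) * Z.
    by field; rewrite gt_eqF.
  move: fS0 fS half k0Z; rewrite -/Z e24; clear.
  have gen (a1 a2 a3 a4 a5 : K) : 0 <= a1 -> a1 <= a2 + a3 - a4 -> a5 + a5 <= a4 ->
    a3 <= a5 -> a5 <= a2 by clear; lra.
  exact: gen.
have fluxC t : M <= t <= S -> - (t ^+ n.+2 * k t) <= 18 * c ^+ 3.
  move=> tMS; have ft := flux t tMS.
  have pos : 0 <= e * w S * (t ^+ n.+2 - M ^+ n.+2) / n.+2%:R.
    rewrite divr_ge0 ?(ltW NN0)// mulr_ge0 ?mulr_ge0// subr_ge0 lerXn2r// ?nnegrE ?(ltW M0)//;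
    by case/andP: tMS; clear -M0; lra.
  move: ft pos k0Z ZC; rewrite -/Z; clear.
  have gen (a1 a2 a3 a4 a5 : K) : a1 <= 9 * a2 + a3 - a4 -> 0 <= a4 -> a3 <= a5 ->
    a5 <= 9 * a2 -> a1 <= 18 * a2 by clear; lra.
  exact: gen.
have C0 : 0 <= 36 * n.+2%:R * c ^+ 3 / R ^+ 2.
  exact: divr_ge0 (mulr_ge0 (mulr_ge0 (ler0n _ 36) (ler0n _ _)) (le_trans ler01 c3)) (ltW R20).
have ZC' : Z <= 36 * n.+2%:R * c ^+ 3 / R ^+ 2.
  rewrite ler_pdivlMr// -(ler_pM2l (_ : 0 < (4 * n.+2%:R)^-1)) ?invr_gt0 ?mulr_gt0//.
  move: ZC; have -> : R ^+ 2 / (4 * n.+2%:R) * Z = (4 * n.+2%:R)^-1 * (Z * R ^+ 2) by ring.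
  by move/le_trans; apply; rewrite le_eqVlt; apply/orP; left; apply/eqP; field; rewrite gt_eqF.
split; last first.
  have sMS : M <= s <= S by rewrite Ms.
  by apply: le_trans (fluxC _ sMS) _; rewrite /decay_const lerDr.
(* Pointwise decay follows by integrating - w'(x), which is the flux divided by x^(n+1). *)
have wws : w s - w S <= 18 * c ^+ 3 * s ^- n.
  have dneg (t : K) : 0 < t -> is_derive t 1 (fun t => - (18 * c ^+ 3) * t ^- n)
      (18 * c ^+ 3 * n%:R * t ^- n.+1).
    move=> t0; have tn0 : t ^+ n != 0 by rewrite expf_neq0// gt_eqF.
    notypeclasses refine (is_derive_ext _ _).
      notypeclasses refine (is_derive_mul _ _); first derive_rec.
      notypeclasses refine (is_derive_inv (f := fun t => t ^+ n) _ _); [exact: tn0|derive_rec].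
    have -> : n.-1 = (n - 1)%N by rewrite subn1.
    have -> : t ^+ n.+1 = t ^+ n * t by rewrite exprSr.
    have tE : t ^+ n = t ^+ (n - 1) * t by rewrite -exprSr subn1 prednK// ltnW.
    have tn1 : t ^+ (n - 1) != 0 by rewrite expf_neq0// gt_eqF.
    by rewrite tE /=; field; rewrite tn1 gt_eqF.
  suff : - w S - - w s <= - (18 * c ^+ 3) * S ^- n - - (18 * c ^+ 3) * s ^- n.
    have : 0 <= 18 * c ^+ 3 * S ^- n.
      by rewrite mulr_ge0 ?invr_ge0 ?exprn_ge0 ?(ltW S0)//; clear -c3; lra.
    by clear; invlra.
  apply: (@le_of_derive_le' K (fun t => - w t) (fun t => - (18 * c ^+ 3) * t ^- n)
    (fun t => - (t * k t)) (fun t => 18 * c ^+ 3 * n%:R * t ^- n.+1)).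
  - exact: sS.
  - move=> x /andP[sx _]; apply: is_derive_opp; apply: (flow_dw wk).
    by clear -s0 sx; lra.
  - by move=> x /andP[sx _]; apply: dneg; clear -s0 sx; lra.
  - move=> x /andP[sx xS]; have x0 : 0 < x by clear -s0 sx; lra.
    rewrite ler_pdivlMr ?exprn_gt0// mulrC mulrN
      (_ : x ^+ n.+1 * (x * k x) = x ^+ n.+2 * k x); last first.
      by rewrite !exprS; ring.
    apply: le_trans (fluxC x _) _; first by rewrite (le_trans Ms (ltW sx)) ltW.
    by rewrite ler_peMr ?ler1n ?(ltnW n_gt1)//; clear -c3; lra.
have -> : decay_const n c R = 36 * n.+2%:R * c ^+ 3 / R ^+ 2 + 18 * c ^+ 3 by [].
have sn0 : 0 < s ^+ n by rewrite exprn_gt0.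
have swZ : s ^+ n * w S <= Z.
  by rewrite /Z mulrC ler_wpM2l// lerXn2r// nnegrE ltW.
have sww : s ^+ n * (w s - w S) <= 18 * c ^+ 3.
  by rewrite mulrC -ler_pdivlMr.
by move: swZ sww ZC'; rewrite mulrBr; clear; invlra.
Qed.

End decay.

(** * The Pohozaev identity *)

Section pohozaev.
Context {K : realType} (n : nat) (q e : K) (w k : K -> K).
Implicit Types s t x : K.

Lemma continuous_clamp_powR x : 1 <= q <= 3 ->
  {for x, continuous (fun x : K => clamp x `^ q)}.
Proof.
move=> q13; apply/continuousP_eps => r r0; exists (r / 3); first exact: divr_gt0.
move=> y yx; have := powR_lip q13 (introT andP (conj (clamp_ge0 y) (clamp_le1 y)))
  (introT andP (conj (clamp_ge0 x) (clamp_le1 x))).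
by have := clamp_lip y x; lra.
Qed.

Lemma is_derive_clamp_power x : 0 < x < 1 ->
  is_derive x 1 (fun x : K => x * clamp x `^ q) ((q + 1) * x `^ q).
Proof.
move=> /andP[x0 x1].
apply: (@is_derive_local _ _ (fun x : K => x * x `^ q) _ (Num.min x (1 - x))).
- by rewrite lt_min x0/= subr_gt0.
- move=> y; rewrite lt_min => /andP[/ltr_normlP[u1 u2] /ltr_normlP[v1 v2]].
  by rewrite clamp_id//; lra.
derive_by; first exact: x0.
by rewrite /= powRB_pos// powRr1 ?(ltW x0)//; field; rewrite gt_eqF.
Qed.

(** With w' = s k this is s^N (w'^2 / 2 + F(w)) + (N-2)/2 s^(N-1) w w', where F(w) = w^(q+1) / (q+1)
    - e w^2 / 2. The factor with [clamp] keeps it continuous where w leaves [0, 1]. *)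
Definition pohozaev s : K :=
  s ^+ n.+4 * k s ^+ 2 / 2 + n%:R / 2 * (s ^+ n.+2 * (w s * k s))
  - e / 2 * (s ^+ n.+2 * w s ^+ 2) + (q + 1)^-1 * (s ^+ n.+2 * (w s * clamp (w s) `^ q)).

Hypotheses (q13 : 1 <= q <= 3) (wk : sol n q e w k).

Lemma continuous_pohozaev s : {for s, continuous pohozaev}.
Proof.
have cw : {for s, continuous w} by exact: (flow_cw wk).
have ck : {for s, continuous k} by exact: (flow_ck wk).
have cs p : {for s, continuous (fun t : K => t ^+ p)} by exact: continuous_id_expn.
have cc (c : K) : {for s, continuous (fun=> c : K)} by exact: cst_continuous.
apply: continuousD; first apply: continuousB; first apply: continuousD.
- apply: continuousM; last exact: cc.
  by apply: continuousM; [exact: cs|exact: continuous_expn].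
- apply: continuousM; first exact: cc.
  by apply: continuousM; [exact: cs|exact: continuousM].
- apply: continuousM; first exact: cc.
  by apply: continuousM; [exact: cs|exact: continuous_expn].
- apply: continuousM; first exact: cc.
  apply: continuousM; first exact: cs.
  apply: continuousM; first exact: cw.
  exact: (@continuous_comp _ _ _ w (fun x : K => clamp x `^ q) s cw (continuous_clamp_powR q13)).
Qed.

Lemma is_derive_pohozaev s : 0 < s -> 0 < w s < 1 ->
  is_derive s 1 pohozaev
    (s ^+ n.+1 * ((n.+2%:R / (q + 1) - n%:R / 2) * (w s * w s `^ q) - e * w s ^+ 2)).
Proof.
move=> s0 w01.
have dk := sol_dk wk s0; have dw := flow_dw wk (ltW s0).
have dF := @is_derive_comp _ _ w _ _ _ (is_derive_clamp_power w01) dw.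
have q1 : q + 1 != 0 by case/andP: q13 => q1 _; rewrite gt_eqF// addr_gt0// (lt_le_trans ltr01).
rewrite /pohozaev.
notypeclasses refine (is_derive_ext _ _).
  notypeclasses refine (is_derive_add _ _); first derive_rec.
  notypeclasses refine (is_derive_mul _ _); first derive_rec.
  notypeclasses refine (is_derive_mul _ _); [derive_rec|exact: dF].
have nlE : nl q e (w s) = w s `^ q - e * w s.
  by rewrite /nl clamp_id//; case/andP: w01 => *; rewrite !ltW.
have cE : clamp (w s) = w s by rewrite clamp_id//; case/andP: w01 => *; rewrite !ltW.
have n2 : n.+2%:R = n%:R + 2 :> K by rewrite -addn2 natrD.
have n4 : n.+4%:R = n%:R + 4 :> K by rewrite -addn4 natrD.
rewrite nlE cE n2 n4 /= !exprS; field.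
by rewrite q1 gt_eqF.
Qed.

Lemma pohozaev0 : pohozaev 0 = 0.
Proof. by rewrite /pohozaev !expr0n/= !mul0r !mulr0 oppr0 !addr0. Qed.

End pohozaev.

(** * Shooting in the exponent *)

Section exponents.
Context {K : realType}.

Lemma powR_large (r A : K) : 0 < r -> exists2 M0 : K, 1 <= M0 &
  forall M, M0 <= M -> A < M `^ r.
Proof.
move=> r0; pose B := Num.max 1 (A + 1).
have B1 : 1 <= B by rewrite le_max lexx.
have AB : A < B by rewrite lt_max ltrDl ltr01 orbT.
exists (B `^ r^-1).
  apply: le_trans (ler_powR B1 (_ : 0 <= _)); first by rewrite powRr0.
  by rewrite invr_ge0 ltW.
move=> M BM; apply: (lt_le_trans AB).
have -> : B = (B `^ r^-1) `^ r by rewrite -powRrM mulVf ?gt_eqF// powRr1//; lra.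
by apply: ge0_ler_powR; rewrite ?nnegrE ?powR_ge0 ?(ltW r0)// (le_trans _ BM)// powR_ge0.
Qed.

End exponents.

(** Conditions at the point M where core and tail are matched. The last three make
    [small_of_barrier] work and put the decays C s^(-n) and c s^(-(n - 1/4)) below the barrier
    s^(-3n/4) from M on. *)
Record scales (K : realType) (n : nat) (R c k0 M : K) : Prop := Scales {
  sc_n : (1 < n)%N;
  sc_R : 0 < R;
  sc_k0 : 0 < k0;
  sc_k04 : k0 <= 1 / 4;
  sc_k0R : k0 <= R ^+ 2 / (256 * n.+2%:R);
  sc_c : 1 <= c;
  sc_M : 1 <= M;
  sc_Mk0 : M `^ (- (1 / 2)) <= k0;
  sc_MC : decay_const n c R < M `^ (n%:R / 4);
  sc_Mc : c < M `^ (n%:R / 4 - 1 / 4) }.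

(** What closeness to the profile on [0, M] provides. The field [co_phi] says that s^(n - 1/4) w has
    negative derivative at M; it starts the trapping argument below the critical exponent. *)
Record core (K : realType) (n : nat) (c M : K) (w k : K -> K) : Prop := Core {
  co_w : forall s, 0 <= s <= M -> profile n s / 2 <= w s;
  co_k : forall s, 0 <= s <= M -> k s < 0;
  co_wM : M ^+ n * w M <= c;
  co_fM : - (M ^+ n.+2 * k M) <= c;
  co_phi : (n%:R - 1 / 4) * w M + M ^+ 2 * k M < 0 }.

(* Decays more slowly than [s ^ - n], fast enough for [s ^ 2 w ^ (q - 1)] to be small. *)
Definition barrier (K : realType) (n : nat) (s : K) : K := s `^ (- (3 / 4 * n%:R)).

Section core_facts.
Context {K : realType}.

Lemma profile_flux_const_ge1 (n : nat) : (0 < n)%N ->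
  1 <= (n.+2%:R * n%:R : K) `^ (n%:R / 2 + 1).
Proof.
move=> n0; have D1 : 1 <= n.+2%:R * n%:R :> K by rewrite -natrM ler1n muln_gt0.
apply: le_trans (ler_powR D1 (_ : 0 <= _)); first by rewrite powRr0.
by rewrite addr_ge0// divr_ge0.
Qed.

(** The profile satisfies all conditions with room to spare, the factors 2 included, so [eta] is the
    least slack. Since the profile decreases and its slope increases, the slack at M serves the
    whole interval. *)
Lemma core_exists n (M : K) : (0 < n)%N -> 1 <= M ->
  (n%:R - 1 / 4) * (n.+2%:R * n%:R) < 1 / 4 * M ^+ 2 ->
  exists2 eta : K, 0 < eta & forall w k : K -> K,
    (forall s, 0 <= s <= M -> `|k s - profile_slope n s| <= eta /\
                              `|w s - profile n s| <= eta) ->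
    core n (2 * (n.+2%:R * n%:R) `^ (n%:R / 2 + 1)) M w k.
Proof.
move=> n0 M1 steep; set c1 := _ `^ (n%:R / 2 + 1).
have c11 : 1 <= c1 by exact: profile_flux_const_ge1.
have M0 : 0 < M by lra.
have MM : 0 <= M <= M by rewrite lexx ltW.
have st := profile_steep n0 (_ : 0 < 1 / 4 :> K) steep.
have {}st := st ltac:(lra).
set g := (n%:R - 1 / 4) * profile n M + M ^+ 2 * profile_slope n M in st.
have uM := profile_gt0 n0 M.
have kM := profile_slope_lt0 n0 M.
have nn1 : 1 <= n%:R :> K by rewrite ler1n.
have M2 : 0 < M ^+ 2 by rewrite exprn_gt0.
have Mn : 0 < M ^+ n by rewrite exprn_gt0.
have MN : 0 < M ^+ n.+2 by rewrite exprn_gt0.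
pose A := n%:R + M ^+ 2.
have A0 : 0 < A by rewrite addr_gt0//; lra.
pose eta := Num.min (Num.min (profile n M / 2) (- profile_slope n M / 2))
  (Num.min (Num.min (c1 / M ^+ n) (c1 / M ^+ n.+2)) (- g / (2 * A))).
have eta0 : 0 < eta.
  have c10 : 0 < c1 by clear -c11; lra.
  have a1 : 0 < profile n M / 2 by rewrite divr_gt0.
  have a2 : 0 < - profile_slope n M / 2 by rewrite divr_gt0 ?oppr_gt0.
  have a3 : 0 < - g / (2 * A) by rewrite divr_gt0 ?oppr_gt0 ?mulr_gt0.
  by rewrite !lt_min a1 a2 a3 !divr_gt0.
exists eta => // w k H.
have e1 : eta <= profile n M / 2 by rewrite !ge_min lexx.
have e2 : eta <= - profile_slope n M / 2 by rewrite !ge_min lexx !orbT.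
have e3 : M ^+ n * eta <= c1 by rewrite mulrC -ler_pdivlMr// !ge_min lexx !orbT.
have e4 : M ^+ n.+2 * eta <= c1 by rewrite mulrC -ler_pdivlMr// !ge_min lexx !orbT.
have e5 : A * eta <= - g / 2.
  rewrite mulrC -ler_pdivlMr//; have -> : - g / 2 / A = - g / (2 * A) by field; rewrite gt_eqF.
  by rewrite !ge_min lexx !orbT.
have [/ler_normlP[k1 k2] /ler_normlP[w1 w2]] := H M MM.
split.
- move=> s /andP[s0 sM]; have [_ /ler_normlP[u1 u2]] := H s (introT andP (conj s0 sM)).
  by have := profile_anti n0 (introT andP (conj s0 sM)); clear -e1 u1 u2; lra.
- move=> s /andP[s0 sM]; have [/ler_normlP[u1 u2] _] := H s (introT andP (conj s0 sM)).
  by have := profile_slope_incr n0 (introT andP (conj s0 sM)); clear -e2 u1 u2 kM; lra.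
- have p1 := profile_decay n0 M0.
  have : M ^+ n * w M <= M ^+ n * profile n M + M ^+ n * eta.
    by rewrite -mulrDr ler_pM2l//; clear -w2; lra.
  by rewrite -/c1 in p1 *; clear -p1 e3; lra.
- have p1 := profile_flux n0 M0.
  have : - (M ^+ n.+2 * k M) <= - (M ^+ n.+2 * profile_slope n M) + M ^+ n.+2 * eta.
    by rewrite -!mulrN -mulrDr ler_pM2l//; clear -k1; lra.
  by rewrite -/c1 in p1 *; clear -p1 e4; lra.
- have t1 : (n%:R - 1 / 4) * w M <= (n%:R - 1 / 4) * profile n M + n%:R * eta.
    have : (n%:R - 1 / 4) * w M <= (n%:R - 1 / 4) * (profile n M + eta).
      by rewrite ler_pM2l; [clear -w2; lra|clear -nn1; lra].
    by rewrite mulrDr; clear -eta0; lra.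
  have t2 : M ^+ 2 * k M <= M ^+ 2 * profile_slope n M + M ^+ 2 * eta.
    by rewrite -mulrDr ler_pM2l//; clear -k2; lra.
  by move: e5 t1 t2 st; rewrite /A /g mulrDl; clear; lra.
Qed.

(** The profile solves the problem with critical exponent and e = 0. Changing the exponent by [dl]
    costs at most d, and the linear term at most d^4 <= d; hence the perturbation 2 d in the
    stability estimate. *)
Lemma near_profile n (M eta : K) : (1 < n)%N -> 0 <= M -> 0 < eta ->
  exists2 d0 : K, 0 < d0 & forall d dl (w k : K -> K), 0 < d < d0 -> 0 <= dl <= d ->
    d <= 1 -> n%:R * d <= 1 / 4 ->
    sol n (crit_power n - dl) (d ^+ 4) w k ->
    forall s, 0 <= s <= M -> `|k s - profile_slope n s| <= eta /\
                              `|w s - profile n s| <= eta.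
Proof.
move=> n1 M0 eta0; have E0 := expR_gt0 (4 * M ^+ 2).
exists (eta / (6 * expR (4 * M ^+ 2))); first by rewrite divr_gt0// mulr_gt0.
move=> d dl w k /andP[d0 dd0] /andP[dl0 dld] d1 nd wk s sM.
have ndl : n%:R * dl <= 1 / 4 by apply: le_trans nd; rewrite ler_wpM2l.
have [_ q1 q3] := crit_power_range n1 dl0 ndl.
have q13 : 1 <= crit_power n - dl <= 3 by rewrite (ltW q1).
have e01 : 0 <= d ^+ 4 <= 1 by rewrite exprn_ge0 ?(ltW d0)//= exprn_ile1// ltW.
have d4 : d ^+ 4 <= d by rewrite exprS ler_piMr ?(ltW d0)// exprn_ile1// ltW.
have d20 : 0 <= 2 * d by rewrite mulr_ge0// ltW.
have [|a b] := @flow_stability K n _ _ w k _ _ _ (2 * d) M q13 e01 M0 d20 wk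
  (profile_flow (ltnW n1)) _ s sM.
  move=> t _; rewrite /= /nl mul0r subr0.
  have u1 := profile_le1 (ltnW n1) t; have u0 := ltW (profile_gt0 (ltnW n1) t).
  rewrite clamp_id ?u0// addrAC; apply: le_trans (ler_normD _ _) _.
  have p1 := @powR_lip_exponent K (profile n t) (crit_power n - dl) (crit_power n).
  have {}p1 := p1 ltac:(by rewrite u0) (ltW q1).
  have {}p1 := p1 ltac:(clear -q1 dl0; lra).
  have -> : 2 * d = d + d by ring.
  apply: lerD.
    by apply: (le_trans p1); rewrite addrAC subrr add0r normrN ger0_norm.
  rewrite normrN ger0_norm; last by rewrite mulr_ge0// exprn_ge0// ltW.
  by apply: le_trans d4; rewrite ler_piMr// exprn_ge0// ltW.
have bd : 3 * (2 * d) * expR (4 * M ^+ 2) <= eta.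
  have -> : 3 * (2 * d) * expR (4 * M ^+ 2) = d * (6 * expR (4 * M ^+ 2)) by ring.
  by rewrite -ler_pdivlMr ?mulr_gt0// ltW.
by split; [exact: le_trans bd|exact: le_trans bd].
Qed.

(** With n (q - 1) >= 15/4 the barrier gives s^2 x^(q-1) <= s^(2 - 45/16) <= s^(-1/2), which is at
    most [k0] from M on. *)
Lemma small_of_barrier n (R c k0 M dl x s : K) : scales n R c k0 M ->
  0 <= dl -> n%:R * dl <= 1 / 4 -> M <= s -> 0 <= x -> x <= barrier n s ->
  s ^+ 2 * x `^ (crit_power n - dl - 1) <= k0.
Proof.
move=> [n1 _ _ _ _ _ M1 Mk0 _ _] dl0 ndl Ms x0 xs.
have [nq q1 q3] := crit_power_range n1 dl0 ndl.
have s0 : 0 < s by lra.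
have s1 : 1 <= s by lra.
apply: le_trans Mk0; apply: (@le_trans _ _ (s `^ (- (1 / 2)))).
  have h : x `^ (crit_power n - dl - 1) <= barrier n s `^ (crit_power n - dl - 1).
    by apply: ge0_ler_powR; rewrite ?nnegrE ?powR_ge0//; lra.
  apply: le_trans (ler_wpM2l (exprn_ge0 2 (ltW s0)) h) _.
  rewrite /barrier -powRrM -(powR_mulrn 2 (ltW s0)) -powRD_pos//.
  by apply: ler_powR => //; lra.
rewrite !powRN lef_pV2 ?posrE ?powR_gt0//; try lra.
by apply: ge0_ler_powR; rewrite ?nnegrE//; lra.
Qed.

End core_facts.

(** The situation common to all exponents tested, S being the rescaled radius. The field [rn_MS2]
    keeps at least half of S^N in S^N - M^N for the absorption in the decay estimate. *)
Record run (K : realType) (n : nat) (R c k0 M dl e : K) (w k : K -> K) (S : K) : Prop := Run {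
  rn_sc : scales n R c k0 M;
  rn_dl : 0 <= dl;
  rn_ndl : n%:R * dl <= 1 / 4;
  rn_e : 0 <= e <= 1;
  rn_sol : sol n (crit_power n - dl) e w k;
  rn_core : core n c M w k;
  rn_MS : M < S;
  rn_S : e * S ^+ 2 = R ^+ 2;
  rn_MS2 : 2 * M ^+ n.+2 <= S ^+ n.+2 }.

(** * Monotonicity, decay and backward uniqueness along a run *)

Section dynamics.
Context {K : realType}.

Lemma sol_nonincreasing n (q e : K) w k s t : sol n q e w k -> 0 <= s <= t ->
  (forall x, s <= x <= t -> k x <= 0) -> w t <= w s.
Proof.
move=> wk /andP[s0 st] kx; rewrite -lerN2.
apply: (@le_of_derive_ge0 K (fun t => - w t) (fun t => - (t * k t))).
- exact: st.
- by move=> x _; apply: continuousN; exact: (flow_cw wk).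
- move=> x /andP[sx _]; apply: is_derive_opp; apply: (flow_dw wk).
  exact: le_trans (ltW sx).
- move=> x /andP[sx xt]; rewrite oppr_ge0 mulr_ge0_le0//; first exact: le_trans (ltW sx).
  by apply: kx; rewrite !ltW.
Qed.

Lemma sol_lt1 n (q e : K) w k s : sol n q e w k -> 0 < s ->
  (forall x, 0 <= x <= s -> k x < 0) -> w s < 1.
Proof.
move=> wk s0 kx.
have dw' x : x \in `]0, s[ -> is_derive x 1 w (x * k x).
  by rewrite in_itv/= => /andP[x0 _]; exact: (flow_dw wk (ltW x0)).
have cw : {within `[0, s], continuous w}.
  by apply: continuous_within => x _; exact: (flow_cw wk).
have [x + wE] := MVT s0 dw' cw; rewrite in_itv/= => /andP[x0 xs].
have : x * k x * (s - 0) < 0.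
  rewrite subr0 pmulr_llt0// pmulr_rlt0// kx//.
  by rewrite !ltW.
by rewrite -wE (flow_w0 wk) subr_lt0.
Qed.

Lemma run_lt1 n (R c k0 M dl e : K) w k S T s : run n R c k0 M dl e w k S ->
  (forall x, M <= x <= T -> k x <= 0) -> 0 < s <= T -> w s < 1.
Proof.
move=> H kT /andP[s0 sT]; have wk := rn_sol H; have kM := co_k (rn_core H).
have M1 := sc_M (rn_sc H).
have [sM|Ms] := leP s M.
  apply: (sol_lt1 wk s0) => x /andP[x0 xs]; apply: kM.
  by rewrite x0 (le_trans xs).
apply: (@le_lt_trans _ _ (w M)).
  apply: (sol_nonincreasing wk); first by rewrite (ltW Ms) andbT (le_trans _ M1).
  by move=> x /andP[Mx xs]; apply: kT; rewrite Mx (le_trans xs).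
by apply: (sol_lt1 wk) => //; exact: lt_le_trans M1.
Qed.

Lemma run_tail n (R c k0 M dl e : K) w k S T : run n R c k0 M dl e w k S ->
  M < T -> w T = 0 \/ T = S ->
  (forall s, M <= s <= T -> 0 <= w s) ->
  (forall s, M <= s <= T -> k s <= 0) ->
  (forall s, M <= s <= T -> w s <= barrier n s) ->
  tail_data n (crit_power n - dl) e w k dl c R M T k0.
Proof.
move=> H MT endT w0 kT wb; have M1 := sc_M (rn_sc H).
split.
- exact: sc_n (rn_sc H).
- exact: rn_e H.
- exact: rn_sol H.
- by [].
- exact: rn_dl H.
- exact: rn_ndl H.
- exact: M1.
- exact: MT.
- exact: sc_c (rn_sc H).
- exact: sc_R (rn_sc H).
- move=> s sMT; rewrite w0//= ltW//; apply: (run_lt1 H kT).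
  by case/andP: sMT => Ms ->; rewrite andbT (lt_le_trans _ Ms)// (lt_le_trans _ M1).
- exact: kT.
- exact: sc_k04 (rn_sc H).
- exact: sc_k0R (rn_sc H).
- move=> s sMT; apply: (small_of_barrier (rn_sc H) (rn_dl H) (rn_ndl H)).
  + by case/andP: sMT.
  + exact: w0.
  + exact: wb.
- exact: co_wM (rn_core H).
- exact: co_fM (rn_core H).
- case: endT => [wT|->]; [by left|right; split; [exact: rn_S H|exact: rn_MS2 H]].
Qed.

Lemma decay_const_ge1 n (c R : K) : 1 <= c -> 0 < R -> 1 <= decay_const n c R.
Proof.
move=> c1 R0; have c3 : 1 <= c ^+ 3 by rewrite exprn_ege1.
have : 0 <= 36 * n.+2%:R * c ^+ 3 / R ^+ 2.
  apply: divr_ge0; last by rewrite exprn_ge0 ?(ltW R0).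
  exact: mulr_ge0 (mulr_ge0 (ler0n _ 36) (ler0n _ _)) (le_trans ler01 c3).
by rewrite /decay_const; move: (_ / R ^+ 2) => r; lra.
Qed.

(* The decay [s ^ - n] beats the barrier [s ^ (- 3 n / 4)] past [M]. *)
Lemma below_barrier n (R c k0 M x s : K) : scales n R c k0 M ->
  M <= s -> s ^+ n * x <= decay_const n c R -> x < barrier n s.
Proof.
move=> H Ms xC; have M1 := sc_M H.
have s0 : 0 < s by apply: lt_le_trans Ms; exact: lt_le_trans M1.
rewrite -(ltr_pM2l (exprn_gt0 n s0)); apply: (le_lt_trans xC).
apply: (lt_le_trans (sc_MC H)); rewrite /barrier -(powR_mulrn n (ltW s0)) -powRD_pos//.
have -> : n%:R - 3 / 4 * n%:R = n%:R / 4 :> K by field.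
by apply: ge0_ler_powR; rewrite ?nnegrE ?divr_ge0//; lra.
Qed.

Lemma run_decay n (R c k0 M dl e : K) w k S T : run n R c k0 M dl e w k S ->
  M < T -> w T = 0 \/ T = S ->
  (forall s, M <= s <= T -> 0 <= w s) ->
  (forall s, M <= s <= T -> k s <= 0) ->
  (forall s, M <= s <= T -> w s <= barrier n s) ->
  forall s, M <= s <= T ->
    [/\ s ^+ n * w s <= decay_const n c R, - (s ^+ n.+2 * k s) <= decay_const n c R &
        w s < barrier n s].
Proof.
move=> H MT endT w0 kT wb s sMT.
have [wC kC] := tail_decay (run_tail H MT endT w0 kT wb) sMT.
split=> //; apply: (below_barrier (rn_sc H)) => //.
by case/andP: sMT.
Qed.

(** Backward uniqueness at an equilibrium: Q = (w - w(S))^2 + k^2 satisfies Q' >= - A Q, so exp(A s)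
    Q does not decrease and its zero at S propagates back to M. Staying in s >= 1 avoids the
    singular factor 1/s; the three summands of A bound the three terms of Q'. *)
Lemma sol_equilibrium n (q e : K) w k M S : 1 <= q <= 3 -> 0 <= e <= 1 ->
  sol n q e w k -> 1 <= M -> M <= S ->
  k S = 0 -> nl q e (w S) = 0 -> k M = 0.
Proof.
move=> q13 e01 wk M1 MS kS nlS.
pose Q s := (w s - w S) ^+ 2 + k s ^+ 2.
pose A : K := S + 4 + 2 * n.+2%:R.
pose Q' s := 2 * (w s - w S) * (s * k s) + 2 * k s * (- (nl q e (w s) + n.+2%:R * k s) / s).
have Q0 s : 0 <= Q s by rewrite addr_ge0// sqr_ge0.
have dQ s : M <= s -> is_derive s 1 Q (Q' s).
  move=> Ms; have s0 : 0 < s by clear -M1 Ms; lra.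
  have dw := flow_dw wk (ltW s0); have dk := sol_dk wk s0.
  rewrite /Q; derive_by; rewrite /Q' /=; field.
  by rewrite gt_eqF.
have QA s : M <= s <= S -> - (A * Q s) <= Q' s.
  move=> /andP[Ms sS]; have s1 : 1 <= s by clear -M1 Ms; lra.
  have lip := nl_lip (w s) (w S) q13 e01; rewrite nlS subr0 in lip.
  rewrite /Q /Q' /A; move: (w s - w S) (k s) (nl q e (w s)) lip => z x f lip.
  have zx0 : 0 <= z ^+ 2 + x ^+ 2 by rewrite addr_ge0 ?sqr_ge0.
  have zx_abs : 2 * (`|z| * `|x|) <= z ^+ 2 + x ^+ 2.
    rewrite -(real_normK (num_real z)) -(real_normK (num_real x)) -subr_ge0.
    have -> : `|z| ^+ 2 + `|x| ^+ 2 - 2 * (`|z| * `|x|) = (`|z| - `|x|) ^+ 2 by ring.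
    exact: sqr_ge0.
  have h1 : - (S * (z ^+ 2 + x ^+ 2)) <= 2 * z * (s * x).
    have -> : 2 * z * (s * x) = s * (2 * (z * x)) by ring.
    have : - (z ^+ 2 + x ^+ 2) <= 2 * (z * x).
      have : - (`|z| * `|x|) <= z * x by rewrite -normrM lerNl ler_normr lexx orbT.
      by move: zx_abs; clear; lra.
    move=> zx; apply: (@le_trans _ _ (s * - (z ^+ 2 + x ^+ 2))).
      by rewrite mulrN lerN2 ler_wpM2r.
    by rewrite ler_wpM2l// (le_trans _ s1).
  have si : 0 <= s^-1 <= 1 by rewrite invr_ge0 invf_le1 ?s1 ?(le_trans _ s1)// (lt_le_trans _ s1).
  case/andP: si => si0 si1.
  have h2 : - (4 * (z ^+ 2 + x ^+ 2)) <= - (2 * (x * f)) * s^-1.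
    have xf : `|2 * (x * f)| <= 4 * (z ^+ 2 + x ^+ 2).
      rewrite 2!normrM (ger0_norm (ler0n _ 2)).
      have : `|x| * `|f| <= `|x| * (4 * `|z|) by rewrite ler_wpM2l.
      by move: zx_abs; rewrite mulrCA (mulrC `|x|); clear; lra.
    rewrite lerNl; apply: le_trans xf.
    rewrite mulNr opprK (le_trans (ler_norm _))// normrM (ger0_norm si0).
    by rewrite ler_piMr.
  have h3 : - (2 * n.+2%:R * (z ^+ 2 + x ^+ 2)) <= - (2 * n.+2%:R * x ^+ 2) * s^-1.
    rewrite mulNr lerN2; apply: (@le_trans _ _ (2 * n.+2%:R * x ^+ 2)).
      by rewrite ler_piMr// mulr_ge0 ?sqr_ge0// mulr_ge0.
    by rewrite ler_wpM2l ?mulr_ge0// lerDr sqr_ge0.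
  have -> : 2 * z * (s * x) + 2 * x * (- (f + n.+2%:R * x) / s) =
    2 * z * (s * x) + - (2 * (x * f)) * s^-1 + - (2 * n.+2%:R * x ^+ 2) * s^-1.
    by field; rewrite gt_eqF// (lt_le_trans _ s1).
  have -> : - ((S + 4 + 2 * n.+2%:R) * (z ^+ 2 + x ^+ 2)) = - (S * (z ^+ 2 + x ^+ 2)) +
    - (4 * (z ^+ 2 + x ^+ 2)) + - (2 * n.+2%:R * (z ^+ 2 + x ^+ 2)) by ring.
  by apply: lerD => //; apply: lerD.
have EQ s : M <= s -> is_derive s 1 (fun s => expR (A * s) * Q s)
    (expR (A * s) * (A * Q s + Q' s)).
  move=> Ms; have dQs := dQ s Ms; derive_by; rewrite /=; ring.
have : expR (A * M) * Q M <= expR (A * S) * Q S.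
  apply: (@le_of_derive_ge0 K (fun s => expR (A * s) * Q s)
    (fun s => expR (A * s) * (A * Q s + Q' s)) M S MS).
  - by move=> x /andP[Mx _]; exact: is_derive_continuous (EQ x Mx).
  - by move=> x /andP[Mx _]; exact: EQ (ltW Mx).
  - move=> x /andP[Mx xS]; rewrite mulr_ge0 ?expR_ge0//.
    have /QA : M <= x <= S by rewrite !ltW.
    by clear; lra.
have -> : Q S = 0 by rewrite /Q subrr kS !expr0n addr0.
rewrite mulr0 pmulr_rle0 ?expR_gt0// => QM.
have : k M ^+ 2 <= 0 by apply: le_trans QM; rewrite lerDr sqr_ge0.
by move=> h; apply/eqP; rewrite -sqrf_eq0 eq_le h sqr_ge0.
Qed.

(** Once w is nonpositive, the clamped nonlinearity reduces to - e w >= 0, so s^(N-1) w' cannot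
    increase back to 0. *)
Lemma sol_negative n (q e : K) w k T S : 1 <= q <= 3 -> 0 <= e ->
  sol n q e w k -> 0 < T -> w T = 0 -> k T < 0 ->
  forall s, T <= s <= S -> k s < 0.
Proof.
move=> q13 e0 wk T0 wT kT; apply: continuous_barrier => //.
  by move=> x _; exact: (flow_ck wk).
move=> z /andP[Tz zS] kz; apply/eqP; rewrite lt_eqF//.
have z0 : 0 < z by exact: lt_trans Tz.
rewrite -(pmulr_rlt0 _ (exprn_gt0 n.+2 z0)).
apply: (@le_lt_trans _ _ (T ^+ n.+2 * k T)); last by rewrite pmulr_rlt0// exprn_gt0.
rewrite -lerN2; apply: (@le_of_derive_ge0 K (fun s => - (s ^+ n.+2 * k s))
  (fun s => - - (s ^+ n.+1 * nl q e (w s))) T z (ltW Tz)).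
- by move=> x _; apply: continuousN; exact: (flow_continuous_moment wk).
- by move=> x /andP[Tx _]; apply: is_derive_opp; apply: (flow_dk wk); exact: lt_trans Tx.
- move=> x /andP[Tx xz]; rewrite opprK mulr_ge0// ?exprn_ge0 ?(ltW (lt_trans T0 Tx))//.
  have wx : w x <= 0.
    rewrite -wT; apply: (sol_nonincreasing wk); first by rewrite !ltW.
    by move=> y /andP[Ty yx]; rewrite ltW// kz// Ty (le_lt_trans yx).
  rewrite /nl (clamp_le0 wx) powR0 ?sub0r ?oppr_ge0 ?mulr_ge0_le0//.
  by case/andP: q13 => q1 _; rewrite gt_eqF// (lt_le_trans ltr01).
Qed.

End dynamics.

(** * From contact with the constraints to the Neumann condition at S *)

Section closing.
Context {K : realType}.

Lemma barrier_gt0 n (s : K) : 0 < s -> 0 < barrier n s.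
Proof. exact: powR_gt0. Qed.

Lemma run_wM n (R c k0 M dl e : K) w k S : run n R c k0 M dl e w k S -> 0 < w M.
Proof.
move=> H; have M1 := sc_M (rn_sc H); have n0 := ltnW (sc_n (rn_sc H)).
apply: (@lt_le_trans _ _ (profile n M / 2)); first by rewrite divr_gt0// profile_gt0.
by apply: (co_w (rn_core H)); rewrite lexx andbT (le_trans ler01).
Qed.

Lemma run_kM n (R c k0 M dl e : K) w k S : run n R c k0 M dl e w k S -> k M < 0.
Proof.
move=> H; have M1 := sc_M (rn_sc H).
by apply: (co_k (rn_core H)); rewrite lexx andbT (le_trans ler01).
Qed.

Lemma run_first_zero n (R c k0 M dl e : K) w k S : run n R c k0 M dl e w k S ->
  exists T, [/\ M < T, T <= S, w T = 0 \/ (T = S /\ 0 < w S) &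
    forall s, M <= s < T -> 0 < w s].
Proof.
move=> H; have wk := rn_sol H; have wM := run_wM H.
have [wpos|/existsNP[s /not_implyP[/andP[Ms sS] /negP ws]]] :=
  pselect (forall s, M <= s <= S -> 0 < w s).
  exists S; split=> //; first exact: rn_MS H.
    by right; split=> //; apply: wpos; rewrite lexx (ltW (rn_MS H)).
  by move=> s /andP[Ms /ltW sS]; apply: wpos; rewrite Ms.
rewrite -leNgt in ws.
have [x _|||T [MT Ts wT wneg]] := @first_zero K (fun s => - w s) M s Ms.
- by apply: continuousN; exact: (flow_cw wk).
- by rewrite oppr_lt0.
- by rewrite oppr_ge0.
exists T; split=> //; first exact: le_trans sS.
  by left; apply/eqP; rewrite -oppr_eq0 wT.
by move=> x /wneg; rewrite oppr_lt0.
Qed.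

Lemma run_nonneg n (R c k0 M dl e : K) w k S T : run n R c k0 M dl e w k S ->
  w T = 0 \/ (T = S /\ 0 < w S) -> (forall s, M <= s < T -> 0 < w s) ->
  forall s, M <= s <= T -> 0 <= w s.
Proof.
move=> H wT wpos s /andP[Ms]; rewrite le_eqVlt => /predU1P[->|sT].
  by case: wT => [->//|[-> /ltW]].
by rewrite ltW// wpos// Ms.
Qed.

Lemma run_q n (R c k0 M dl e : K) w k S : run n R c k0 M dl e w k S ->
  1 <= crit_power n - dl <= 3.
Proof.
move=> H; have [_ /ltW -> ->//] := crit_power_range (sc_n (rn_sc H)) (rn_dl H) (rn_ndl H).
Qed.

Lemma run_closing n (R c k0 M dl e : K) w k S : run n R c k0 M dl e w k S ->
  (forall s, M <= s <= S -> w s <= barrier n s /\ k s <= 0) ->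
  (exists2 s, M <= s <= S & w s = barrier n s \/ k s = 0) ->
  [/\ k S = 0, forall s, 0 <= s <= S -> 0 < w s &
     forall s, M <= s <= S ->
       s ^+ n * w s <= decay_const n c R /\ - (s ^+ n.+2 * k s) <= decay_const n c R].
Proof.
move=> H good [s sMS touch]; have wk := rn_sol H; have q13 := run_q H.
have M1 := sc_M (rn_sc H); have n0 := ltnW (sc_n (rn_sc H)).
have M0 : 0 < M by exact: lt_le_trans M1.
have kM := run_kM H.
(* The decay estimate requires w >= 0, so it is applied only up to T, the first zero of w or else S;
   beyond a zero w is nonpositive and below the barrier anyway. *)
have [T [MT TS wT wpos]] := run_first_zero H.
have w0 := run_nonneg H wT wpos.
have wT' : w T = 0 \/ T = S by case: wT => [|[]]; [left|right].
have inMS t : M <= t <= T -> M <= t <= S by move=> /andP[-> /le_trans]; exact.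
have dec := run_decay H MT wT' w0 (fun t tT => (good t (inMS t tT)).2)
  (fun t tT => (good t (inMS t tT)).1).
have kle t : M <= t <= S -> k t <= 0 by move=> /good[].
have T0 : 0 < T by exact: lt_trans MT.
have w_after t : T <= t <= S -> w T = 0 -> w t <= 0.
  move=> /andP[Tt tS] <-; apply: (sol_nonincreasing wk); first by rewrite (ltW T0).
  by move=> x /andP[Tx xt]; apply: kle; rewrite (le_trans (ltW MT) Tx) (le_trans xt).
have eq_absurd t : M <= t <= S -> k t = 0 -> nl (crit_power n - dl) e (w t) = 0 -> False.
  move=> /andP[Mt _] kt0 nlt0; have := sol_equilibrium q13 (rn_e H) wk M1 Mt kt0 nlt0.
  by move=> kM0; rewrite kM0 ltxx in kM.
have /andP[Ms sS] := sMS.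
have s0 : 0 < s by exact: lt_le_trans Ms.
have ks : k s = 0.
  case: touch => // ws; exfalso; have [sT|Ts] := leP s T.
    by have [_ _] := dec s (introT andP (conj Ms sT)); rewrite ws ltxx.
  have wT0 : w T = 0.
    by case: wT => // -[TE _]; move: sS; rewrite -TE leNgt Ts.
  have := w_after s (introT andP (conj (ltW Ts) sS)) wT0.
  by rewrite ws leNgt barrier_gt0.
have [sT|Ts] := ltP s T.
  exfalso; apply: (eq_absurd s) => //.
  have Ms' : M < s.
    by rewrite lt_neqAle Ms andbT; apply/eqP => Mse; move: kM; rewrite Mse ks ltxx.
  (* As k <= 0, a zero of k inside the interval is a maximum; there the equation for k' leaves [nl]
     equal to 0 at w(s), hence an equilibrium. *)
  have dk0 : is_derive s 1 k 0.
    apply: (@derive1_at_max K k M T s (ltW MT)).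
    - move=> t; rewrite in_itv/= => /andP[Mt _].
      by case: (sol_dk wk (lt_trans M0 Mt)).
    - by rewrite in_itv/= Ms'.
    - move=> t; rewrite in_itv/= ks => /andP[Mt tT]; apply: kle.
      by rewrite !ltW// (lt_le_trans tT).
  have := @derive_val _ _ _ _ _ _ _ dk0; rewrite (@derive_val _ _ _ _ _ _ _ (sol_dk wk s0)).
  rewrite ks mulr0 addr0 mulNr => /eqP; rewrite oppr_eq0 mulf_eq0 invr_eq0 (gt_eqF s0) orbF.
  by move/eqP.
case: wT => [wT0|[TE wS]].
  exfalso; have TMS : M <= T <= S by rewrite (ltW MT).
  apply: (eq_absurd T) => //; last first.
    rewrite wT0 /nl (clamp_le0 (lexx 0)) mulr0 subr0 powR0//.
    by case/andP: q13 => q1 _; rewrite gt_eqF// (lt_le_trans ltr01).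
  (* After a zero T of w the outward flux does not decrease. It vanishes at s, so k(T) >= 0; then w
     and k vanish together at T, again an equilibrium. *)
  have : - (T ^+ n.+2 * k T) <= - (s ^+ n.+2 * k s).
    apply: (@le_of_derive_ge0 K (fun s => - (s ^+ n.+2 * k s))
      (fun s => - - (s ^+ n.+1 * nl (crit_power n - dl) e (w s))) T s Ts).
    - by move=> x _; apply: continuousN; exact: (flow_continuous_moment wk).
    - by move=> x /andP[Tx _]; apply: is_derive_opp; apply: (flow_dk wk); exact: lt_trans Tx.
    - move=> x /andP[Tx xs]; rewrite opprK mulr_ge0// ?exprn_ge0 ?(ltW (lt_trans T0 Tx))//.
      have wx := w_after x (introT andP (conj (ltW Tx) (le_trans (ltW xs) sS))) wT0.
      rewrite /nl (clamp_le0 wx) powR0 ?sub0r ?oppr_ge0 ?mulr_ge0_le0//.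
        by case/andP: (rn_e H).
      by case/andP: q13 => q1 _; rewrite gt_eqF// (lt_le_trans ltr01).
  rewrite ks mulr0 oppr0 oppr_le0 pmulr_rge0 ?exprn_gt0// => kT0.
  by apply/eqP; rewrite eq_le kT0 kle.
have sE : s = S by apply/eqP; rewrite eq_le sS -TE.
split.
- by rewrite -sE.
- move=> t /andP[t0 tS]; have [tM|Mt] := leP t M.
    apply: lt_le_trans (co_w (rn_core H) (introT andP (conj t0 tM))).
    by rewrite divr_gt0// profile_gt0.
  move: tS; rewrite le_eqVlt => /predU1P[->//|tS].
  by apply: wpos; rewrite (ltW Mt) TE.
- by move=> t; rewrite -TE => /dec[].
Qed.

End closing.

(** * At the critical exponent a constraint is violated *)

Section pohozaev_runs.
Context {K : realType}.

(** This is the coefficient of w^(q+1) in the derivative of the Pohozaev function: zero at the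
    critical exponent, positive below it. *)
Lemma pohozaev_coefE n (dl : K) : (1 < n)%N -> 0 <= dl -> n%:R * dl <= 1 / 4 ->
  n.+2%:R / (crit_power n - dl + 1) - n%:R / 2 =
  n%:R * dl / (2 * (crit_power n - dl + 1)).
Proof.
move=> n1 dl0 ndl; have [nq q1 q3] := crit_power_range n1 dl0 ndl.
have n0 : n%:R != 0 :> K by rewrite pnatr_eq0 -lt0n ltnW.
set q := crit_power n - dl in nq q1 q3 *.
have q10 : q + 1 != 0 by rewrite gt_eqF//; clear -q1; lra.
have -> : n.+2%:R = (n%:R * q + n%:R + n%:R * dl) / 2 :> K.
  by rewrite nq -addn2 natrD; field.
by field.
Qed.

Lemma pohozaev_le n (e : K) w k a b (G g : K -> K) : (1 < n)%N -> 0 <= e <= 1 ->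
  sol n (crit_power n) e w k -> 0 <= a <= b ->
  (forall s, a < s < b -> 0 < w s < 1) ->
  (forall s, a <= s <= b -> {for s, continuous G}) ->
  (forall s, a < s < b -> is_derive s 1 G (g s)) ->
  (forall s, a < s < b -> g s <= s ^+ n.+1 * w s ^+ 2) ->
  pohozaev n (crit_power n) e w k b - pohozaev n (crit_power n) e w k a <= - e * (G b - G a).
Proof.
move=> n1 /andP[e0 e1] wk /andP[a0 ab] w01 cG dG gw.
have nd0 : n%:R * 0 <= 1 / 4 :> K by rewrite mulr0; lra.
have [_ q1 q3] := @crit_power_range K n 0 n1 (lexx 0) nd0.
have coef := @pohozaev_coefE n 0 n1 (lexx 0) nd0.
rewrite subr0 in q1 q3 coef; rewrite mulr0 mul0r in coef.
have q13 : 1 <= @crit_power K n <= 3 by rewrite (ltW q1).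
rewrite mulrBr; apply: (@le_of_derive_le K _ (fun s => - e * G s)
  (fun s => s ^+ n.+1 * ((n.+2%:R / (crit_power n + 1) - n%:R / 2) *
     (w s * w s `^ crit_power n) - e * w s ^+ 2)) (fun s => - e * g s) a b ab).
- by move=> x _; exact: continuous_pohozaev.
- by move=> x xab; apply: continuousM; [exact: cst_continuous|exact: cG].
- by move=> x /andP[ax xb]; apply: is_derive_pohozaev => //;
    [exact: le_lt_trans ax|apply: w01; rewrite ax].
- by move=> x xab; have dGx := dG x xab; derive_by; rewrite /= mul0r add0r.
- move=> x xab; rewrite coef mul0r sub0r mulrN mulNr lerN2 mulrCA ler_wpM2l//.
  exact: gw.
Qed.

Lemma run_core_lt1 n (R c k0 M dl e : K) w k S s : run n R c k0 M dl e w k S ->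
  0 < s <= M -> 0 < w s < 1.
Proof.
move=> H /andP[s0 sM]; have n0 := ltnW (sc_n (rn_sc H)); have M1 := sc_M (rn_sc H).
rewrite (lt_le_trans _ (co_w (rn_core H) (introT andP (conj (ltW s0) sM))))
  ?divr_gt0 ?profile_gt0//=.
apply: (run_lt1 H (T := M)); last by rewrite s0.
by move=> x /andP[Mx xM]; have -> : x = M; [apply/eqP; rewrite eq_le xM|exact: ltW (run_kM H)].
Qed.

(** The first bound keeps only the mass on [0, 1]. For N = 4 the mass on [1, M] is used instead: s^3
    (s^-2 / 4)^2 = 1 / (16 s), whose integral is ln M / 16. *)
Lemma pohozaev_core n (R c k0 M e : K) w k S : run n R c k0 M 0 e w k S ->
  pohozaev n (crit_power n) e w k M <= - e * ((profile n 1 / 2) ^+ 2 / n.+2%:R) /\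
  (n = 2%N -> pohozaev n (crit_power n) e w k M <= - e * (ln M / 16)).
Proof.
move=> H; have wk := rn_sol H; rewrite subr0 in wk.
have n1 := sc_n (rn_sc H); have n0 := ltnW n1; have M1 := sc_M (rn_sc H).
have /andP[e0 _] := rn_e H.
have N0 : 0 < n.+2%:R :> K by rewrite ltr0n.
have w01 a b s : 0 <= a -> b <= M -> a < s < b -> 0 < w s < 1.
  move=> a0 bM /andP[asl sb]; apply: (run_core_lt1 H).
  by rewrite (le_lt_trans a0 asl) (le_trans (ltW sb)).
have p01 : pohozaev n (crit_power n) e w k 1 <= - e * ((profile n 1 / 2) ^+ 2 / n.+2%:R).
  have := @pohozaev_le n e w k 0 1 (fun s => (profile n 1 / 2) ^+ 2 / n.+2%:R * s ^+ n.+2)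
    (fun s => (profile n 1 / 2) ^+ 2 * s ^+ n.+1) n1 (rn_e H) wk.
  rewrite pohozaev0 !subr0 expr0n expr1n /= mulr0 subr0 mulr1; apply.
  - by rewrite lexx ler01.
  - by move=> s; apply: w01.
  - by move=> s _; apply: continuousM; [exact: cst_continuous|exact: continuous_id_expn].
  - by move=> s _; derive_by; rewrite /=; field; rewrite gt_eqF.
  - move=> s /andP[s0 s1]; rewrite mulrC ler_wpM2l ?exprn_ge0 ?(ltW s0)//.
    have u1 : profile n 1 / 2 <= w s.
      apply: le_trans (co_w (rn_core H) _); last by rewrite (ltW s0) (le_trans (ltW s1)).
      by rewrite ler_pM2r// (profile_anti n0)// (ltW s0) (ltW s1).
    have u0 : 0 <= profile n (1 : K) / 2 by rewrite divr_ge0// ltW// profile_gt0.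
    by rewrite lerXn2r// nnegrE// (le_trans u0).
have mono : pohozaev n (crit_power n) e w k M <= pohozaev n (crit_power n) e w k 1.
  have := @pohozaev_le n e w k 1 M (fun=> 0) (fun=> 0) n1 (rn_e H) wk.
  rewrite subr0 mulr0 subr_le0; apply.
  - by rewrite ler01.
  - by move=> s; apply: w01.
  - by move=> s _; exact: cst_continuous.
  - by move=> s /andP[s0 _]; rewrite mulr_ge0 ?sqr_ge0// exprn_ge0// (le_trans ler01)// ltW.
split; first exact: le_trans mono p01.
move=> n2.
have := @pohozaev_le n e w k 1 M (fun s => ln s * 16^-1) (fun s => s^-1 * 16^-1) n1 (rn_e H) wk.
rewrite ln1 mul0r subr0 => HM.
have p1 : pohozaev n (crit_power n) e w k 1 <= 0.
  by apply: (le_trans p01); rewrite mulNr oppr_le0 mulr_ge0// divr_ge0// sqr_ge0.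
have : pohozaev n (crit_power n) e w k M - pohozaev n (crit_power n) e w k 1 <=
    - e * (ln M / 16).
  apply: HM.
  - by rewrite ler01.
  - by move=> s; apply: w01.
  - move=> s /andP[s1 _]; apply: continuousM; last exact: cst_continuous.
    by apply: continuous_ln; exact: lt_le_trans s1.
  - move=> s /andP[s1 _]; have dl := is_derive1_ln (lt_trans ltr01 s1).
    by derive_by; rewrite /= mulr0 addr0.
  - move=> s /andP[s1 sM]; have s0 : 0 < s by exact: lt_trans s1.
    have u1 : s ^- 2 / 4 <= w s.
      apply: le_trans (co_w (rn_core H) _); last by rewrite !ltW.
      by have := @profile_lower K n s (ltW s1) n2; lra.
    have u0 : 0 <= s ^- 2 / 4 by rewrite divr_ge0// invr_ge0 exprn_ge0 ?ltW.
    apply: (@le_trans _ _ (s ^+ n.+1 * (s ^- 2 / 4) ^+ 2)).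
      by rewrite n2 le_eqVlt; apply/orP; left; apply/eqP; field; rewrite gt_eqF.
    by rewrite ler_wpM2l ?exprn_ge0 ?(ltW s0)// lerXn2r// nnegrE// (le_trans u0).
by move: p1; clear; lra.
Qed.

(** If both constraints held, P would be negative from M up to T. At a zero of w only the square of
    k remains in P, a contradiction. Otherwise T = S, and the decay of w and of the flux bounds P(S)
    S^n from below by - C^2 (n/2 + R^2/2), against the hypothesis on I. *)
Lemma run_critical_exits n (R c k0 M e I : K) w k S : run n R c k0 M 0 e w k S ->
  0 < e -> 0 < I ->
  pohozaev n (crit_power n) e w k M <= - e * I ->
  decay_const n c R ^+ 2 * (n%:R / 2 + R ^+ 2 / 2) < e * I * S ^+ n ->
  ~ (forall s, M <= s <= S -> w s <= barrier n s /\ k s <= 0).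
Proof.
move=> H e0 I0 PM CI good; have wk := rn_sol H; rewrite subr0 in wk.
have n1 := sc_n (rn_sc H); have M1 := sc_M (rn_sc H).
have M0 : 0 < M by exact: lt_le_trans M1.
have [T [MT TS wT wpos]] := run_first_zero H.
have w0 := run_nonneg H wT wpos.
have T0 : 0 < T by exact: lt_trans MT.
have wT' : w T = 0 \/ T = S by case: wT => [|[]]; [left|right].
have inMS t : M <= t <= T -> M <= t <= S by move=> /andP[-> /le_trans]; exact.
have kle t : M <= t <= T -> k t <= 0 by move=> /inMS/good[].
have dec := run_decay H MT wT' w0 kle (fun t tT => (good t (inMS t tT)).1).
have PT : pohozaev n (crit_power n) e w k T <= - e * I.
  apply: le_trans PM.
  have := @pohozaev_le n e w k M T (fun=> 0) (fun=> 0) n1 (rn_e H) wk.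
  rewrite subr0 mulr0 subr_le0; apply.
  - by rewrite !ltW.
  - move=> s /andP[Ms sT]; rewrite wpos ?(ltW Ms)//=.
    by apply: (run_lt1 H kle); rewrite (lt_trans M0 Ms) ltW.
  - by move=> s _; exact: cst_continuous.
  - by move=> s /andP[Ms _]; rewrite mulr_ge0 ?sqr_ge0// exprn_ge0// ltW// (lt_trans M0).
have eI : 0 < e * I by exact: mulr_gt0.
case: wT => [wT0|[TE wS]].
  have : 0 <= pohozaev n (crit_power n) e w k T.
    rewrite /pohozaev wT0 !mul0r expr0n /= !mulr0 !addr0 oppr0 addr0.
    by rewrite divr_ge0// mulr_ge0 ?sqr_ge0// exprn_ge0// ltW.
  by move: PT eI; clear; rewrite mulNr; lra.
have MTT : M <= T <= T by rewrite (ltW MT) lexx.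
have [wC kC _] := dec T MTT; have kT := kle T MTT.
rewrite TE in PT wC kC kT T0.
have C0 : 0 <= decay_const n c R.
  exact: le_trans ler01 (decay_const_ge1 n (sc_c (rn_sc H)) (sc_R (rn_sc H))).
have Sn := exprn_gt0 n T0.
have y0 : 0 <= - (S ^+ n.+2 * k S) by rewrite oppr_ge0 mulr_ge0_le0// exprn_ge0// ltW.
have x0 : 0 <= S ^+ n * w S by rewrite mulr_ge0 ?(ltW wS)// ltW.
have xy : (S ^+ n * w S) * - (S ^+ n.+2 * k S) <= decay_const n c R ^+ 2.
  by rewrite expr2; apply: ler_pM.
have xx : (S ^+ n * w S) ^+ 2 <= decay_const n c R ^+ 2 by rewrite lerXn2r// nnegrE.
have PS : - (decay_const n c R ^+ 2 * (n%:R / 2 + R ^+ 2 / 2)) <=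
    pohozaev n (crit_power n) e w k S * S ^+ n.
  have -> : pohozaev n (crit_power n) e w k S * S ^+ n =
    S ^+ n * (S ^+ n.+4 * k S ^+ 2 / 2) +
    S ^+ n * ((crit_power n + 1)^-1 * (S ^+ n.+2 * (w S * clamp (w S) `^ crit_power n)))
    - n%:R / 2 * ((S ^+ n * w S) * - (S ^+ n.+2 * k S))
    - R ^+ 2 / 2 * (S ^+ n * w S) ^+ 2.
    by rewrite -(rn_S H) /pohozaev !exprS; ring.
  have t1 : 0 <= S ^+ n * (S ^+ n.+4 * k S ^+ 2 / 2).
    by rewrite mulr_ge0 ?(ltW Sn)// divr_ge0// mulr_ge0 ?sqr_ge0// exprn_ge0// ltW.
  have q0 : 0 < crit_power n + 1 :> K by rewrite addr_gt0// addr_gt0// divr_gt0// ltr0n ltnW.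
  have t2 : 0 <= S ^+ n * ((crit_power n + 1)^-1 * (S ^+ n.+2 * (w S * clamp (w S) `^ crit_power n))).
    rewrite mulr_ge0 ?(ltW Sn)// mulr_ge0 ?invr_ge0 ?(ltW q0)//.
    by rewrite mulr_ge0 ?exprn_ge0 ?(ltW T0)// mulr_ge0 ?powR_ge0// ltW.
  have t3 : n%:R / 2 * ((S ^+ n * w S) * - (S ^+ n.+2 * k S)) <= n%:R / 2 * decay_const n c R ^+ 2.
    by rewrite ler_wpM2l// divr_ge0.
  have t4 : R ^+ 2 / 2 * (S ^+ n * w S) ^+ 2 <= R ^+ 2 / 2 * decay_const n c R ^+ 2.
    by rewrite ler_wpM2l// divr_ge0// sqr_ge0.
  have -> : decay_const n c R ^+ 2 * (n%:R / 2 + R ^+ 2 / 2) =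
    n%:R / 2 * decay_const n c R ^+ 2 + R ^+ 2 / 2 * decay_const n c R ^+ 2 by ring.
  have gen (a1 a2 a3 a4 a5 a6 : K) : 0 <= a1 -> 0 <= a2 -> a3 <= a5 -> a4 <= a6 ->
    - (a5 + a6) <= a1 + a2 - a3 - a4 by clear; lra.
  exact: gen.
have : pohozaev n (crit_power n) e w k S * S ^+ n <= - e * I * S ^+ n by rewrite ler_wpM2r// ltW.
by move: CI PS; clear; rewrite !mulNr; lra.
Qed.

End pohozaev_runs.

(** * Below the critical exponent the solution is trapped *)

Section start.
Context {K : realType}.

(** The coefficient n dl / (2 (q + 1)) is at least dl / 4 because n >= 2 and q <= 3. *)
Lemma pohozaev_ge n (dl e : K) w k a b (G g : K -> K) : (1 < n)%N -> 0 <= e <= 1 ->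
  0 <= dl -> n%:R * dl <= 1 / 4 ->
  sol n (crit_power n - dl) e w k -> 0 <= a <= b ->
  (forall s, a < s < b -> 0 < w s < 1) ->
  (forall s : K, is_derive s 1 G (g s)) ->
  (forall s, a < s < b -> g s <= s ^+ n.+1 *
     (dl / 4 * (w s * w s `^ (crit_power n - dl)) - e * w s ^+ 2)) ->
  G b - G a <= pohozaev n (crit_power n - dl) e w k b - pohozaev n (crit_power n - dl) e w k a.
Proof.
move=> n1 /andP[e0 e1] dl0 ndl wk /andP[a0 ab] w01 dG gw.
have [nq q1 q3] := crit_power_range n1 dl0 ndl.
have coef := pohozaev_coefE n1 dl0 ndl.
set q := crit_power n - dl in nq q1 q3 coef wk gw *.
have q13 : 1 <= q <= 3 by rewrite (ltW q1).
have n2 : 2 <= n%:R :> K by rewrite ler_nat.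
have coef_ge : dl / 4 <= n.+2%:R / (q + 1) - n%:R / 2.
  rewrite coef ler_pdivlMr; last by clear -q1; lra.
  have -> : dl / 4 * (2 * (q + 1)) = dl * ((q + 1) / 2) by field.
  by rewrite mulrC ler_wpM2r//; clear -n2 q3; lra.
apply: (@le_of_derive_le K G _ g
  (fun s => s ^+ n.+1 * ((n.+2%:R / (q + 1) - n%:R / 2) *
     (w s * w s `^ q) - e * w s ^+ 2)) a b ab).
- by move=> x _; exact: is_derive_continuous (dG x).
- by move=> x _; exact: continuous_pohozaev.
- by move=> x /andP[ax xb]; apply: is_derive_pohozaev => //;
    [exact: le_lt_trans ax|apply: w01; rewrite ax].
- move=> x xab; apply: le_trans (gw x xab) _.
  rewrite ler_wpM2l ?exprn_ge0//; first by case/andP: xab => ax _; exact: le_trans (ltW ax).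
  rewrite lerD2r ler_wpM2r// mulr_ge0 ?powR_ge0//.
  by have /andP[/ltW] := w01 x xab.
Qed.

(** The gain is collected on [0, 1], where w >= m = [profile n 1 / 2] and w^(q+1) >= m^4 since m <=
    1 and q <= 3. On [1, M] only the loss of mass is counted, with w <= 1. *)
Lemma pohozaev_start n (R c k0 M dl e : K) w k S : run n R c k0 M dl e w k S ->
  (dl * (profile n 1 / 2) ^+ 4 / 4 - e) / n.+2%:R - e * M ^+ n.+2 / n.+2%:R <=
  pohozaev n (crit_power n - dl) e w k M.
Proof.
move=> H; have wk := rn_sol H; have dl0 := rn_dl H; have ndl := rn_ndl H.
have n1 := sc_n (rn_sc H); have n0 := ltnW n1; have M1 := sc_M (rn_sc H).
have /andP[e0 _] := rn_e H.
have [_ q1 q3] := crit_power_range n1 dl0 ndl.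
have N0 : 0 < n.+2%:R :> K by rewrite ltr0n.
set m := profile n (1 : K) / 2; have m0 : 0 < m by rewrite divr_gt0// profile_gt0.
have m1 : m <= 1 by have := profile_le1 n0 (1 : K); rewrite /m; lra.
have w01 a b s : 0 <= a -> b <= M -> a < s < b -> 0 < w s < 1.
  move=> a0 bM /andP[asl sb]; apply: (run_core_lt1 H).
  by rewrite (le_lt_trans a0 asl) (le_trans (ltW sb)).
have w2 s : 0 < w s < 1 -> e * w s ^+ 2 <= e.
  by move=> /andP[ws0 ws1]; rewrite ler_piMr// exprn_ile1// ltW.
have dpow (A s : K) : is_derive s 1 (fun t : K => A / n.+2%:R * t ^+ n.+2) (s ^+ n.+1 * A).
  by derive_by; rewrite /=; field; rewrite gt_eqF.
have P1 : (dl * m ^+ 4 / 4 - e) / n.+2%:R <= pohozaev n (crit_power n - dl) e w k 1.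
  have := @pohozaev_ge n dl e w k 0 1 _ _ n1 (rn_e H) dl0 ndl wk _ _ (dpow (dl * m ^+ 4 / 4 - e)) _.
  rewrite pohozaev0 !subr0 expr0n expr1n /= mulr0 subr0 mulr1; apply.
  - by rewrite lexx ler01.
  - by move=> s; apply: w01.
  - move=> s /andP[s0 s1]; rewrite ler_wpM2l ?exprn_ge0 ?(ltW s0)//.
    have ws : 0 < w s < 1 by apply: (w01 0 1) => //; rewrite s0.
    apply: lerB; last exact: w2.
    have u1 : m <= w s.
      apply: le_trans (co_w (rn_core H) _); last by rewrite (ltW s0) (le_trans (ltW s1)).
      by rewrite ler_pM2r// (profile_anti n0)// (ltW s0) (ltW s1).
    have -> : dl * m ^+ 4 / 4 = dl / 4 * m ^+ 4 by ring.
    rewrite ler_wpM2l ?divr_ge0// exprS; apply: ler_pM => //; first exact: ltW.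
      by rewrite exprn_ge0 ?ltW.
    apply: (@le_trans _ _ (m `^ (crit_power n - dl))).
      rewrite -(powR_mulrn 3 (ltW m0)); apply: ger_powR; last exact: q3.
      by rewrite m0.
    by apply: ge0_ler_powR; rewrite ?nnegrE ?(ltW m0)// ?(le_trans _ u1)// ltW//; clear -q1; lra.
have PM : - e * M ^+ n.+2 / n.+2%:R <= pohozaev n (crit_power n - dl) e w k M -
     pohozaev n (crit_power n - dl) e w k 1.
  apply: (@le_trans _ _ (- e / n.+2%:R * M ^+ n.+2 - - e / n.+2%:R * 1 ^+ n.+2)).
    rewrite expr1n mulr1 !mulNr opprK mulrAC lerDl.
    by rewrite divr_ge0.
  apply: (@pohozaev_ge n dl e w k 1 M
    (fun t => - e / n.+2%:R * t ^+ n.+2) _ n1 (rn_e H) dl0 ndl wk _ _ (dpow (- e))).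
  - by rewrite ler01.
  - by move=> s; apply: w01.
  - move=> s /andP[s1 sM]; have s0 : 0 < s by exact: lt_trans s1.
    rewrite ler_wpM2l ?exprn_ge0 ?(ltW s0)//.
    have ws : 0 < w s < 1 by apply: (w01 1 M) => //; rewrite s1.
    have := w2 s ws; have : 0 <= dl / 4 * (w s * w s `^ (crit_power n - dl)).
      by rewrite mulr_ge0 ?divr_ge0// mulr_ge0 ?powR_ge0//; case/andP: ws => /ltW.
    by clear; lra.
move: P1 PM; rewrite !mulNr -/m; clear.
have gen (a1 a2 a3 a4 : K) : a1 <= a2 -> - a3 <= a4 - a2 -> a1 - a3 <= a4 by clear; lra.
exact: gen.
Qed.

(** Up to a positive factor, [g] is the derivative of s^(n - 1/4) w, negative at M. At a first zero
    of [g], the Pohozaev function would be positive by the gain on the core, yet nonpositive by its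
    expression there. So s^(n - 1/4) w decreases up to the first zero of w, which keeps w below the
    barrier and k < 0; after that zero [sol_negative] takes over. *)
Lemma run_subcritical_stays n (R c k0 M dl e : K) w k S : run n R c k0 M dl e w k S ->
  e * c ^+ 2 * S < (dl * (profile n 1 / 2) ^+ 4 / 4 - e) / n.+2%:R - e * M ^+ n.+2 / n.+2%:R ->
  forall s, M <= s <= S -> w s < barrier n s /\ k s < 0.
Proof.
move=> H PB; have wk := rn_sol H; have dl0 := rn_dl H; have ndl := rn_ndl H.
have n1 := sc_n (rn_sc H); have n0 := ltnW n1; have M1 := sc_M (rn_sc H).
have /andP[e0 _] := rn_e H; have q13 := run_q H.
have [nq q1 q3] := crit_power_range n1 dl0 ndl.
have c1 := sc_c (rn_sc H).
have M0 : 0 < M by exact: lt_le_trans M1.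
have nn2 : 2 <= n%:R :> K by rewrite ler_nat.
have PM := pohozaev_start H.
have [T [MT TS wT wpos]] := run_first_zero H.
have w0 := run_nonneg H wT wpos.
have T0 : 0 < T by exact: lt_trans MT.
pose g s := (n%:R - 1 / 4) * w s + s ^+ 2 * k s.
have cg s : {for s, continuous g}.
  apply: continuousD; apply: continuousM.
  - exact: cst_continuous.
  - exact: (flow_cw wk).
  - exact: continuous_id_expn.
  - exact: (flow_ck wk).
have kneg z : M <= z <= T -> g z < 0 -> k z < 0.
  move=> zMT gz; have z0 : 0 < z by case/andP: zMT => Mz _; exact: lt_le_trans Mz.
  rewrite -(pmulr_rlt0 _ (exprn_gt0 2 z0)); apply: le_lt_trans gz.
  by rewrite /g lerDr mulr_ge0 ?w0//; clear -nn2; lra.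
(* On a stretch where g < 0 the function s ^ (n - 1 / 4) w(s) decreases. *)
have wdec z : M <= z <= T -> (forall s, M <= s < z -> g s < 0) ->
    w z <= c * z `^ (- (n%:R - 1 / 4)).
  move=> /andP[Mz zT] gneg; have z0 : 0 < z by exact: lt_le_trans Mz.
  have : z `^ (n%:R - 1 / 4) * w z <= M `^ (n%:R - 1 / 4) * w M.
    rewrite -lerN2; apply: (@le_of_derive_ge0 K (fun s => - (s `^ (n%:R - 1 / 4) * w s))
      (fun s => - (s `^ (n%:R - 2 * (1 / 4) - 1) * (s `^ (1 / 4) * g s))) M z Mz).
    - move=> x /andP[Mx _]; apply: continuousN; apply: is_derive_continuous (is_derive_psi wk _ _).
      exact: lt_le_trans Mx.
    - move=> x /andP[Mx _]; apply: is_derive_opp; apply: (is_derive_psi wk).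
      exact: lt_trans Mx.
    - move=> x /andP[Mx xz]; rewrite oppr_ge0 mulr_ge0_le0 ?powR_ge0//.
      by rewrite mulr_ge0_le0 ?powR_ge0// ltW// gneg// (ltW Mx).
  move=> zw; rewrite powRN ler_pdivlMr ?powR_gt0// mulrC; apply: (le_trans zw).
  apply: le_trans (co_wM (rn_core H)); rewrite ler_wpM2r ?(ltW (run_wM H))//.
  rewrite -(powR_mulrn n (ltW M0)); apply: ler_powR => //; clear; lra.
have cbar z : M <= z -> c * z `^ (- (n%:R - 1 / 4)) < barrier n z.
  move=> Mz; have z0 : 0 < z by exact: lt_le_trans Mz.
  have -> : barrier n z = z `^ (n%:R / 4 - 1 / 4) * z `^ (- (n%:R - 1 / 4)).
    by rewrite -powRD_pos//; congr (_ `^ _); field.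
  rewrite ltr_pM2r ?powR_gt0//; apply: lt_le_trans (sc_Mc (rn_sc H)) _.
  by apply: ge0_ler_powR; rewrite ?nnegrE ?(ltW M0) ?(ltW z0)//; clear -nn2; lra.
have gneg : forall s, M <= s <= T -> g s < 0.
  apply: continuous_barrier => //; first exact: co_phi (rn_core H).
  move=> z /andP[Mz zT] gz gz0.
  have zMT : M <= z <= T by rewrite (ltW Mz).
  have z0 : 0 < z by exact: lt_trans Mz.
  have wz := wdec z zMT gz.
  have kz s : M <= s <= z -> k s <= 0.
    move=> /andP[Ms]; rewrite le_eqVlt => /predU1P[->|sz].
      rewrite -(pmulr_rle0 _ (exprn_gt0 2 z0)).
      have -> : z ^+ 2 * k z = - ((n%:R - 1 / 4) * w z) by move: gz0; rewrite /g; clear; lra.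
      by rewrite oppr_le0 mulr_ge0 ?w0//; clear -nn2; lra.
    by rewrite ltW// kneg ?gz ?Ms ?(le_trans (ltW sz)).
  (* Before z the decay gives s^(n+1) w^2 <= c^2 s^(3/2 - n) <= c^2, so the loss beyond M is at most
     e c^2 S, less than the value at M. *)
  have Pz : 0 < pohozaev n (crit_power n - dl) e w k z.
    have dlin (s : K) : is_derive s 1 (fun t : K => - (e * c ^+ 2) * t) (- (e * c ^+ 2)).
      by derive_by; rewrite /= mul0r add0r mulr1.
    have := @pohozaev_ge n dl e w k M z _ _ n1 (rn_e H) dl0 ndl wk _ _ dlin.
    rewrite !mulNr opprK => HP.
    have : - (e * c ^+ 2 * z) + e * c ^+ 2 * M <=
        pohozaev n (crit_power n - dl) e w k z - pohozaev n (crit_power n - dl) e w k M.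
      apply: HP.
      - by rewrite (ltW M0) ltW.
      - move=> s /andP[Ms sz]; rewrite wpos ?(ltW Ms) ?(lt_le_trans sz)//=.
        by apply: (run_lt1 H kz); rewrite (lt_trans M0 Ms) ltW.
      - move=> s /andP[Ms sz]; have s0 : 0 < s by exact: lt_trans Ms.
        have s1 : 1 <= s by exact: le_trans (ltW Ms).
        have sMT : M <= s <= T by rewrite (ltW Ms) (le_trans (ltW sz)).
        have ws0 := w0 s sMT.
        have ws : w s <= c * s `^ (- (n%:R - 1 / 4)).
          by apply: wdec => // t /andP[Mt ts]; apply: gz; rewrite Mt (lt_trans ts).
        have t1 : 0 <= dl / 4 * (w s * w s `^ (crit_power n - dl)).
          by rewrite mulr_ge0 ?divr_ge0// mulr_ge0 ?powR_ge0.
        have t2 : s ^+ n.+1 * w s ^+ 2 <= c ^+ 2.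
          have cs0 : 0 <= c * s `^ (- (n%:R - 1 / 4)) by rewrite mulr_ge0 ?powR_ge0// (le_trans ler01).
          apply: (@le_trans _ _ (s ^+ n.+1 * (c * s `^ (- (n%:R - 1 / 4))) ^+ 2)).
            by rewrite ler_wpM2l ?exprn_ge0 ?(ltW s0)// lerXn2r// nnegrE.
          rewrite exprMn mulrCA ler_piMr ?exprn_ge0 ?(le_trans ler01 c1)//.
          rewrite -(powR_mulrn 2 (powR_ge0 _ _)) -powRrM -(powR_mulrn _ (ltW s0)) -powRD_pos//.
          apply: (@le_trans _ _ (s `^ 0)); last by rewrite powRr0.
          apply: ler_powR => //.
          by rewrite -natr1; clear -nn2; lra.
        rewrite mulrBr; have t3 : s ^+ n.+1 * (e * w s ^+ 2) <= e * c ^+ 2.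
          by rewrite mulrCA ler_wpM2l.
        have t4 : 0 <= s ^+ n.+1 * (dl / 4 * (w s * w s `^ (crit_power n - dl))).
          by rewrite mulr_ge0 ?exprn_ge0 ?(ltW s0).
        by move: t3 t4; clear; lra.
    have ez : e * c ^+ 2 * z <= e * c ^+ 2 * S.
      by rewrite ler_wpM2l ?mulr_ge0 ?exprn_ge0 ?(le_trans ler01 c1)// (le_trans zT).
    have eM : 0 <= e * c ^+ 2 * M.
      by rewrite mulr_ge0 ?(ltW M0)// mulr_ge0 ?exprn_ge0 ?(le_trans ler01 c1).
    move: PB PM ez eM; clear.
    have gen (a1 a2 a3 a4 a5 a6 : K) : a1 < a2 -> a2 <= a3 -> a4 <= a1 -> 0 <= a5 ->
      - a4 + a5 <= a6 - a3 -> 0 < a6 by clear; lra.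
    exact: gen.
  have kE : z ^+ 2 * k z = - ((n%:R - 1 / 4) * w z) by move: gz0; rewrite /g; clear; lra.
  have ws01 : 0 <= w z <= 1.
    rewrite w0//= ltW//; apply: (run_lt1 H kz).
    by rewrite z0 lexx.
  have small : z ^+ 2 * w z `^ (crit_power n - dl - 1) <= k0.
    apply: (small_of_barrier (rn_sc H) dl0 ndl (ltW Mz)); first by case/andP: ws01.
    by rewrite ltW// (le_lt_trans wz)// cbar// ltW.
  have k04 := sc_k04 (rn_sc H).
  (* At a zero of [g] one has z^2 k = - (n - 1/4) w, so the first two terms of P amount to - (n -
     1/4)/8 z^n w^2. The power term is at most z^n w^2 / 8, since q + 1 >= 2 and z^2 w^(q-1) <= [k0]
     <= 1/4. *)
  move: Pz; apply/negP; rewrite -leNgt /pohozaev clamp_id//.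
  set q := crit_power n - dl in small q1 q3 *.
  have w_z0 : 0 <= w z by case/andP: ws01.
  have -> : z ^+ n.+4 * k z ^+ 2 / 2 + n%:R / 2 * (z ^+ n.+2 * (w z * k z)) -
      e / 2 * (z ^+ n.+2 * w z ^+ 2) + (q + 1)^-1 * (z ^+ n.+2 * (w z * w z `^ q)) =
    z ^+ n * ((z ^+ 2 * k z) ^+ 2 / 2 + n%:R / 2 * (w z * (z ^+ 2 * k z)) -
      e / 2 * (z * w z) ^+ 2 + (q + 1)^-1 * (w z ^+ 2 * (z ^+ 2 * w z `^ (q - 1)))).
    rewrite -[w z `^ q](mulr_powRB1 w_z0); last by clear -q1; lra.
    by rewrite !exprS; ring.
  rewrite kE mulr_ge0_le0 ?exprn_ge0 ?(ltW z0)//.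
  have t1 : (q + 1)^-1 * (w z ^+ 2 * (z ^+ 2 * w z `^ (q - 1))) <= 1 / 2 * (w z ^+ 2 * (1 / 4)).
    apply: ler_pM.
    - by rewrite invr_ge0; clear -q1; lra.
    - by rewrite mulr_ge0 ?sqr_ge0// mulr_ge0 ?sqr_ge0// powR_ge0.
    - by rewrite mul1r lef_pV2 ?posrE; clear -q1; lra.
    - by rewrite ler_wpM2l ?sqr_ge0// (le_trans small).
  have t2 : 0 <= e / 2 * (z * w z) ^+ 2 by rewrite mulr_ge0 ?sqr_ge0// divr_ge0.
  have -> : (- ((n%:R - 1 / 4) * w z)) ^+ 2 / 2 + n%:R / 2 * (w z * - ((n%:R - 1 / 4) * w z)) =
    - ((n%:R - 1 / 4) / 8 * w z ^+ 2) by field.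
  have t3 : 1 / 8 * w z ^+ 2 <= (n%:R - 1 / 4) / 8 * w z ^+ 2.
    by rewrite ler_wpM2r ?sqr_ge0//; clear -nn2; lra.
  have gen (a1 a2 a3 a4 : K) : a1 <= 1 / 2 * (a4 * (1 / 4)) -> 0 <= a2 -> 1 / 8 * a4 <= a3 ->
    - a3 - a2 + a1 <= 0 by clear; lra.
  exact: gen t1 t2 t3.
have kT s : M <= s <= T -> k s < 0 by move=> sMT; apply: kneg => //; exact: gneg.
move=> s /andP[Ms sS]; have s0 : 0 < s by exact: lt_le_trans Ms.
have [sT|Ts] := leP s T.
  have sMT : M <= s <= T by rewrite Ms.
  split; last exact: kT.
  apply: le_lt_trans (cbar s Ms); apply: wdec => // t /andP[Mt ts]; apply: gneg.
  by rewrite Mt (le_trans (ltW ts)).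
have wT0 : w T = 0 by case: wT => // -[TE _]; move: sS; rewrite -TE leNgt Ts.
have kafter := sol_negative q13 e0 wk T0 wT0 (kT T ltac:(by rewrite (ltW MT) lexx)) (S := S).
split; last by apply: kafter; rewrite (ltW Ts).
apply: le_lt_trans (barrier_gt0 n s0); rewrite -wT0.
apply: (sol_nonincreasing wk); first by rewrite (ltW T0) ltW.
by move=> x /andP[Tx xs]; rewrite ltW// kafter// Tx (le_trans xs).
Qed.

End start.

(** * Choice of the exponent and of the scales *)

Section shooting.
Context {K : realType}.

Lemma max_lip (a b x y r : K) : a <= x + r -> b <= y + r ->
  Num.max a b <= Num.max x y + r.
Proof.
move=> ax yb; rewrite ge_max; apply/andP; split.
  by apply: (le_trans ax); rewrite lerD2r le_max lexx.
by apply: (le_trans yb); rewrite lerD2r le_max lexx orbT.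
Qed.

(** The maximum of [h t] over [M, S] is Lipschitz in t, so the intermediate value theorem gives a
    parameter at which this maximum is 0. *)
Lemma lipschitz_family_zero (h : K -> K -> K) (L M S : K) : 0 < L -> M <= S ->
  (forall t s, M <= s <= S -> {for s, continuous (h t)}) ->
  (forall t u s, M <= s <= S -> h t s <= h u s + L * `|t - u|) ->
  (exists2 s, M <= s <= S & 0 < h 0 s) ->
  (forall s, M <= s <= S -> h 1 s < 0) ->
  exists t, [/\ 0 < t, t < 1, forall s, M <= s <= S -> h t s <= 0 &
    exists2 s, M <= s <= S & h t s = 0].
Proof.
move=> L0 MS ch lh [s0 s0MS h0] h1.
have ex t : exists m, M <= m <= S /\ forall s, M <= s <= S -> h t s <= h t m.
  have [m mMS mmax] := EVT_max MS (continuous_within (ch t)).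
  rewrite in_itv/= in mMS; by exists m; split.
have [m mP] := choice ex.
pose g t := h t (m t).
have gle t u : g t <= g u + L * `|t - u|.
  apply: le_trans (lh t u _ (mP t).1) _.
  by rewrite lerD2r; apply: (mP u).2; exact: (mP t).1.
have cg : {within `[0, 1], continuous g}.
  apply: continuous_within => t _; apply/continuousP_eps => e e0.
  exists (e / L); first exact: divr_gt0.
  move=> u; rewrite ltr_pdivlMr// mulrC => ut.
  have a1 := gle t u; have a2 := gle u t; rewrite distrC in a1.
  by apply/ltr_normlP; split; move: ut a1 a2; clear; lra.
have g1 : g 1 < 0 by apply: h1; exact: (mP 1).1.
have g0 : 0 < g 0 by apply: (lt_le_trans h0); apply: (mP 0).2.
have [|t + gt] := @IVT K g 0 1 0 ler01 cg.
  by rewrite ge_min le_max (ltW g0) (ltW g1) orbT.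
rewrite in_itv/= => /andP[t0 t1]; exists t; split.
- rewrite lt_neqAle t0 andbT; apply/eqP => t0E; move: gt; rewrite -t0E => g00.
  by rewrite g00 ltxx in g0.
- by rewrite lt_neqAle t1 andbT; apply/eqP => t1E; rewrite -t1E gt ltxx in g1.
- by move=> s sMS; rewrite -gt; apply: (mP t).2.
- by exists (m t); [exact: (mP t).1|].
Qed.

Lemma continuous_barrier_fun n (s : K) : 0 < s -> {for s, continuous (@barrier K n)}.
Proof.
move=> s0; have := @is_derive_powR K (fun t => t) (- (3 / 4 * n%:R)) s 1 s0 (is_derive_var s).
exact: is_derive_continuous.
Qed.

Definition shooting_solution n (R C M d dl : K) (w k : K -> K) : Prop :=
  let S := R / d ^+ 2 in
  [/\ 0 < dl < d, sol n (crit_power n - dl) (d ^+ 4) w k, k S = 0,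
    forall s, 0 <= s <= S -> 0 < w s /\ k s <= 0 &
    M < S /\ forall s, M <= s <= S -> s ^+ n * w s <= C /\ - (s ^+ n.+2 * k s) <= C].

Lemma shooting_step n (R c k0 M d I : K) : 0 < d -> d <= 1 -> n%:R * d <= 1 / 4 ->
  scales n R c k0 M ->
  (forall dl (w k : K -> K), 0 <= dl <= d -> sol n (crit_power n - dl) (d ^+ 4) w k ->
     core n c M w k) ->
  2 * M < R / d ^+ 2 ->
  d ^+ 4 * c ^+ 2 * (R / d ^+ 2) <
    (d * (profile n 1 / 2) ^+ 4 / 4 - d ^+ 4) / n.+2%:R - d ^+ 4 * M ^+ n.+2 / n.+2%:R ->
  0 < I -> I <= (profile n 1 / 2) ^+ 2 / n.+2%:R \/ (n = 2%N /\ I <= ln M / 16) ->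
  decay_const n c R ^+ 2 * (n%:R / 2 + R ^+ 2 / 2) < d ^+ 4 * I * (R / d ^+ 2) ^+ n ->
  exists dl w k, shooting_solution n R (decay_const n c R) M d dl w k.
Proof.
move=> d0 d1 nd sc near MS PB I0 IP CI; set S := R / d ^+ 2.
have n1 := sc_n sc; have M1 := sc_M sc; have R0 := sc_R sc.
have M0 : 0 < M by exact: lt_le_trans M1.
have MS' : M < S by move: MS M0; rewrite -/S; clear; lra.
have S0 : 0 < S by exact: lt_trans MS'.
have e01 : 0 <= d ^+ 4 <= 1 by rewrite exprn_ge0 ?(ltW d0)//= exprn_ile1// ltW.
have e0 : 0 < d ^+ 4 by rewrite exprn_gt0.
have ndc t : n%:R * (d * clamp t) <= 1 / 4.
  by apply: le_trans nd; rewrite ler_wpM2l// ler_piMr ?clamp_le1// ltW.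
have dc0 t : 0 <= d * clamp t by rewrite mulr_ge0 ?clamp_ge0// ltW.
have dcd t : 0 <= d * clamp t <= d by rewrite dc0/= ler_piMr ?clamp_le1// ltW.
have q13 t : 1 <= crit_power n - d * clamp t <= 3.
  by have [_ /ltW -> ->] := crit_power_range n1 (dc0 t) (ndc t).
have ex t : exists wk : (K -> K) * (K -> K),
    sol n (crit_power n - d * clamp t) (d ^+ 4) wk.1 wk.2.
  by have [w [k wk]] := sol_exists n (q13 t) e01; exists (w, k).
have [wk wkP] := choice ex.
have rn t : run n R c k0 M (d * clamp t) (d ^+ 4) (wk t).1 (wk t).2 S.
  split=> //.
  - exact: near (dcd t) (wkP t).
  - by rewrite /S; field; rewrite gt_eqF.
  - apply: (@le_trans _ _ ((2 * M) ^+ n.+2)).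
      rewrite exprMn ler_wpM2r ?exprn_ge0 ?(ltW M0)//.
      by rewrite exprS ler_peMr// exprn_ege1// ler1n.
    by apply: lerXn2r; rewrite ?nnegrE ?(ltW S0) ?(ltW MS)// mulr_ge0// ltW.
(* Both constraints in one function: it is nonpositive exactly when w <= [barrier] and k <= 0, and
   zero when one of them is attained as well. *)
pose h t s := Num.max ((wk t).1 s - barrier n s) ((wk t).2 s).
have E0 := expR_gt0 (4 * S ^+ 2).
have L0 : 0 < 3 * d * expR (4 * S ^+ 2) by rewrite !mulr_gt0.
have pos s : M <= s <= S -> 0 < s by move=> /andP[Ms _]; exact: lt_le_trans Ms.
have ch t s : M <= s <= S -> {for s, continuous (h t)}.
  move=> sMS; apply: continuous_max; last exact: (flow_ck (wkP t)).
  apply: continuousB; first exact: (flow_cw (wkP t)).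
  exact: continuous_barrier_fun (pos s sMS).
have lh t u s : M <= s <= S -> h t s <= h u s + 3 * d * expR (4 * S ^+ 2) * `|t - u|.
  move=> sMS; have sS : 0 <= s <= S by rewrite ltW ?pos//=; case/andP: sMS.
  have /andP[q1u _] := q13 u.
  have [kk ww] := sol_continuous_exponent (q13 t) q1u e01 (ltW S0) (wkP t) (wkP u) sS.
  have qd : `|crit_power n - d * clamp t - (crit_power n - d * clamp u)| <= d * `|t - u|.
    have -> : crit_power n - d * clamp t - (crit_power n - d * clamp u) = d * (clamp u - clamp t) by ring.
    rewrite normrM (ger0_norm (ltW d0)) ler_wpM2l ?(ltW d0)// distrC.
    exact: clamp_lip.
  have bd : 3 * `|crit_power n - d * clamp t - (crit_power n - d * clamp u)| * expR (4 * S ^+ 2) <=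
      3 * d * expR (4 * S ^+ 2) * `|t - u|.
    have -> : 3 * d * expR (4 * S ^+ 2) * `|t - u| = 3 * (d * `|t - u|) * expR (4 * S ^+ 2) by ring.
    by rewrite ler_wpM2r ?(ltW E0)// ler_wpM2l.
  have {}kk := le_trans (le_trans (ler_norm _) kk) bd.
  have {}ww := le_trans (le_trans (ler_norm _) ww) bd.
  apply: max_lip; last by move: kk; clear; lra.
  by move: ww; clear; lra.
have c0 : clamp (0 : K) = 0 by rewrite clamp_le0.
have c1 : clamp (1 : K) = 1 by rewrite clamp_id// ler01 lexx.
have h1 s : M <= s <= S -> h 1 s < 0.
  move=> sMS; have r1 := rn 1; rewrite c1 mulr1 in r1.
  have [wb kneg] := run_subcritical_stays r1 PB sMS.
  by rewrite /h gt_max kneg subr_lt0 wb.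
have h0 : exists2 s, M <= s <= S & 0 < h 0 s.
  have r0 := rn 0; rewrite c0 mulr0 in r0.
  apply: contrapT => noh.
  apply: (run_critical_exits r0 e0 I0 _ CI).
    have [p1 p2] := pohozaev_core r0.
    case: IP => [II|[n2 II]].
      by apply: (le_trans p1); rewrite !mulNr lerN2 ler_pM2l.
    by apply: (le_trans (p2 n2)); rewrite !mulNr lerN2 ler_pM2l.
  move=> s sMS; have hs : h 0 s <= 0.
    by rewrite leNgt; apply/negP => hs; apply: noh; exists s.
  by move: hs; rewrite /h ge_max subr_le0 => /andP[].
have [t [t0 t1 hle [s sMS hs]]] := lipschitz_family_zero L0 (ltW MS') ch lh h0 h1.
have ct : clamp t = t by rewrite clamp_id// !ltW.
have rt := rn t; rewrite ct in rt.
have good x : M <= x <= S -> (wk t).1 x <= barrier n x /\ (wk t).2 x <= 0.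
  by move=> /hle; rewrite /h ge_max subr_le0 => /andP[].
have touch : (wk t).1 s = barrier n s \/ (wk t).2 s = 0.
  move: hs; rewrite /h; have [_ ks|_ ws] := leP ((wk t).1 s - barrier n s) ((wk t).2 s).
    by right.
  by left; apply/eqP; rewrite -subr_eq0 ws.
have [kS wpos dec] := run_closing rt good (ex_intro2 _ _ s sMS touch).
exists (d * t), (wk t).1, (wk t).2; split.
- by rewrite mulr_gt0//= gtr_pMr.
- exact: rn_sol rt.
- exact: kS.
- move=> x /[dup] /wpos wx /andP[x0 xS]; split=> //.
  have [xM|Mx] := leP x M; last by apply: (good x _).2; rewrite (ltW Mx).
  by apply/ltW/(co_k (rn_core rt)); rewrite x0.
- by split.
Qed.

(** Here c and [k0] do not involve M, so every condition is a lower bound on M, including [A < ln M]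
    for an A built from [decay_const]. *)
Lemma scales_exist n (R A : K) : (1 < n)%N -> 0 < R -> exists M, [/\
  scales n R (2 * (n.+2%:R * n%:R) `^ (n%:R / 2 + 1))
    (Num.min (1 / 4) (R ^+ 2 / (256 * n.+2%:R))) M,
  (n%:R - 1 / 4) * (n.+2%:R * n%:R) < 1 / 4 * M ^+ 2 & A < ln M].
Proof.
move=> n1 R0; set c := 2 * _ `^ _; set k0 := Num.min _ _.
have nn2 : 2 <= n%:R :> K by rewrite ler_nat.
have c1 : 1 <= c by have := @profile_flux_const_ge1 K n (ltnW n1); rewrite /c; lra.
have k00 : 0 < k0.
  have h1 : 0 < 1 / 4 :> K by lra.
  have h2 : 0 < R ^+ 2 / (256 * n.+2%:R) by rewrite divr_gt0 ?exprn_gt0// mulr_gt0.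
  by rewrite lt_min h1 h2.
have e1 : 0 < 1 / 2 :> K by lra.
have e2 : 0 < n%:R / 4 :> K by lra.
have e3 : 0 < n%:R / 4 - 1 / 4 :> K by lra.
have e4 : 0 < 2 :> K by lra.
have [M1 M11 M1P] := powR_large k0^-1 e1.
have [M2 M21 M2P] := powR_large (decay_const n c R) e2.
have [M3 M31 M3P] := powR_large c e3.
have [M4 M41 M4P] := powR_large (4 * ((n%:R - 1 / 4) * (n.+2%:R * n%:R))) e4.
pose M := Num.max (Num.max (Num.max M1 M2) (Num.max M3 M4)) (expR (A + 1)).
have l1 : M1 <= M by rewrite !le_max lexx.
have l2 : M2 <= M by rewrite !le_max lexx !orbT.
have l3 : M3 <= M by rewrite !le_max lexx !orbT.
have l4 : M4 <= M by rewrite !le_max lexx !orbT.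
have l5 : expR (A + 1) <= M by rewrite !le_max lexx !orbT.
have Mge1 : 1 <= M by exact: le_trans l1.
have M0 : 0 < M by exact: lt_le_trans Mge1.
exists M; split.
- split=> //.
  + by rewrite ge_min lexx.
  + by rewrite ge_min lexx orbT.
  + rewrite powRN -[leRHS]invrK lef_pV2 ?posrE ?powR_gt0 ?invr_gt0//.
    exact: ltW (M1P _ l1).
  + exact: M2P.
  + exact: M3P.
- have := M4P _ l4; rewrite (powR_mulrn 2 (ltW M0)); lra.
- have : A + 1 <= ln M by rewrite -[leLHS]expRK ler_ln// posrE expR_gt0.
  lra.
Qed.

(** C and M are uniform in d. The critical exit needs B < e I S^n = I R^n d^(4 - 2n): for n = 2 this
    is the condition 16 B / R^n < ln M met by the choice of M, for n >= 3 the right side is at least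
    I R^n / d. *)
Lemma shooting n (R : K) : (1 < n)%N -> 0 < R -> exists C M, 1 <= M /\
  exists2 d0, 0 < d0 & forall d, 0 < d < d0 -> [/\ d <= 1, n%:R * d <= 1 / 4 &
    exists dl w k, shooting_solution n R C M d dl w k].
Proof.
move=> n1 R0; have n0 := ltnW n1.
set c := 2 * (n.+2%:R * n%:R : K) `^ (n%:R / 2 + 1).
pose C := decay_const n c R.
pose B := C ^+ 2 * (n%:R / 2 + R ^+ 2 / 2).
have [M [sc steep lnM]] := scales_exist (16 * (B / R ^+ n)) n1 R0.
have M1 := sc_M sc; have M0 : 0 < M by exact: lt_le_trans M1.
have c1 := sc_c sc; have c0 : 0 < c by exact: lt_le_trans c1.
have [eta eta0 etaP] := core_exists n0 M1 steep.
have [d1 d10 d1P] := near_profile n1 (ltW M0) eta0.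
set m := profile n (1 : K) / 2; have m0 : 0 < m by rewrite divr_gt0// profile_gt0.
have N0 : 0 < n.+2%:R :> K by rewrite ltr0n.
have nn2 : 2 <= n%:R :> K by rewrite ler_nat.
have nn0 : 0 < n%:R :> K by rewrite ltr0n.
have B0 : 0 <= B by rewrite mulr_ge0 ?sqr_ge0// addr_ge0// divr_ge0// sqr_ge0.
have Rn0 : 0 < R ^+ n by rewrite exprn_gt0.
pose I := if n == 2%N then ln M / 16 else m ^+ 2 / n.+2%:R.
have lnM0 : 0 < ln M by apply: le_lt_trans lnM; rewrite mulr_ge0// divr_ge0// ltW.
have I0 : 0 < I by rewrite /I; case: ifP => _; rewrite divr_gt0// exprn_gt0.
have IP : I <= m ^+ 2 / n.+2%:R \/ (n = 2%N /\ I <= ln M / 16).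
  by rewrite /I; case: eqVneq => [->|_]; [right|left].
pose F := c ^+ 2 * R + (1 + M ^+ n.+2) / n.+2%:R.
have F0 : 0 < F.
  exact: addr_gt0 (mulr_gt0 (exprn_gt0 2 c0) R0) (divr_gt0 (addr_gt0 ltr01 (exprn_gt0 _ M0)) N0).
(* Beyond the closeness to the profile and the elementary bounds on d: [R / (2 * M)] gives 2 M < S,
   the entry with [F] makes the Pohozaev gain of order d exceed the losses, at most d^2 [F], and the
   last entry serves the critical exit for n >= 3. *)
pose d0 := Num.min (Num.min (Num.min d1 1) (1 / (4 * n%:R)))
  (Num.min (Num.min (R / (2 * M)) (m ^+ 4 / (4 * n.+2%:R) / F)) (I * R ^+ n / (B + 1))).
have d00 : 0 < d0.
  have a1 : 0 < 1 / (4 * n%:R) :> K by rewrite divr_gt0// mulr_gt0.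
  have a2 : 0 < R / (2 * M) by rewrite divr_gt0// mulr_gt0.
  have a3 : 0 < m ^+ 4 / (4 * n.+2%:R) / F.
    exact: divr_gt0 (divr_gt0 (exprn_gt0 4 m0) (mulr_gt0 (ltr0n _ 4) N0)) F0.
  have a4 : 0 < I * R ^+ n / (B + 1) by rewrite divr_gt0 ?mulr_gt0// ltr_wpDl.
  by rewrite !lt_min d10 a1 a2 a3 a4 ltr01.
exists C, M; split=> //; exists d0 => // d /andP[dpos].
rewrite !lt_min => /andP[/andP[/andP[dd1 dlt1] dn]].
rewrite -andbA => /and3P[dM dF dI].
have dle1 : d <= 1 by exact: ltW.
have nd : n%:R * d <= 1 / 4.
  move: dn; rewrite ltr_pdivlMr ?mulr_gt0// => dn; lra.
have d2 : 0 < d ^+ 2 by rewrite exprn_gt0.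
have d2d : d ^+ 2 <= d by rewrite expr2 ler_piMr// ltW.
split=> //; apply: (@shooting_step n R c _ M d I) => //.
- exact: sc.
- move=> dl w k dld wk; apply: etaP.
  by apply: (d1P d dl) => //; rewrite dpos.
- rewrite ltr_pdivlMr//; move: dM; rewrite ltr_pdivlMr ?mulr_gt0// => dM.
  apply: le_lt_trans dM; by rewrite mulrC ler_wpM2r// mulr_ge0 ?(ltW M0).
- move: dF; rewrite ltr_pdivlMr// => dF; rewrite -/m.
  have d4d2 : d ^+ 4 <= d ^+ 2.
    by rewrite (_ : 4%N = (2 + 2)%N)// exprD ler_piMr ?(ltW d2)// (le_trans d2d).
  have -> : d ^+ 4 * c ^+ 2 * (R / d ^+ 2) = d ^+ 2 * (c ^+ 2 * R).
    by field; rewrite gt_eqF.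
  have -> : (d * m ^+ 4 / 4 - d ^+ 4) / n.+2%:R - d ^+ 4 * M ^+ n.+2 / n.+2%:R =
    d * (m ^+ 4 / (4 * n.+2%:R)) - d ^+ 4 * ((1 + M ^+ n.+2) / n.+2%:R).
    by field; rewrite gt_eqF.
  have h1 : d * (d * F) < d * (m ^+ 4 / (4 * n.+2%:R)) by rewrite ltr_pM2l.
  have h2 : d ^+ 4 * ((1 + M ^+ n.+2) / n.+2%:R) <= d ^+ 2 * ((1 + M ^+ n.+2) / n.+2%:R).
    by rewrite ler_wpM2r// divr_ge0 ?(ltW N0)// addr_ge0// exprn_ge0// ltW.
  move: h1 h2; have -> : d * (d * F) = d ^+ 2 * (c ^+ 2 * R) + d ^+ 2 * ((1 + M ^+ n.+2) / n.+2%:R).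
    by rewrite /F; ring.
  have gen (a1 a2 a3 a4 : K) : a1 + a2 < a3 -> a4 <= a2 -> a1 < a3 - a4 by clear; lra.
  exact: gen.
- rewrite -/C -/B.
  have -> : d ^+ 4 * I * (R / d ^+ 2) ^+ n = I * R ^+ n * (d ^+ 4 / d ^+ (2 * n)).
    by rewrite expr_div_n -exprM; ring.
  rewrite /I; have [n2|nn2'] := eqVneq n 2%N.
    rewrite n2 mulfV ?mulr1 ?expf_neq0 ?gt_eqF//.
    move: lnM; rewrite n2 mulrA ltr_pdivrMr ?exprn_gt0//; clear; lra.
  have In : I = m ^+ 2 / n.+2%:R by rewrite /I (negbTE nn2').
  rewrite -In; move: dI; rewrite ltr_pdivlMr ?ltr_wpDl// => dI.
  have n3 : (3 <= n)%N by rewrite ltn_neqAle eq_sym nn2'.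
  have dinv : d^-1 <= d ^+ 4 / d ^+ (2 * n).
    have -> : d ^+ (2 * n) = d ^+ 4 * d ^+ (2 * n - 4)
      by rewrite -exprD subnKC// (leq_trans _ (leq_mul (leqnn 2) n3)).
    rewrite invfM mulrA mulfV ?mul1r ?expf_neq0 ?gt_eqF//.
    rewrite lef_pV2 ?posrE ?exprn_gt0//.
    have [j ->] : exists j, (2 * n - 4)%N = j.+1.
      exists (2 * n - 5)%N; have : (4 < 2 * n)%N by apply: leq_trans (leq_mul (leqnn 2) n3).
      by move=> h; rewrite -subSn.
    by rewrite exprS ler_piMr ?(ltW dpos)// exprn_ile1// ltW.
  apply: (@lt_le_trans _ _ (I * R ^+ n * d^-1)); last by rewrite ler_wpM2l// mulr_ge0// ltW.
  rewrite ltr_pdivlMr//; apply: le_lt_trans dI.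
  by rewrite mulrC ler_wpM2l ?(ltW dpos)// lerDl.
Qed.

End shooting.

(** * Radial functions of a row vector *)

Section radial_calculus.
Context {K : realType} {n : nat}.
Implicit Types (x v : 'rV[K]_n) (i j : 'I_n) (g k l : K -> K).

Lemma is_deriveP_eps (f : K -> K) (x a : K) : is_derive x 1 f a <->
  forall e : K, 0 < e -> exists2 d : K, 0 < d &
    forall h : K, `|h| < d -> `|f (h + x) - f x - a * h| <= e * `|h|.
Proof.
split=> [[df <-] e e0|H].
  have /cvgrPdist_le/(_ _ e0) := df; rewrite near_withinE => /nbhs_ballP[d d0 dh].
  exists d => // h hd; have [->|h0] := eqVneq h 0.
    by rewrite add0r subrr mulr0 subr0 normr0 mulr0.
  have := dh h; rewrite -ball_normE /= sub0r normrN => /(_ hd h0).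
  rewrite -/('D_1 f x) scaler1 => le_e.
  have -> : f (h + x) - f x - 'D_1 f x * h =
      - (('D_1 f x - h^-1 *: (f (h + x) - f x)) * h).
    by rewrite /GRing.scale/=; field.
  by rewrite normrN normrM ler_pM2r ?normr_gt0.
have cf : h^-1 *: (f (h *: 1 + x) - f x) @[h --> (0 : K)^'] --> a.
  apply/cvgrPdist_le => e /H[d d0 dh]; rewrite near_withinE.
  apply/nbhs_ballP; exists d => // h; rewrite -ball_normE /= sub0r normrN => hd h0.
  have := dh h hd; rewrite scaler1 -ler_pdivrMr ?normr_gt0// -normfV -normrM.
  apply: le_trans; rewrite le_eqVlt; apply/orP; left; apply/eqP.
  by rewrite distrC /GRing.scale/=; congr (`| _ |); field.
by apply: DeriveDef; [apply/cvg_ex; exists a|exact: cvg_lim].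
Qed.

Lemma is_derive_line (f : 'rV[K]_n -> K) x v (a : K) :
  is_derive (0 : K) 1 (fun h : K => f (h *: v + x)) a -> is_derive x v f a.
Proof.
have E : (fun h : K => h^-1 *: ((fun h => f (h *: v + x)) (h *: 1 + 0) -
      (fun h => f (h *: v + x)) 0)) = (fun h : K => h^-1 *: (f (h *: v + x) - f x)).
  by apply/funext => h; rewrite scaler1 addr0 scale0r add0r.
move=> [df fa]; apply: DeriveDef; first by rewrite /derivable -E.
by rewrite -fa /derive E.
Qed.

Lemma enorm_ge0 x : 0 <= enorm x. Proof. exact: sqrtr_ge0. Qed.

Lemma enorm_sqr x : enorm x ^+ 2 = \sum_i x ord0 i ^+ 2.
Proof. by rewrite sqr_sqrtr// sumr_ge0// => i _; exact: sqr_ge0. Qed.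

Lemma enorm_coord x i : `|x ord0 i| <= enorm x.
Proof.
rewrite -(ger0_norm (enorm_ge0 x)) -ler_sqr ?nnegrE// !real_normK ?num_real// enorm_sqr.
by rewrite (bigD1 i)//= lerDl sumr_ge0// => j _; exact: sqr_ge0.
Qed.

Lemma enorm_eq0 x : enorm x = 0 -> x = 0.
Proof.
move=> x0; apply/rowP => i; rewrite mxE; apply/eqP; rewrite -normr_le0 -x0.
exact: enorm_coord.
Qed.

Lemma enorm0 : enorm (0 : 'rV[K]_n) = 0.
Proof. by rewrite /enorm big1 ?sqrtr0// => i _; rewrite mxE expr0n. Qed.

Lemma enormZ (c : K) x : enorm (c *: x) = `|c| * enorm x.
Proof.
rewrite /enorm -sqrtr_sqr -sqrtrM ?sqr_ge0// mulr_sumr; congr Num.sqrt.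
by apply: eq_bigr => i _; rewrite mxE exprMn.
Qed.

Lemma enorm_sqr_line x i (h : K) :
  \sum_j (h *: delta_mx ord0 i + x) ord0 j ^+ 2 =
  enorm x ^+ 2 + 2 * h * x ord0 i + h ^+ 2.
Proof.
rewrite enorm_sqr (bigD1 i)//= [X in _ = X + _ + _](bigD1 i)//=.
rewrite (eq_bigr (fun j => x ord0 j ^+ 2)) => [|j /negPf ji]; last first.
  by rewrite !mxE ji andbF mulr0 add0r.
rewrite !mxE !eqxx mulr1; ring.
Qed.

Lemma is_derive_enorm_line x i : x != 0 ->
  is_derive (0 : K) 1 (fun h : K => enorm (h *: delta_mx ord0 i + x))
    (x ord0 i / enorm x).
Proof.
move=> x0; have ex0 : 0 < enorm x.
  rewrite lt_neqAle enorm_ge0 andbT eq_sym; apply: contra_neq x0; exact: enorm_eq0.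
have -> : (fun h : K => enorm (h *: delta_mx ord0 i + x)) =
    (fun h : K => Num.sqrt (enorm x ^+ 2 + 2 * h * x ord0 i + h ^+ 2)).
  by apply/funext => h; rewrite /enorm enorm_sqr_line.
have dQ : is_derive (0 : K) 1 (fun h : K => enorm x ^+ 2 + 2 * h * x ord0 i + h ^+ 2)
    (2 * x ord0 i).
  by derive_by => /=; ring.
have Q0 : enorm x ^+ 2 + 2 * 0 * x ord0 i + 0 ^+ 2 = enorm x ^+ 2 by ring.
have dS : is_derive (enorm x ^+ 2 + 2 * 0 * x ord0 i + 0 ^+ 2) 1 Num.sqrt (2 * enorm x)^-1.
  rewrite Q0 -[X in (2 * X)^-1](gtr0_norm ex0) -sqrtr_sqr.
  by apply: is_derive1_sqrt; rewrite exprn_gt0.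
have := @is_derive_comp _ Num.sqrt
  (fun h : K => enorm x ^+ 2 + 2 * h * x ord0 i + h ^+ 2) _ _ _ dS dQ.
by move/is_derive_ext; apply; field; rewrite gt_eqF.
Qed.

Lemma enorm_line0 i (h : K) : enorm (h *: delta_mx ord0 i + 0 : 'rV[K]_n) = `|h|.
Proof.
rewrite /enorm enorm_sqr_line enorm0 mxE expr0n mulr0 !add0r; exact: sqrtr_sqr.
Qed.

(** The Euclidean norm is not differentiable at the origin; there g'(0) = 0, given by the form s
    k(s) of the derivative, yields the derivative 0 directly. *)
Lemma is_derive_radial g k x i :
  (forall s : K, 0 <= s -> is_derive s 1 g (s * k s)) ->
  is_derive x (delta_mx ord0 i) (fun y => g (enorm y)) (k (enorm x) * x ord0 i).
Proof.
move=> dg; apply: is_derive_line; have [->|x0] := eqVneq x 0.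
  rewrite mxE mulr0; apply/is_deriveP_eps => e e0.
  have [d d0 dh] := (is_deriveP_eps _ _ _).1 (dg 0 (lexx _)) e e0.
  exists d => // h hd; rewrite [h + 0]addr0 !enorm_line0 normr0.
  by have := dh `|h|; rewrite normr_id addr0 !mul0r; apply.
have ex0 : enorm x != 0 by apply: contra_neq x0; exact: enorm_eq0.
have := @is_derive_comp _ g _ _ _ _ _ (is_derive_enorm_line i x0).
rewrite scale0r add0r => /(_ _ (dg _ (enorm_ge0 x))) H.
by apply: is_derive_ext H _; field.
Qed.

(** Here l(s) = s k'(s). At the origin the quotient reads 0 / 0 = 0, so the formula asks for the
    derivative k(0) of h k(|h|) if i = j, which the continuity of k gives. *)
Lemma is_derive_radial_gradient k l x i j :
  {for (0 : K), continuous k} -> (forall s : K, 0 < s -> is_derive s 1 k (l s / s)) ->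
  is_derive x (delta_mx ord0 j) (fun y : 'rV[K]_n => k (enorm y) * y ord0 i)
    (k (enorm x) * (i == j)%:R +
     l (enorm x) * (x ord0 i * x ord0 j / enorm x ^+ 2)).
Proof.
move=> ck dk; apply: is_derive_line; have [->|x0] := eqVneq x 0.
  rewrite !mxE enorm0 !mul0r mulr0 addr0; apply/is_deriveP_eps => e e0.
  have [d d0 dh] := (continuousP_eps _ _).1 ck e e0.
  exists d => // h hd; rewrite [h + 0]addr0 !enorm_line0 !mxE !addr0 mul0r mulr0 subr0.
  rewrite eqxx /=; case: (i == j) => /=; last by rewrite !mulr0 mul0r subr0 normr0 mulr_ge0// ltW.
  rewrite !mulr1 -mulrBl normrM ler_wpM2r// ltW//.
  by have := dh `|h|; rewrite subr0 normr_id; apply.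
have ex0 : 0 < enorm x.
  rewrite lt_neqAle enorm_ge0 andbT eq_sym; apply: contra_neq x0; exact: enorm_eq0.
have := @is_derive_comp _ k _ _ _ _ _ (is_derive_enorm_line j x0).
rewrite scale0r add0r => /(_ _ (dk _ ex0)) H.
have -> : (fun h : K => k (enorm (h *: delta_mx ord0 j + x)) *
      (h *: delta_mx ord0 j + x) ord0 i) =
    (fun h : K => k (enorm (h *: delta_mx ord0 j + x)) * (h * (i == j)%:R + x ord0 i)).
  by apply/funext => h; rewrite !mxE eqxx.
have D2 : is_derive (0 : K) 1 (fun h : K => h * (i == j)%:R + x ord0 i) (i == j)%:R.
  by derive_by; ring.
apply: is_derive_ext (is_derive_mul H D2) _.
by rewrite scale0r add0r mul0r add0r; field; rewrite gt_eqF.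
Qed.

Lemma continuous_at_mul (T : topologicalType) (p q : T -> K) (x : T) :
  {for x, continuous p} -> {for x, continuous q} ->
  {for x, continuous (fun y => p y * q y)}.
Proof. exact: continuousM. Qed.

Lemma continuous_at_dominated (T : topologicalType) (p q : T -> K) (x : T) :
  q x = 0 -> (forall y, `|p y| <= `|q y|) -> {for x, continuous q} ->
  {for x, continuous p}.
Proof.
move=> qx pq cq; have px : p x = 0.
  by apply/eqP; rewrite -normr_le0 (le_trans (pq x))// qx normr0.
apply/cvgrPdist_lt => e e0; move/cvgrPdist_lt/(_ e e0) : cq.
by apply: filterS => y; rewrite px qx !sub0r !normrN; exact: le_lt_trans.
Qed.

Lemma continuous_coord i : continuous (fun y : 'rV[K]_n => y ord0 i : K).
Proof. exact: coord_continuous. Qed.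

Lemma continuous_enorm : continuous (enorm : 'rV[K]_n -> K).
Proof.
have cQ : continuous (fun y : 'rV[K]_n => \sum_i y ord0 i ^+ 2 : K).
  apply: continuous_big; first exact: add_continuous.
  move=> i _ x; apply: continuous_at_mul; exact: (@continuous_coord i x).
move=> x; exact: (continuous_comp (cQ x) (@sqrt_continuous K _)).
Qed.

End radial_calculus.

Section radial_function.
Context {K : realType} {n : nat}.
Variables (g k l : K -> K).
Hypothesis dg : forall s : K, 0 <= s -> is_derive s 1 g (s * k s).
Hypothesis dk : forall s : K, 0 < s -> is_derive s 1 k (l s / s).
Hypothesis ck : continuous k.
Hypothesis cl : continuous l.
Hypothesis l0 : l 0 = 0.
Implicit Types (x : 'rV[K]_n) (i j : 'I_n) (A : set 'rV[K]_n) (R : K).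

Let f x := g (enorm x).

Lemma partial_radial i : partial i f = fun x => k (enorm x) * x ord0 i.
Proof. by apply/funext => x; have [_ <-] := is_derive_radial x i dg. Qed.

Lemma partial2_radial i j : partial j (partial i f) = fun x =>
  k (enorm x) * (i == j)%:R + l (enorm x) * (x ord0 i * x ord0 j / enorm x ^+ 2).
Proof.
rewrite partial_radial; apply/funext => x.
by have [_ <-] := is_derive_radial_gradient x i j (@ck 0) dk.
Qed.

Let continuous_radial (h : K -> K) : continuous h ->
  continuous (fun x => h (enorm x)).
Proof.
by move=> ch x; apply: continuous_comp; [exact: continuous_enorm|exact: ch].
Qed.

Lemma continuous_partial_radial i : continuous (partial i f).
Proof.
rewrite partial_radial => x.
apply: continuous_at_mul; first exact: continuous_radial.
exact: (@continuous_coord _ _ i x).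
Qed.

(** The quotient x_i x_j / |x|^2 has no limit at the origin but is bounded by 1; the factor [l]
    tends to [l 0 = 0]. *)
Lemma continuous_partial2_radial i j : continuous (partial j (partial i f)).
Proof.
rewrite partial2_radial => x.
apply: (@continuousD _ _ _ (fun y => k (enorm y) * _) (fun y => l (enorm y) * _) x).
  apply: continuous_at_mul; [exact: continuous_radial|exact: cst_continuous].
have [->|x0] := eqVneq x 0; last first.
  have ex0 : enorm x != 0 by apply: contra_neq x0; exact: enorm_eq0.
  have cN : {for x, continuous (fun y : 'rV[K]_n => enorm y ^+ 2)}.
    by apply: continuous_at_mul; exact: continuous_enorm.
  apply: continuous_at_mul; first exact: continuous_radial.
  apply: continuous_at_mul; last by apply: continuousV; rewrite // expf_neq0.
  by apply: continuous_at_mul; exact: (@continuous_coord _ _ _ x).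
apply: (continuous_at_dominated (q := fun y => l (enorm y))).
- by rewrite enorm0.
- move=> y; rewrite normrM ler_piMr//; have [->|y0] := eqVneq (enorm y) 0.
    by rewrite expr0n invr0 mulr0 normr0.
  rewrite normrM normfV ler_pdivrMr ?normr_gt0 ?expf_neq0// mul1r normrM.
  by rewrite expr2 normrM (ger0_norm (enorm_ge0 y)) ler_pM ?enorm_coord.
- exact: continuous_radial.
Qed.

Lemma C2_radial A : C2_on A f.
Proof.
split=> [x _ i|i x _ j].
  split; last exact: continuous_partial_radial.
  by have [] := is_derive_radial x i dg.
split; last exact: continuous_partial2_radial.
rewrite partial_radial.
by have [] := is_derive_radial_gradient x i j (@ck 0) dk.
Qed.

Lemma laplacian_radial x : laplacian f x = n%:R * k (enorm x) + l (enorm x).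
Proof.
rewrite /laplacian; under eq_bigr do rewrite partial2_radial eqxx mulr1.
rewrite big_split/= sumr_const card_ord mulr_natl -mulr_sumr; congr (_ + _).
have [->|x0] := eqVneq x 0; first by rewrite enorm0 l0 mul0r.
have ex0 : enorm x != 0 by apply: contra_neq x0; exact: enorm_eq0.
by rewrite -mulr_suml -enorm_sqr divff ?expf_neq0// mulr1.
Qed.

Lemma C1_closed_ball_radial R : continuous g -> C1_closed_ball R f.
Proof.
move=> cg; split.
- by have [] := C2_radial (eball R).
- by apply: continuous_subspaceT; exact: continuous_radial.
- move=> i; exists (partial i f) => //.
  by apply: continuous_subspaceT; exact: continuous_partial_radial.
Qed.

Lemma normal_derivative_radial R x : 0 < R -> enorm x = R -> k R = 0 ->
  is_normal_derivative R f x 0.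
Proof.
move=> R0 xR kR.
have dgR : is_derive R 1 g 0 by have := dg (ltW R0); rewrite kR mulr0.
apply/cvgrPdist_le => e e0; rewrite near_withinE.
have [d d0 dh] := (is_deriveP_eps _ _ _).1 dgR e e0.
apply/nbhs_ballP; exists (Num.min d R); first by rewrite /= lt_min d0.
move=> t; rewrite -ball_normE /= sub0r normrN lt_min => /andP[td tR] t0.
have -> : x - t *: (R^-1 *: x) = (1 - t / R) *: x.
  by rewrite scalerA scalerBl scale1r.
have tR' : 0 <= 1 - t / R.
  by rewrite subr_ge0 ler_pdivrMr// mul1r ltW// (le_lt_trans (ler_norm _)).
rewrite /f enormZ xR (ger0_norm tR').
rewrite mulrBl mul1r divfK ?gt_eqF// sub0r normrN normrM normfV.
rewrite mulrC ler_pdivrMr ?normr_gt0 ?gt_eqF//.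
have := dh (- t); rewrite normrN mul0r subr0 (addrC (- t)) distrC; exact.
Qed.

End radial_function.

(** * From the initial value problem to the Neumann problem on the ball *)

Section rescaling.
Context {K : realType} (n : nat) (q e alpha kappa : K) (w k : K -> K).
Hypotheses (q13 : 1 <= q <= 3) (e01 : 0 <= e <= 1) (wk : sol n q e w k).
Hypothesis kappa0 : 0 < kappa.

Let l s := - (nl q e (w s) + n.+2%:R * k s).

Let cw : continuous w. Proof. exact: flow_cw wk. Qed.
Let ck : continuous k. Proof. by move=> x; exact: (flow_ck (s := x) wk). Qed.

Let cl : continuous l.
Proof.
have cnl y : {for y, continuous (nl q e)}.
  by apply: (@lipschitz_continuous _ _ 4) => // x z; exact: nl_lip.
move=> x; apply: (@continuousN K K K (fun s => nl q e (w s) + n.+2%:R * k s) x).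
apply: (@continuousD K K K (fun s => nl q e (w s)) (fun s => n.+2%:R * k s) x).
  exact: (continuous_comp (@cw x) (cnl _)).
by apply: continuous_at_mul; [exact: cst_continuous|exact: ck].
Qed.

Let rescale_continuous c (f : K -> K) : continuous f ->
  continuous (fun s => c * f (kappa * s)).
Proof.
move=> cf x; apply: continuous_at_mul; first exact: cst_continuous.
apply: continuous_comp; last exact: cf.
by apply: continuous_at_mul; [exact: cst_continuous|exact: cvg_id].
Qed.

Lemma is_derive_rescale (f : K -> K) (c x a : K) : is_derive (kappa * x) 1 f a ->
  is_derive x 1 (fun s => c * f (kappa * s)) (c * kappa * a).
Proof.
move=> fa; have dx : is_derive x 1 (fun s => kappa * s) kappa.
  by derive_by; rewrite /=; ring.
have := is_derive_mul (is_derive_const c x) (is_derive_comp fa dx).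
by move/is_derive_ext; apply; ring.
Qed.

Lemma is_derive_rescaled (s : K) : 0 <= s ->
  is_derive s 1 (fun s => alpha * w (kappa * s))
    (s * (alpha * kappa ^+ 2 * k (kappa * s))).
Proof.
move=> s0; have /(is_derive_rescale alpha)/is_derive_ext := flow_dw wk (mulr_ge0 (ltW kappa0) s0).
by apply; ring.
Qed.

(** The clamp disappears because w is positive and decreases from w(0) = 1. The two scaling
    relations normalize the coefficients of the power and of the linear term to 1. *)
Lemma rescaled_solution R : 0 < R -> 0 < alpha -> alpha `^ (q - 1) = kappa ^+ 2 ->
  kappa ^+ 2 * e = 1 -> k (kappa * R) = 0 ->
  (forall s, 0 <= s <= kappa * R -> 0 < w s /\ k s <= 0) ->
  positive_radial_solution R (q + 1)
    (fun x : 'rV[K]_n.+2 => alpha * w (kappa * enorm x)).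
Proof.
move=> R0 a0 aq ke kR wpos.
pose g s := alpha * w (kappa * s).
pose kg s := alpha * kappa ^+ 2 * k (kappa * s).
pose lg s := alpha * kappa ^+ 2 * l (kappa * s).
have dg (s : K) : 0 <= s -> is_derive s 1 g (s * kg s).
  exact: is_derive_rescaled.
have dkg (s : K) : 0 < s -> is_derive s 1 kg (lg s / s).
  move=> s0; have := is_derive_rescale (alpha * kappa ^+ 2) (sol_dk wk (mulr_gt0 kappa0 s0)).
  by move/is_derive_ext; apply; rewrite /lg /l; field; rewrite !gt_eqF.
have lg0 : lg 0 = 0.
  rewrite /lg /l mulr0 (flow_k0 wk) /=.
  have N0 : n.+2%:R != 0 :> K by rewrite pnatr_eq0.
  by field.
have ckg : continuous kg by exact: rescale_continuous.
have clg : continuous lg by exact: rescale_continuous.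
have cg : continuous g by exact: rescale_continuous.
have w01 (x : 'rV[K]_n.+2) : eball R x -> 0 < w (kappa * enorm x) <= 1.
  rewrite /eball /= => xR.
  have kx : 0 <= kappa * enorm x by rewrite mulr_ge0 ?enorm_ge0// ltW.
  have kxR : kappa * enorm x <= kappa * R by rewrite ler_pM2l// ltW.
  have [|-> _] := wpos (kappa * enorm x); first by rewrite kx.
  rewrite -(flow_w0 wk); apply: (sol_nonincreasing wk); first by rewrite lexx.
  by move=> s /andP[s0 sx]; have [] := wpos s; rewrite ?s0 ?(le_trans sx).
split.
- split; first exact: (C2_radial dg dkg).
  exact: (C1_closed_ball_radial dg dkg ckg clg lg0).
- by move=> x /w01/andP[w0 _]; rewrite mulr_gt0.
- by exists g.
- move=> x /w01/andP[w0 w1].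
  rewrite (laplacian_radial dg dkg ckg lg0) /lg /l /kg /nl.
  rewrite clamp_id ?w1 ?(ltW w0)// addrK powRM ?(ltW w0) ?(ltW a0)//.
  have -> : alpha `^ q = alpha * kappa ^+ 2.
    rewrite -aq -[X in X * _](powRr1 (ltW a0)) -powRD_pos//.
    by congr (_ `^ _); ring.
  set W := w _; set P := W `^ q; set X := k _.
  have -> : alpha * kappa ^+ 2 * P =
      alpha * kappa ^+ 2 * (P - e * W) + alpha * (kappa ^+ 2 * e) * W by ring.
  by rewrite ke; ring.
- move=> x xR; apply: (normal_derivative_radial dg) => //.
  by rewrite /kg kR mulr0.
Qed.

End rescaling.

(** * Distance to the bubble *)

Section radial_integral.
Context {K : realType} {n : nat}.
Implicit Types (x : 'rV[K]_n) (r : K) (h : K -> K).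

Lemma measurable_enorm : measurable_fun [set: 'rV[K]_n] (enorm : 'rV[K]_n -> K).
Proof.
apply: (measurableT_comp (f := @Num.sqrt K)).
  apply: continuous_measurable_fun; exact: sqrt_continuous.
apply: measurable_sum => i; apply: measurable_funX; exact: measurable_rV_coord.
Qed.

Lemma measurable_eball r : measurable (eball r : set 'rV[K]_n).
Proof.
have := measurable_enorm measurableT (measurable_itv `]-oo, r[).
by rewrite setTI; congr (measurable _); apply/seteqP; split => x; rewrite /= in_itv.
Qed.

Lemma lebesgue_eball_le r : 0 <= r ->
  (lebesgue_rV n (eball r) <= ((2 * r) ^+ n)%:E)%E.
Proof.
move=> r0; have mbox : measurable [set x : 'rV[K]_n | forall i, `]-r, r[%classic (x ord0 i)].
  rewrite [X in measurable X](_ : _ = \bigcap_(i in [set: 'I_n])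
      (rV_coord i @^-1` `]-r, r[%classic)).
    apply: fin_bigcap_measurable => // i _.
    by rewrite -[X in measurable X]setTI; exact: measurable_rV_coord.
  by apply/seteqP; split => [v Av i _|v Av i]; exact: Av.
apply: (@le_trans _ _ (lebesgue_rV n [set x : 'rV[K]_n | forall i, `]-r, r[%classic (x ord0 i)])).
  apply: le_measure; rewrite ?inE//; first exact: measurable_eball.
  move=> x; rewrite /eball/= => xr i; rewrite in_itv/= -ltr_norml.
  exact: le_lt_trans (enorm_coord x i) xr.
rewrite (lebesgue_rV_box (A := fun=> `]-r, r[%classic))//.
rewrite lebesgue_measure_itv/= lte_fin.
under eq_bigr => i _.
  have -> : (if - r < r then (r%:E - (- r)%:E)%E else 0%E) = (2 * r)%:E.
    case: ltP => [_|rr]; first by rewrite -EFinD; congr EFin; ring.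
    by congr EFin; move: rr r0; clear; lra.
  over.
by rewrite prodEFin prodr_const card_ord.
Qed.

(* Dominates [h] by a step function on the balls of radii [r0 * 2 ^ j]. *)
Lemma integral_radial_le h (R r0 : K) (c : nat -> K) J :
  measurable_fun setT h -> (forall s, 0 <= s -> 0 <= h s) ->
  (forall j, 0 <= c j) -> 0 <= r0 -> R <= r0 * 2 ^+ J ->
  (forall s, 0 <= s < R -> s < r0 -> h s <= c 0%N) ->
  (forall j s, 0 <= s < R -> r0 * 2 ^+ j <= s < r0 * 2 ^+ j.+1 -> h s <= c j.+1) ->
  (\int[lebesgue_rV n]_(x in eball R) (h (enorm x))%:E <=
    (\sum_(j < J.+1) c j * (2 * (r0 * 2 ^+ j)) ^+ n)%:E)%E.
Proof.
move=> mh h0 c0 r00 RJ hc0 hc.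
pose B j : set 'rV[K]_n := eball (r0 * 2 ^+ j).
have mB j : measurable (B j) by exact: measurable_eball.
pose f j x : \bar K := ((c j)%:E * (\1_(B j) x)%:E)%E.
have mI j : measurable_fun (eball R) (fun x => (\1_(B j) x)%:E : \bar K).
  by apply/measurable_EFinP; exact: measurable_indic.
have mf j : measurable_fun (eball R) (f j) by exact: measurable_funeM.
have f0 j x : (0 <= f j x)%E by rewrite mule_ge0// lee_fin.
have mR := measurable_eball R.
apply: (@le_trans _ _ (\int[lebesgue_rV n]_(x in eball R) (\sum_(j < J.+1) f j x))%E).
  apply: ge0_le_integral => //.
  - by move=> x _; rewrite lee_fin h0// enorm_ge0.
  - apply/measurable_EFinP; apply: measurable_funTS.
    exact: (measurableT_comp mh measurable_enorm).
  - exact: emeasurable_sum.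
  - move=> x; rewrite /eball/= => xR.
    have xR' : 0 <= enorm x < R by rewrite enorm_ge0.
    have pick (j : 'I_J.+1) : B j x -> h (enorm x) <= c j ->
        ((h (enorm x))%:E <= \sum_(j < J.+1) f j x)%E.
      move=> Bj hj; rewrite (bigD1 j)//=; apply: lee_paddr.
        by apply: sume_ge0 => i _; exact: f0.
      by rewrite /f indicE mem_set// mule1 lee_fin.
    have [xr0|r0x] := ltP (enorm x) r0.
      by apply: (pick ord0); [rewrite /B/eball/= mulr1|exact: hc0].
    have [j jJ /andP[jx xj]] : exists2 j, (j < J)%N &
        r0 * 2 ^+ j <= enorm x < r0 * 2 ^+ j.+1.
      have : enorm x < r0 * 2 ^+ J by exact: lt_le_trans RJ.
      elim: J {RJ pick} => [|j IH xj]; first by rewrite mulr1 ltNge r0x.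
      have [xj'|jx] := ltP (enorm x) (r0 * 2 ^+ j).
        by have [i ij iP] := IH xj'; exists i => //; rewrite ltnW.
      by exists j => //; rewrite jx.
    apply: (pick (Ordinal (jJ : j.+1 < J.+1)%N)); first exact: xj.
    by apply: hc => //; rewrite jx.
rewrite ge0_integral_sum// -sumEFin; apply: lee_sum => j _.
rewrite ge0_integralZl ?lee_fin//.
rewrite integral_indic// EFinM; apply: lee_wpmul2l; first by rewrite lee_fin.
apply: (@le_trans _ _ (lebesgue_rV n (B j))).
  by apply: le_measure; rewrite ?inE//; exact: measurableI.
by apply: lebesgue_eball_le; rewrite mulr_ge0// exprn_ge0.
Qed.

End radial_integral.

Section bubble_distance.
Context {K : realType} (n : nat).
Hypothesis n_gt1 : (1 < n)%N.

Let n_gt0 : (0 < n)%N. Proof. exact: ltnW. Qed.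
Let n0 : 0 < n%:R :> K. Proof. by rewrite ltr0n. Qed.
Let N0 : 0 < n.+2%:R :> K. Proof. by rewrite ltr0n. Qed.

(** For lambda = sqrt(D) / kappa with D = N (N - 2), the quotient lambda / (lambda^2 + s^2) is kappa
    / sqrt(D) divided by 1 + (kappa s)^2 / D; the powers of D then cancel. *)
Lemma bubble_profile (kappa : K) (x : 'rV[K]_n.+2) : 0 < kappa ->
  bubble (Num.sqrt (n.+2%:R * n%:R) / kappa) x =
  kappa `^ (n%:R / 2) * profile n (kappa * enorm x).
Proof.
move=> k0; rewrite /bubble /profile.
have -> : n.+2%:R - 2 = n%:R :> K by rewrite -addn2 natrD addrK.
set D : K := n.+2%:R * n%:R; have D0 : 0 < D by exact: mulr_gt0.
set c := Num.sqrt D; have c0 : 0 < c by rewrite sqrtr_gt0.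
have c2 : c ^+ 2 = D by rewrite sqr_sqrtr// ltW.
set s := enorm x; set b := 1 + (kappa * s) ^+ 2 / D.
have b0 : 0 < b by rewrite ltr_wpDr// divr_ge0 ?sqr_ge0// ltW.
have -> : c / kappa / ((c / kappa) ^+ 2 + s ^+ 2) = kappa * (c * b)^-1.
  have b0' : D + (kappa * s) ^+ 2 != 0 by rewrite gt_eqF// ltr_wpDr// sqr_ge0.
  have -> : b = (D + (kappa * s) ^+ 2) / D by rewrite /b; field; rewrite gt_eqF.
  have h1 : c ^+ 2 + (kappa * s) ^+ 2 != 0 by rewrite c2.
  by rewrite -c2; field; rewrite h1 !gt_eqF.
have cb0 : 0 < c * b by exact: mulr_gt0.
have cD : c = D `^ 2^-1 by rewrite powR12_sqrt// ltW.
rewrite powRM ?invr_ge0 ?(ltW k0) ?(ltW cb0)//.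
rewrite -[(c * b)^-1]powR_inv1 ?(ltW cb0)// -powRrM mulN1r.
rewrite (powRM _ (ltW c0) (ltW b0)).
rewrite [in c `^ _]cD.
rewrite -powRrM.
rewrite (_ : 2^-1 * - (n%:R / 2) = - (n%:R / 4)); last by field.
rewrite (powRN D); field; rewrite gt_eqF// powR_gt0//.
Qed.

Lemma continuous_profile_slope : continuous (profile_slope n : K -> K).
Proof.
move=> s; have b0 : 0 < 1 + s ^+ 2 / (n.+2%:R * n%:R) :> K.
  by rewrite ltr_wpDr// divr_ge0 ?sqr_ge0// mulr_ge0.
apply: (@is_derive_continuous _ _ _ _ _).
by rewrite /profile_slope; derive_rec.
Qed.

Lemma sum_geometric_half (J : nat) : \sum_(j < J) (2 ^- j : K) <= 2.
Proof.
have : \sum_(j < J) (2 ^- j : K) = 2 - 2 * 2 ^- J.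
  elim: J => [|J IH]; first by rewrite big_ord0 expr0 invr1; ring.
  by rewrite big_ord_recr/= IH exprS invfM; field; rewrite expf_neq0.
by move=> ->; rewrite lerBlDr lerDl mulr_ge0// invr_ge0 exprn_ge0.
Qed.

Variables (kappa rho : K) (w k : K -> K).
Hypothesis dw : forall s : K, 0 <= s -> is_derive s 1 w (s * k s).
Hypotheses (cw : continuous w) (ck : continuous k).
Hypothesis kappa1 : 1 <= kappa.

Let z s := rho * w s - profile n s.
Let kz s := rho * k s - profile_slope n s.

Let kappa0 : 0 < kappa. Proof. exact: lt_le_trans kappa1. Qed.

Let dz (s : K) : 0 <= s -> is_derive s 1 z (s * kz s).
Proof.
move=> s0; have := is_derive_sub (is_derive_mul (is_derive_const rho s) (dw s0))
  (is_derive_profile n_gt0 s).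
by move/is_derive_ext; apply; rewrite /kz; ring.
Qed.

Let cz : continuous z.
Proof.
move=> s; apply: (@continuousB _ K^o _ (fun s => rho * w s) (profile n) s).
  by apply: continuous_at_mul; [exact: cst_continuous|exact: cw].
exact: is_derive_continuous (is_derive_profile n_gt0 s).
Qed.

Let ckz : continuous kz.
Proof.
move=> s; apply: (@continuousB _ K^o _ (fun s => rho * k s) (profile_slope n) s).
  by apply: continuous_at_mul; [exact: cst_continuous|exact: ck].
exact: continuous_profile_slope.
Qed.

(** The density of the squared H^1 norm of kappa^(n/2) z(kappa |x|). Its factor kappa^N is
    compensated by the volume of balls measured in the variable kappa |x|; the L^2 part keeps a
    factor kappa^-2. *)
Let h (s : K) : K := kappa ^+ n.+2 *
  ((kappa * s * kz (kappa * s)) ^+ 2 + kappa ^- 2 * z (kappa * s) ^+ 2).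

Let mh : measurable_fun setT h.
Proof.
have mk : measurable_fun [set: K] (fun s => kappa * s).
  apply: continuous_measurable_fun => s.
  by apply: continuous_at_mul; [exact: cst_continuous|exact: cvg_id].
have mc (f : K -> K) : continuous f -> measurable_fun [set: K] (fun s => f (kappa * s)).
  by move=> cf; apply: (measurableT_comp (f := f)) => //; exact: continuous_measurable_fun.
apply: measurable_funM => //; apply: measurable_funD.
  by apply: measurable_funX; apply: measurable_funM => //; exact: mc.
by apply: measurable_funM => //; apply: measurable_funX; exact: mc.
Qed.

Let integrand (x : 'rV[K]_n.+2) :
  let v := fun x : 'rV[K]_n.+2 => kappa `^ (n%:R / 2) * z (kappa * enorm x) in
  \sum_i partial i v x ^+ 2 + v x ^+ 2 = h (enorm x).
Proof.
move=> v.
have dg (s : K) : 0 <= s -> is_derive s 1 (fun s => kappa `^ (n%:R / 2) * z (kappa * s))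
    (s * (kappa `^ (n%:R / 2) * kappa ^+ 2 * kz (kappa * s))).
  move=> s0; have := is_derive_rescale (kappa `^ (n%:R / 2)) (dz (mulr_ge0 (ltW kappa0) s0)).
  by move/is_derive_ext; apply; ring.
under eq_bigr do rewrite (partial_radial dg) exprMn.
rewrite -mulr_sumr -enorm_sqr /v /h !exprMn.
have -> : (kappa `^ (n%:R / 2)) ^+ 2 = kappa ^+ n.
  rewrite -powR_mulrn ?powR_ge0// -powRrM divfK ?pnatr_eq0//.
  by rewrite powR_mulrn// ltW.
by rewrite !exprS; field; rewrite gt_eqF.
Qed.

(** On the annulus kappa |x| of order tau = M 2^j the gradient part contributes at most a multiple
    of tau^(-n) <= 1 / tau, summing to the term 2 / M. The L^2 part contributes kappa^-2 tau^(2-n)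
    <= kappa^-2 per annulus, with no gain in j when N = 4, so it is multiplied by the number of
    annuli. *)
Lemma H1norm_bubble_le (R M eta B : K) : 0 < R -> 1 <= M -> 0 <= eta ->
  (forall s, 0 <= s <= M -> `|z s| <= eta /\ `|kz s| <= eta) ->
  (forall s, M <= s <= kappa * R ->
    s ^+ n * `|z s| <= B /\ s ^+ n.+2 * `|kz s| <= B) ->
  (H1norm R (fun x : 'rV[K]_n.+2 => kappa `^ (n%:R / 2) * (rho * w (kappa * enorm x))
      - bubble (Num.sqrt (n.+2%:R * n%:R) / kappa) x)%R <=
   sqrte (eta ^+ 2 * (M ^+ 2 + 1) * (2 * M) ^+ n.+2 +
     4 ^+ n.+2 * B ^+ 2 * (2 / M + (kappa * R + 1) / kappa ^+ 2))%R%:E)%E.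
Proof.
move=> R0 M1 eta0 near tail; have M0 : 0 < M by exact: lt_le_trans M1.
pose v (x : 'rV[K]_n.+2) := kappa `^ (n%:R / 2) * z (kappa * enorm x).
have -> : (fun x : 'rV[K]_n.+2 => kappa `^ (n%:R / 2) * (rho * w (kappa * enorm x))
      - bubble (Num.sqrt (n.+2%:R * n%:R) / kappa) x) = v.
  by apply/funext => x; rewrite bubble_profile// /v /z mulrBr.
rewrite /H1norm; pose tau j : K := M * 2 ^+ j.
have tau1 j : 1 <= tau j.
  by rewrite (le_trans M1)// ler_peMr ?(ltW M0)// exprn_ege1// ler1n.
have tau0 j : 0 < tau j by exact: lt_le_trans (tau1 j).
pose c j := kappa ^+ n.+2 * (if j is i.+1 then
  B ^+ 2 * (tau i ^- n.+1.*2 + kappa ^- 2 * tau i ^- n.*2) else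
  eta ^+ 2 * (M ^+ 2 + 1)).
have kn0 : 0 <= kappa ^+ n.+2 by rewrite exprn_ge0// ltW.
have c0 j : 0 <= c j.
  rewrite mulr_ge0//; case: j => [|j].
    by rewrite mulr_ge0 ?sqr_ge0// addr_ge0 ?sqr_ge0.
  by rewrite mulr_ge0 ?sqr_ge0// addr_ge0 ?mulr_ge0 ?invr_ge0 ?exprn_ge0// ltW.
have k21 : kappa ^- 2 <= 1 by rewrite invf_le1 ?exprn_gt0// exprn_ege1.
have k20 : 0 <= kappa ^- 2 by rewrite invr_ge0 exprn_ge0// ltW.
have sqr_le (a b : K) : `|a| <= b -> a ^+ 2 <= b ^+ 2.
  move=> ab; rewrite -(real_normK (num_real a)) ler_sqr ?nnegrE//.
  exact: le_trans ab.
(* A logarithmic number of annuli would cover the ball; the linear count avoids logarithms, and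
   (kappa R + 1) / kappa^2 still tends to 0. *)
pose J := (Num.truncn (kappa * R)).+1.
have kR0 : 0 <= kappa * R by rewrite mulr_ge0// ltW.
have JR : kappa * R < J%:R by have /andP[] := truncn_itv kR0.
have RJ : J%:R <= kappa * R + 1 by have /andP[? _] := truncn_itv kR0; rewrite -natr1 lerD2r.
have J2 : (J%:R : K) <= 2 ^+ J by rewrite -natrX ler_nat ltnW// ltn_expl.
have hc0 s : 0 <= s < R -> s < M / kappa -> h s <= c 0%N.
  move=> /andP[s0 sR]; rewrite ltr_pdivlMr// mulrC => sM.
  have ks0 : 0 <= kappa * s by rewrite mulr_ge0// ltW.
  have [|z1 z2] := near (kappa * s); first by rewrite ks0 ltW.
  rewrite /h /c; apply: ler_wpM2l => //.
  rewrite (_ : eta ^+ 2 * _ = M ^+ 2 * eta ^+ 2 + eta ^+ 2); last by ring.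
  apply: lerD.
    rewrite exprMn; apply: ler_pM; rewrite ?sqr_ge0 ?sqr_le//.
    by rewrite ger0_norm// ltW.
  apply: le_trans (sqr_le _ _ z1); rewrite ler_piMl ?sqr_ge0//.
have hc j s : 0 <= s < R -> M / kappa * 2 ^+ j <= s < M / kappa * 2 ^+ j.+1 ->
    h s <= c j.+1.
  move=> /andP[s0 sR] /andP[js _].
  have ts : tau j <= kappa * s.
    by move: js; rewrite mulrAC ler_pdivrMr// [s * _]mulrC.
  have ks0 : 0 < kappa * s by exact: lt_le_trans ts.
  have [|z1 z2] := tail (kappa * s).
    rewrite ler_pM2l// (ltW sR) andbT (le_trans _ ts)//.
    by rewrite ler_peMr ?(ltW M0)// exprn_ege1// ler1n.
  have B0 : 0 <= B by apply: le_trans z1; rewrite mulr_ge0// exprn_ge0// ltW.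
  have inv m : (kappa * s) ^- m <= tau j ^- m.
    by rewrite lef_pV2 ?posrE ?exprn_gt0// lerXn2r ?nnegrE// ltW.
  have bound m (a : K) : (kappa * s) ^+ m * `|a| <= B -> a ^+ 2 <= B ^+ 2 * tau j ^- m.*2.
    rewrite mulrC -ler_pdivlMr ?exprn_gt0// => aB.
    rewrite -muln2 exprM -exprVn -exprMn; apply: sqr_le; apply: (le_trans aB).
    exact: ler_wpM2l.
  rewrite /h /c; apply: ler_wpM2l => //; rewrite [leRHS]mulrDr; apply: lerD.
    apply: bound; rewrite normrM (ger0_norm (ltW ks0)) mulrA -exprSr//.
  rewrite [leRHS]mulrCA; apply: ler_wpM2l => //; exact: bound.
have intle := @integral_radial_le K n.+2 h R (M / kappa) c J mh _ c0 _ _ hc0 hc.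
rewrite lee_sqrt; last first.
  have B0 : 0 <= B ^+ 2 by exact: sqr_ge0.
  rewrite lee_fin; apply: addr_ge0.
    apply: mulr_ge0; first by rewrite mulr_ge0 ?sqr_ge0// addr_ge0 ?sqr_ge0.
    by rewrite exprn_ge0// mulr_ge0// ltW.
  apply: mulr_ge0; first by rewrite mulr_ge0// exprn_ge0.
  apply: addr_ge0; first by rewrite divr_ge0// ltW.
  by rewrite divr_ge0 ?exprn_ge0 ?addr_ge0// ltW.
under eq_integral do rewrite integrand.
have r00 : 0 <= M / kappa by rewrite divr_ge0// ltW.
have h0 s : 0 <= s -> 0 <= h s.
  by move=> s0; rewrite mulr_ge0// addr_ge0 ?sqr_ge0// mulr_ge0// sqr_ge0.
have RJ2 : R <= M / kappa * 2 ^+ J.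
  rewrite mulrAC ler_pdivlMr// mulrC (le_trans (ltW JR))// (le_trans J2)//.
  by rewrite ler_peMl// exprn_ge0.
apply: (le_trans (intle h0 r00 RJ2)).
rewrite lee_fin big_ord_recl/=; apply: lerD.
  rewrite expr0 mulr1 mulrA expr_div_n /c le_eqVlt; apply/orP; left; apply/eqP.
  by field; rewrite expf_neq0// gt_eqF.
have term j : c j.+1 * (2 * (M / kappa * 2 ^+ j.+1)) ^+ n.+2 <=
    4 ^+ n.+2 * B ^+ 2 * (M^-1 * 2 ^- j + kappa ^- 2).
  have -> : 2 * (M / kappa * 2 ^+ j.+1) = 4 * tau j / kappa.
    by rewrite /tau exprS; ring.
  have -> : c j.+1 * (4 * tau j / kappa) ^+ n.+2 = 4 ^+ n.+2 * B ^+ 2 *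
      (tau j ^+ n.+2 * (tau j ^- n.+1.*2 + kappa ^- 2 * tau j ^- n.*2)).
    have gen (a b x t u : K) : a != 0 -> a * (b * t) * (x * u / a) = x * b * (u * t).
      by move=> a0; field.
    rewrite /c expr_div_n [(4 * tau j) ^+ _]exprMn; apply: gen.
    by rewrite expf_neq0// gt_eqF.
  apply: ler_wpM2l; first by rewrite mulr_ge0 ?sqr_ge0// exprn_ge0.
  have -> : M^-1 * 2 ^- j = (tau j)^-1 by rewrite -invfM.
  rewrite mulrDr; apply: lerD.
    have -> : tau j ^+ n.+2 * tau j ^- n.+1.*2 = tau j ^- n.
      have -> : n.+1.*2 = (n.+2 + n)%N by rewrite doubleS -addnn.
      by rewrite exprD; field; rewrite !expf_neq0// gt_eqF.
    rewrite lef_pV2 ?posrE ?exprn_gt0//.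
    by rewrite -[leLHS]expr1; apply: ler_weXn2l.
  rewrite mulrCA ler_piMr//.
  rewrite ler_pdivrMr ?exprn_gt0// mul1r; apply: ler_weXn2l => //.
  by rewrite -addnn -addn2 leq_add2l.
apply: le_trans (ler_sum _ (fun (j : 'I_J) _ => term j)) _.
rewrite -mulr_sumr; apply: ler_wpM2l.
  by rewrite mulr_ge0 ?sqr_ge0// exprn_ge0.
rewrite big_split/= -mulr_sumr sumr_const card_ord; apply: lerD.
  by rewrite mulrC ler_wpM2r ?invr_ge0 ?(ltW M0)//; exact: sum_geometric_half.
by rewrite -[leLHS]mulr_natl ler_wpM2r.
Qed.

End bubble_distance.

(* The amplitude of the rescaled solution and that of the bubble differ by a
   power of [d] whose exponent is [O(d)]. *)
Lemma amplitude_ratio (K : realType) (n : nat) (eta : K) : (1 < n)%N -> 0 < eta ->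
  exists2 d0 : K, 0 < d0 &
  forall d dl, 0 < d < d0 -> 0 < dl < d -> d <= 1 -> n%:R * d <= 1 / 4 ->
    1 <= (d ^- 2) `^ (2 / (crit_power n - dl - 1) - n%:R / 2) <= 1 + eta.
Proof.
move=> n_gt1 eta0; have n0 : 0 < n%:R :> K by rewrite ltr0n ltnW.
 have l0 : 0 < ln (1 + eta) by rewrite ln_gt0// ltrDl.
pose m : K := 4 * n%:R ^+ 2; have m0 : 0 < m by rewrite mulr_gt0 ?exprn_gt0.
(* The exponent is at most n^2 d, and ln(d^-2) = 4 ln(d^(-1/2)) <= 4 d^(-1/2). The logarithm of the
   ratio is thus at most m sqrt(d), below ln(1 + eta) for d under this threshold. *)
exists ((ln (1 + eta) / m) ^+ 2); first by rewrite exprn_gt0// divr_gt0.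
move=> d dl /andP[d0 dd0] /andP[dl0 dld] d1 nd.
have q0 : 3 <= 4 - n%:R * dl.
  have : n%:R * dl <= n%:R * d by rewrite ler_pM2l// ltW.
  by move: nd; clear; lra.
set E := (X in _ `^ X).
have EE : E = n%:R ^+ 2 * dl / (2 * (4 - n%:R * dl)).
  rewrite /E /crit_power.
  have h1 : 4 - n%:R * dl != 0 by rewrite gt_eqF//; move: q0; clear; lra.
  have -> : 1 + 4 / n%:R - dl - 1 = (4 - n%:R * dl) / n%:R by field; rewrite gt_eqF.
  by field; rewrite h1 gt_eqF.
have E0 : 0 <= E.
  rewrite EE divr_ge0//; first by rewrite mulr_ge0 ?exprn_ge0 ?(ltW n0) ?(ltW dl0).
  by rewrite mulr_ge0//; move: q0; clear; lra.
have Ed : E <= n%:R ^+ 2 * d.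
  rewrite EE ler_pdivrMr; last by rewrite mulr_gt0//; move: q0; clear; lra.
  have n20 : 0 <= n%:R ^+ 2 :> K by exact: sqr_ge0.
  rewrite -[leRHS]mulrA; apply: ler_wpM2l => //; apply: (le_trans (ltW dld)).
  rewrite ler_peMr ?(ltW d0)//.
  by move: q0; clear; lra.
have dm2 : 1 <= d ^- 2 by rewrite -invr1 lef_pV2 ?posrE ?exprn_gt0// exprn_ile1// ltW.
rewrite -[X in X <= _](powRr0 (d ^- 2)) ler_powR//=.
have dm0 : 0 < d ^- 2 by exact: lt_le_trans dm2.
rewrite /powR (gt_eqF dm0) -[leRHS]lnK ?posrE ?ltr_wpDl// ler_expR.
have s0 : 0 < Num.sqrt d by rewrite sqrtr_gt0.
have sd : Num.sqrt d ^+ 2 = d by rewrite sqr_sqrtr// ltW.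
have lnd : ln (d ^- 2) <= 4 / Num.sqrt d.
  have -> : d ^- 2 = ((Num.sqrt d)^-1) ^+ 4 by rewrite -[in LHS]sd exprVn -exprM.
  rewrite lnXn ?invr_gt0// -[leLHS]mulr_natl ler_wpM2l//.
  by rewrite ltW// ln_sublinear// invr_gt0.
apply: (@le_trans _ _ (n%:R ^+ 2 * d * (4 / Num.sqrt d))).
  by apply: ler_pM => //; rewrite ln_ge0.
have -> : n%:R ^+ 2 * d * (4 / Num.sqrt d) = m * Num.sqrt d.
  have gen (t : K) : t != 0 -> n%:R ^+ 2 * t ^+ 2 * (4 / t) = m * t.
    by move=> t0; rewrite /m; field.
  by rewrite -[X in _ * X * _]sd gen// gt_eqF.
rewrite mulrC -ler_pdivlMr//.
have lm0 : 0 <= ln (1 + eta) / m by rewrite divr_ge0 ?ltW.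
by rewrite -[leRHS]ger0_norm// -sqrtr_sqr ler_wsqrtr// ltW.
Qed.

Lemma profile_slope_norm_le1 (K : realType) (n : nat) (s : K) : (0 < n)%N ->
  `|profile_slope n s| <= 1.
Proof.
move=> n_gt0; have N0 : 0 < n.+2%:R :> K by rewrite ltr0n.
rewrite ltr0_norm ?profile_slope_lt0// profile_slopeE// opprK.
have b1 : 1 <= 1 + s ^+ 2 / (n.+2%:R * n%:R) :> K.
  by rewrite lerDl divr_ge0 ?sqr_ge0// mulr_ge0 ?ltW.
have N1 : n.+2%:R^-1 <= 1 :> K by rewrite invf_le1// ler1n.
rewrite mulr_ile1 ?invr_ge0 ?(ltW N0)//.
  by rewrite divr_ge0 ?ltW ?profile_gt0// (lt_le_trans _ b1).
rewrite ler_pdivrMr ?(lt_le_trans _ b1)// mul1r.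
exact: le_trans (profile_le1 _ _) b1.
Qed.

(** The squared H^1 distance splits into three parts, each made smaller than eta^2 / 3: the gradient
    tail by M, the core by [e1], the mass tail by d. *)
Lemma bubbling_solution (K : realType) (n : nat) (R eta : K) : (1 < n)%N -> 0 < R -> 0 < eta ->
  exists (p : K) (u : 'rV[K]_n.+2 -> K) (lam : K),
  [/\ critical_exponent K n.+2 - eta < p < critical_exponent K n.+2,
      positive_radial_solution R p u, 0 < lam < eta &
      (H1norm R (fun x => u x - bubble lam x)%R < eta%:E)%E].
Proof.
move=> n_gt1 R0 eta0; have n_gt0 : (0 < n)%N by exact: ltnW.
have n0 : 0 < n%:R :> K by rewrite ltr0n.
have N0 : 0 < n.+2%:R :> K by rewrite ltr0n.
 have [C [M0 [M01 [dS dS0 HS]]]] := shooting n_gt1 R0.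
pose D : K := n.+2%:R * n%:R; have D0 : 0 < D by exact: mulr_gt0.
(* Bounds the decay of both the solution, multiplied by the amplitude ratio [rho <= 2], and the
   profile. *)
pose B := `|C| * 2 + D `^ (n%:R / 2 + 1).
pose F : K := 4 ^+ n.+2 * B ^+ 2.
have F0 : 0 <= F by rewrite mulr_ge0 ?sqr_ge0// exprn_ge0.
have e20 : 0 < eta ^+ 2 by rewrite exprn_gt0.
pose M := M0 + 6 * F / eta ^+ 2.
have M0M : M0 <= M by rewrite lerDl divr_ge0 ?(ltW e20)// mulr_ge0.
have M1 : 1 <= M by exact: le_trans M0M.
have Mpos : 0 < M by exact: lt_le_trans M1.
have FM : F * (2 / M) < eta ^+ 2 / 3.
  have : 6 * F < eta ^+ 2 * M.
    have -> : eta ^+ 2 * M = eta ^+ 2 * M0 + 6 * F by rewrite /M; field; rewrite gt_eqF.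
    rewrite ltrDr mulr_gt0//.
    exact: lt_le_trans M01.
  by move=> h; rewrite [ltLHS]mulrA ltr_pdivrMr//; move: h; clear; lra.
pose A := (M ^+ 2 + 1) * (2 * M) ^+ n.+2.
have A0 : 0 < A by rewrite mulr_gt0 ?exprn_gt0 ?mulr_gt0// ltr_wpDl// sqr_ge0.
pose e1 := Num.min 1 (eta ^+ 2 / (4 * A)).
have e10 : 0 < e1 by rewrite lt_min ltr01 divr_gt0// mulr_gt0.
have e11 : e1 <= 1 by rewrite ge_min lexx.
have e1A : e1 ^+ 2 * A < eta ^+ 2 / 3.
  have h1 : e1 ^+ 2 * A <= e1 * A by rewrite ler_pM2r// expr2 ler_piMr// ltW.
  have : e1 * A <= eta ^+ 2 / 4.
    have : e1 <= eta ^+ 2 / (4 * A) by rewrite ge_min lexx orbT.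
    have A40 : 0 < 4 * A by exact: mulr_gt0.
    rewrite (ler_pdivlMr _ _ A40) => h.
    have -> : e1 * A = e1 * (4 * A) / 4 by field.
    by rewrite ler_wpM2r.
  by move: h1 e20; clear; lra.
have e140 : 0 < e1 / 4 by rewrite divr_gt0.
have [dN dN0 HN] := near_profile n_gt1 (ltW Mpos) e140.
have [dA dA0 HA] := amplitude_ratio n_gt1 e140.
pose dF := eta ^+ 2 / (3 * F * (R + 1) + 1).
have dFd : 0 < 3 * F * (R + 1) + 1.
  apply: ltr_wpDl => //; apply: mulr_ge0; first exact: mulr_ge0.
  by rewrite addr_ge0// ltW.
have dF0 : 0 < dF by rewrite divr_gt0.
have sD0 : 0 < Num.sqrt D + 1 by rewrite ltr_wpDl// sqrtr_ge0.
pose dL := eta / (Num.sqrt D + 1).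
have dL0 : 0 < dL by rewrite divr_gt0.
(* The thresholds serve, in order, the existence of the solution, closeness on the core, the
   amplitude, the mass tail, the size of lambda and the distance of p to the critical exponent. *)
pose d := Num.min dS (Num.min dN (Num.min dA (Num.min dF (Num.min dL eta)))) / 2.
have mpos : 0 < Num.min dS (Num.min dN (Num.min dA (Num.min dF (Num.min dL eta)))).
  by rewrite !lt_min dS0 dN0 dA0 dF0 dL0.
have d0 : 0 < d by rewrite divr_gt0.
have : d < Num.min dS (Num.min dN (Num.min dA (Num.min dF (Num.min dL eta)))).
  by rewrite /d; move: mpos; clear; lra.
clearbody d; rewrite !lt_min => /and5P[ddS ddN ddA ddF /andP[ddL deta]].
have [|d1 nd [dl [w [k [dld wk kS wpos [_ tail]]]]]] := HS d; first by rewrite d0.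
have /andP[dl0 dld'] := dld.
have dlw : 0 <= dl <= d by rewrite !ltW.
have [|ndl q1 q3] := @crit_power_range K n dl n_gt1 (ltW dl0).
  by apply: le_trans nd; rewrite ler_pM2l// ltW.
set q := crit_power n - dl in ndl q1 q3 wk.
pose kappa := d ^- 2.
have kappa0 : 0 < kappa by rewrite invr_gt0 exprn_gt0.
have kappa1 : 1 <= kappa by rewrite -invr1 lef_pV2 ?posrE ?exprn_gt0// exprn_ile1// ltW.
pose rho := kappa `^ (2 / (q - 1) - n%:R / 2).
pose alpha := kappa `^ (2 / (q - 1)).
have /andP[rho1 rhoe] : 1 <= rho <= 1 + e1 / 4 by apply: HA => //; rewrite d0.
have alphaE : alpha = kappa `^ (n%:R / 2) * rho.
  by rewrite -powRD_pos//; congr (_ `^ _); ring.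
have kR : kappa * R = R / d ^+ 2 by rewrite mulrC.
exists (q + 1), (fun x => alpha * w (kappa * enorm x)), (Num.sqrt D / kappa).
split.
- rewrite /critical_exponent.
  have -> : 2 * n.+2%:R / (n.+2%:R - 2) = 2 + 4 / n%:R :> K.
    have -> : n.+2%:R = n%:R + 2 :> K by rewrite -addn2 natrD.
    by rewrite addrK; field; rewrite gt_eqF.
  rewrite /q /crit_power; set i := _ / n%:R.
  by apply/andP; split; move: dl0 dld' deta; clear; lra.
- apply: (@rescaled_solution _ _ _ (d ^+ 4) _ _ _ k) => //.
  + by rewrite (ltW q1).
  + by rewrite exprn_ge0 ?exprn_ile1// ltW.
  + by rewrite powR_gt0.
  + have q10 : q - 1 != 0 by rewrite gt_eqF// subr_gt0.
    by rewrite -powRrM divfK// powR_mulrn// ltW.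
  + by rewrite /kappa; field; rewrite gt_eqF.
  + by rewrite kR.
  + by rewrite kR.
- rewrite divr_gt0 ?sqrtr_gt0//= /kappa invrK.
  have h1 : Num.sqrt D * d ^+ 2 <= (Num.sqrt D + 1) * d.
    apply: ler_pM; rewrite ?sqrtr_ge0 ?sqr_ge0 ?lerDl//.
    by rewrite expr2 ler_piMr// ltW.
  apply: (le_lt_trans h1); rewrite mulrC.
  by move: ddL; rewrite ltr_pdivlMr.
have cw : continuous w by exact: flow_cw wk.
have ck : continuous k by move=> x; exact: (flow_ck (s := x) wk).
have dw (s : K) : 0 <= s -> is_derive s 1 w (s * k s) by exact: flow_dw wk.
have -> : (fun x : 'rV[K]_n.+2 => alpha * w (kappa * enorm x) - bubble (Num.sqrt D / kappa) x) =
    (fun x : 'rV[K]_n.+2 => kappa `^ (n%:R / 2) * (rho * w (kappa * enorm x))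
      - bubble (Num.sqrt D / kappa) x).
  by apply/funext => x; rewrite alphaE mulrA.
have dist (c a b : K) : `|c * a - b| <= `|c - 1| * `|a| + `|a - b|.
  have -> : c * a - b = (c - 1) * a + (a - b) by ring.
  by apply: le_trans (ler_normD _ _) _; rewrite normrM.
have rn : `|rho - 1| <= e1 / 4 by rewrite ger0_norm ?subr_ge0// lerBlDl.
have near s : 0 <= s <= M -> `|rho * w s - profile n s| <= e1 /\
    `|rho * k s - profile_slope n s| <= e1.
  move=> sM; have [|nk nw] := HN d dl w k _ dlw d1 nd wk s sM; first by rewrite d0.
  have close (a b : K) : `|b| <= 1 -> `|a - b| <= e1 / 4 -> `|rho * a - b| <= e1.
    move=> b1 ab; apply: (le_trans (dist _ _ _)).
    have a2 : `|a| <= 2.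
      have := ler_normD (a - b) b; rewrite subrK.
      by move: b1 ab e11; clear; lra.
    have : `|rho - 1| * `|a| <= e1 / 4 * 2 by exact: ler_pM.
    by move: ab e10; clear; lra.
  split; apply: close => //; last exact: profile_slope_norm_le1.
  by rewrite ger0_norm ?profile_le1// ltW// profile_gt0.
have rho2 : rho <= 2 by move: rhoe e11; clear; lra.
have far s : M <= s <= kappa * R -> s ^+ n * `|rho * w s - profile n s| <= B /\
    s ^+ n.+2 * `|rho * k s - profile_slope n s| <= B.
  rewrite kR => /andP[Ms sS]; have s0 : 0 < s by exact: lt_le_trans Ms.
  have [|wC kC] := tail s; first by rewrite (le_trans M0M).
  have [|w0 k0] := wpos s; first by rewrite ltW.
  have combine m (a b : K) : 0 <= a -> 0 <= b -> s ^+ m * a <= C ->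
      s ^+ m * b <= D `^ (n%:R / 2 + 1) -> s ^+ m * `|rho * a - b| <= B.
    move=> a0 b0 aC bD; have sm : 0 <= s ^+ m by rewrite exprn_ge0// ltW.
    have h1 : `|rho * a - b| <= rho * a + b.
      have ra : 0 <= rho * a by rewrite mulr_ge0// (le_trans _ rho1).
      by apply/ler_normlP; split; move: ra b0; clear; lra.
    apply: (le_trans (ler_wpM2l sm h1)); rewrite mulrDr; apply: lerD => //.
    rewrite mulrCA mulrC; apply: ler_pM => //.
    - exact: mulr_ge0.
    - by rewrite (le_trans _ rho1).
    - exact: le_trans (ler_norm C).
  split; first by apply: combine; rewrite ?(ltW w0) ?(ltW (profile_gt0 _ _)) ?profile_decay.
  have -> : `|rho * k s - profile_slope n s| = `|rho * - k s - - profile_slope n s|.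
    by rewrite mulrN -opprD normrN.
  apply: combine; rewrite ?oppr_ge0 ?(ltW (profile_slope_lt0 _ _))//.
    by rewrite (mulrN _ (k s)).
  by rewrite (mulrN _ (profile_slope n s)) profile_flux.
apply: (le_lt_trans (H1norm_bubble_le n_gt1 dw cw ck kappa1 R0 M1 (ltW e10) near far)).
rewrite /= lte_fin -[ltRHS]gtr0_norm// -sqrtr_sqr ltr_sqrt//.
rewrite -mulrA -/A -/F mulrDr.
have small : F * ((kappa * R + 1) / kappa ^+ 2) < eta ^+ 2 / 3.
  have -> : (kappa * R + 1) / kappa ^+ 2 = d ^+ 2 * R + d ^+ 4.
    by rewrite /kappa; field; rewrite gt_eqF.
  have h1 : d ^+ 2 * R + d ^+ 4 <= d * (R + 1).
    rewrite mulrDr mulr1; apply: lerD.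
      by rewrite ler_wpM2r ?(ltW R0)// expr2 ler_piMr// ltW.
    by rewrite exprS ler_piMr ?(ltW d0)// exprn_ile1// ltW.
  have h2 := ler_wpM2l F0 h1.
  move: ddF; rewrite ltr_pdivlMr// => h3; move: h2 h3 d0; clear.
  have -> : d * (3 * F * (R + 1) + 1) = 3 * (F * (d * (R + 1))) + d by ring.
  lra.
by move: FM e1A small e20; clear; lra.
Qed.

Theorem theorem1p6 (K : realType) (N : nat) (R : K)
    (hN : (4 <= N)%N) (hR : 0 < R) :
  exists (p : nat -> K) (u : nat -> 'rV[K]_N -> K),
    [/\ forall k, p k < critical_exponent K N,
        p k @[k --> \oo] --> critical_exponent K N,
        forall k, positive_radial_solution R (p k) (u k) &
        type_B R u].
Proof.
case: N hN => [|[|n]]// n_gt1.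
have inv0 (k : nat) : 0 < k.+1%:R^-1 :> K by rewrite invr_gt0.
(* With tolerance 1 / (k + 1), each limit follows by squeezing against the harmonic sequence. *)
have /choice[p /choice[u /choice[lam H]]] k := bubbling_solution n_gt1 hR (inv0 k).
have squeeze (a : nat -> K) l : (forall k, l - k.+1%:R^-1 <= a k <= l + k.+1%:R^-1) ->
    a k @[k --> \oo] --> l.
  move=> al; apply: (@squeeze_cvgr _ _ _ _ (fun k => l - k.+1%:R^-1) (fun k => l + k.+1%:R^-1)).
  - by apply: nearW.
  - rewrite -[X in _ --> X]subr0; apply: cvgB; [exact: cvg_cst|exact: cvg_harmonic].
  - rewrite -[X in _ --> X]addr0; apply: cvgD; [exact: cvg_cst|exact: cvg_harmonic].
exists p, u; split.
- by move=> k; have [/andP[]] := H k.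
- apply: squeeze => k; have [/andP[pl pu] _ _ _] := H k.
  by rewrite !ltW//= (lt_trans pu)// ltrDl.
- by move=> k; have [] := H k.
exists lam; split.
- by move=> k; have [_ _ /andP[]] := H k.
- apply: squeeze => k; have [_ _ /andP[l0 lk] _] := H k.
  by rewrite sub0r add0r (ltW lk) andbT (le_trans _ (ltW l0))// oppr_le0 ltW.
apply: (@squeeze_cvge _ _ _ K (fun=> 0%E) _ (fun k => (k.+1%:R^-1)%:E)).
- apply: nearW => k; have [_ _ _ /ltW ->] := H k.
  by rewrite andbT sqrte_ge0.
- exact: cvg_cst.
- by apply: cvg_EFin; [exact: nearW|exact: cvg_harmonic].
Qed.
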